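(* Let $m,d,n\ge 1$ be integers and let $\{X_i\}_{i=1}^n$ be part of a stationary sequence $\{X_i\}_{i\in\mathbb{Z}}$ of $\mathbb{R}^d$-valued random vectors, with marginal law $P$, which is geometrically $\alpha$-mixing with $$\alpha(i)\le \gamma_1\exp(-\gamma_2 i)\quad\text{for all } i\ge 1,$$ where $\gamma_1,\gamma_2>0$ are constants. Let $f:(\mathbb{R}^d)^m\to\mathbb{R}$ be a symmetric kernel such that $f\in L_1(\mathbb{R}^{md})$, $f$ is continuous, and its Fourier transform $\widehat f$ satisfies $$\int_{\mathbb{R}^{md}}|\widehat f(u)|\,\|u\|^q\,du<\infty$$ for some $q\ge 1$. Then there exists a positive constant $C=C(m,\gamma_1,\gamma_2)$, depending only on $m,\gamma_1,\gamma_2$, such that for each $1\le p\le m$ and any $x>0$, $$\mathbb{P}\Big\{n^{-p}\max_{1\le k\le n}|V_k(f_p)|\ge x\Big\}\le 6\exp\left(-\frac{C\,n\,x^{2/p}}{A_{p,n}^{1/p}+x^{1/p}M_{p,n}^{1/p}}\right),$$ where $$A_{p,n}=2^{2m}\|\widehat f\|_{L_1}^2\left\{\frac{64\gamma_1^{1/3}}{1-\exp(-\gamma_2/3)}+\frac{(\log n)^4}{n}\right\}^p,\qquad M_{p,n}=2^m\|\widehat f\|_{L_1}(\log n)^{2p}.$$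
   Context: Strong mixing: for $\sigma$-algebras $\mathcal{A},\mathcal{B}$, $\alpha(\mathcal{A},\mathcal{B}):=\sup_{A\in\mathcal{A},B\in\mathcal{B}}|\mathbb{P}(A\cap B)-\mathbb{P}(A)\mathbb{P}(B)|$. For a stationary sequence $\{X_i\}_{i\in\mathbb{Z}}$, $\alpha(i):=\alpha(\sigma(X_j,j\le 0),\sigma(X_j,j\ge i))$ for $i\ge1$. Symmetric kernel: a real function $f(x_1,\dots,x_m)$ of $x_1,\dots,x_m\in\mathbb{R}^d$, invariant under permutations of its $m$ arguments. Hoeffding components: let $\widetilde X_1,\widetilde X_2,\dots$ be i.i.d. with law $P$ (the law of $X_1$), and $\theta:=\mathbb{E}f(\widetilde X_1,\dots,\widetilde X_m)$. Put $g_m:=f-\theta$ and, for $1\le p\le m-1$, $g_p(x_1,\dots,x_p):=\mathbb{E}f(x_1,\dots,x_p,\widetilde X_{p+1},\dots,\widetilde X_m)-\theta$. Then $f_1:=g_1$ and, recursively for $p=2,\dots,m$, $$f_p(x_1,\dots,x_p):=g_p(x_1,\dots,x_p)-\sum_{k=1}^p f_1(x_k)-\dots-\sum_{1\le k_1<\dots<k_{p-1}\le p}f_{p-1}(x_{k_1},\dots,x_{k_{p-1}}).$$ For $1\le p\le m$, $1\le k\le n$: $V_k(f_p):=\sum_{i_1,\dots,i_p=1}^k f_p(X_{i_1},\dots,X_{i_p})$. Fourier transform on $\mathbb{R}^D$ (here $D=md$): $\widehat g(u):=\int_{\mathbb{R}^D}g(x)e^{-2\pi i u^\top x}dx$ for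 $g\in L_1(\mathbb{R}^D)$. $\|g\|_{L_1}=\int|g(x)|dx$ (Lebesgue measure); $\|u\|$ is the Euclidean norm. *)

(* Defs.v *)
From HB Require Import structures.
From mathcomp Require Import all_boot all_order all_algebra.
From mathcomp Require Import perm complex.
From mathcomp Require Import all_classical all_reals all_analysis.

Set Implicit Arguments.
Unset Strict Implicit.
Unset Printing Implicit Defensive.

Import Order.TTheory GRing.Theory Num.Theory.
Import numFieldNormedType.Exports.

Local Open Scope classical_set_scope.
Local Open Scope ring_scope.

Definition tcons (T : Type) n (z : T * n.-tuple T) : n.+1.-tuple T :=
  [tuple of z.1 :: z.2].

Lemma measurable_tcons d (T : measurableType d) n :
  measurable_fun [set: T * n.-tuple T] (@tcons T n).
Proof. exact: measurable_cons. Qed.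

HB.instance Definition _ d (T : measurableType d) n :=
  isMeasurableFun.Build _ _ _ _ (@tcons T n) (@measurable_tcons d T n).

Definition tcons_measure d (T : measurableType d) (R : realType) n
    (mu : {sigma_finite_measure set T -> \bar R})
    (nu : {sigma_finite_measure set (n.-tuple T) -> \bar R}) :
    set (n.+1.-tuple T) -> \bar R :=
  pushforward (mu \x nu)%E (@tcons T n).

Section tcons_measure.
Context d (T : measurableType d) (R : realType) (n : nat).
Variable mu : {sigma_finite_measure set T -> \bar R}.
Variable nu : {sigma_finite_measure set (n.-tuple T) -> \bar R}.

Let tcons_measure0 : tcons_measure mu nu set0 = 0%E.
Proof. exact: measure0. Qed.

Let tcons_measure_ge0 A : (0 <= tcons_measure mu nu A)%E.
Proof. exact: measure_ge0. Qed.

Let tcons_measure_sigma_additive : semi_sigma_additive (tcons_measure mu nu).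
Proof. exact: (@measure_semi_sigma_additive _ _ _ (pushforward _ _)). Qed.

HB.instance Definition _ := isMeasure.Build _ _ _ (tcons_measure mu nu)
  tcons_measure0 tcons_measure_ge0 tcons_measure_sigma_additive.

Lemma tcons_measure_sigma_finite : sigma_finite setT (tcons_measure mu nu).
Proof.
have /sigma_finiteP[F [FT Fnd Ffin]] := sigma_finiteT mu.
have /sigma_finiteP[G [GT Gnd Gfin]] := sigma_finiteT nu.
pose g (x : n.+1.-tuple T) : T * n.-tuple T := (thead x, [tuple of behead x]).
have gK : cancel (@tcons T n) g.
  by case=> a t; rewrite /g /tcons /= theadE; congr pair; exact/val_inj.
have mg : measurable_fun setT g.
  apply/measurable_fun_pairP; split.
    exact: (measurable_tnth ord0).
  exact: measurable_behead.
exists (fun i => g @^-1` (F i `*` G i)).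
  rewrite -preimage_bigcup; apply/seteqP; split=> // x _ /=.
  have [i _ Fi] : (\bigcup_i F i) (g x).1 by rewrite -FT.
  have [j _ Gj] : (\bigcup_i G i) (g x).2 by rewrite -GT.
  exists (maxn i j) => //; split.
    by have /subsetPset := Fnd _ _ (leq_maxl i j); exact.
  by have /subsetPset := Gnd _ _ (leq_maxr i j); exact.
move=> i; have [mFi Ffi] := Ffin i; have [mGi Gfi] := Gfin i; split.
  by rewrite -[X in measurable X]setTI; apply: mg => //; exact: measurableX.
rewrite /tcons_measure /pushforward -comp_preimage.
rewrite (_ : g \o _ = id) ?preimage_id; last by apply/funext => z; exact: gK.
by rewrite product_measure1E// lte_mul_pinfty// ge0_fin_numE.
Qed.

HB.instance Definition _ := Measure_isSigmaFinite.Build _ _ _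
  (tcons_measure mu nu) tcons_measure_sigma_finite.

End tcons_measure.

(* The n-fold product of mu on T^n, for the product sigma-algebra of tuples: it is
   the law of n independent variables of law mu when mu is a probability, and the
   Lebesgue measure of R^n when mu is the Lebesgue measure of R. *)
Fixpoint power_measure d (T : measurableType d) (R : realType)
    (mu : {sigma_finite_measure set T -> \bar R}) (n : nat) :
    {sigma_finite_measure set (n.-tuple T) -> \bar R} :=
  match n with
  | 0 => \d_ [tuple]
  | k.+1 => tcons_measure mu (power_measure mu k)
  end.

Lemma power_measure_setT d (T : measurableType d) (R : realType)
    (mu : {sigma_finite_measure set T -> \bar R}) n :
  mu setT = 1%E -> power_measure mu n setT = 1%E.
Proof.
move=> mu1; elim: n => [|n ih] /=; first by rewrite diracT.
rewrite /tcons_measure /pushforward preimage_setT -setXTT.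
rewrite product_measure1E//; transitivity (mu setT * power_measure mu n setT)%E => //.
by rewrite mu1 ih mule1.
Qed.

(* R^d with its Borel (product) sigma-algebra; (R^d)^m = R^(md) is then
   m.-tuple (Rvec R d). *)
Notation Rvec R d := (d.-tuple (measurableTypeR R)).

Section euclidean.
Context (R : realType) (m d : nat).
Implicit Types u x : m.-tuple (Rvec R d).

Definition lebesgue_tuple :
    {sigma_finite_measure set (m.-tuple (Rvec R d)) -> \bar R} :=
  power_measure (power_measure (@lebesgue_measure R) d) m.

Definition dotv u x : R :=
  \sum_(i < m) \sum_(j < d) tnth (tnth u i) j * tnth (tnth x i) j.

Definition normv u : R := Num.sqrt (dotv u u).

(* Tuples carry no topology: continuity on (R^d)^m is transported from the usual
   topology of the m x d matrices, row i being the i-th argument. *)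
Definition tuple_of_mx (A : 'M[R]_(m, d)) : m.-tuple (Rvec R d) :=
  [tuple [tuple A i j | j < d] | i < m].

Definition continuous_kernel (f : m.-tuple (Rvec R d) -> R) : Prop :=
  continuous (f \o tuple_of_mx).

Definition symmetric_kernel (f : m.-tuple (Rvec R d) -> R) : Prop :=
  forall (s : 'S_m) x, f [tuple tnth x (s i) | i < m] = f x.

Definition Cintegral (g : m.-tuple (Rvec R d) -> R[i]) : R[i] :=
  ((\int[lebesgue_tuple]_x complex.Re (g x)) +i* (\int[lebesgue_tuple]_x complex.Im (g x)))%C.

Definition expi (t : R) : R[i] := (cos t +i* sin t)%C.

Definition fourier (f : m.-tuple (Rvec R d) -> R) u : R[i] :=
  Cintegral (fun x => (f x)%:C%C * expi (- (2 * pi * dotv u x))).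

Definition L1norm (g : m.-tuple (Rvec R d) -> R[i]) : R :=
  \int[lebesgue_tuple]_u ComplexField.Normc.normc (g u).

End euclidean.

Section hoeffding.
Context dT (T : measurableType dT) (R : realType) (law : probability T R).
Context (m : nat) (f : m.-tuple T -> R).

Definition kernel_mean : R := \int[power_measure law m]_y f y.

(* The tuple below is (x_1, ..., x_p, y_(p+1), ..., y_m): the default value of nth
   supplies the coordinates i >= p. For p = m this is f - theta, see
   hoeffding_g_full. *)
Definition hoeffding_g p (x : p.-tuple T) : R :=
  (\int[power_measure law m]_y f [tuple nth (tnth y i) x i | i < m])
  - kernel_mean.

Lemma hoeffding_g_full (x : m.-tuple T) : hoeffding_g x = f x - kernel_mean.
Proof.
rewrite /hoeffding_g; congr (_ - _).
rewrite (@eq_Rintegral _ _ _ _ _ (fun=> f x)) => [|y _]; last first.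
  congr f; apply/eq_from_tnth => i.
  by rewrite tnth_mktuple -tnth_nth.
rewrite Rintegral_cst// (_ : _ setT = 1%E) ?mulr1//.
exact/power_measure_setT/probability_setT.
Qed.

(* k is fuel, irrelevant as soon as p <= k; the defining recursion is hoeffdingE,
   with the sum over k_1 < ... < k_q indexed by increasing tuples. *)
Fixpoint hoeffding_rec (k p : nat) (x : p.-tuple T) : R :=
  hoeffding_g x -
  (if k is k'.+1 then
     \sum_(1 <= q < p)
       \sum_(s : q.-tuple 'I_p | sorted (fun i j : 'I_p => (i < j)%N) s)
         hoeffding_rec k' [tuple tnth x (tnth s j) | j < q]
   else 0).

Definition hoeffding p (x : p.-tuple T) : R := hoeffding_rec p x.

Lemma hoeffding_rec_stable k k' p (x : p.-tuple T) :
  (p <= k)%N -> (p <= k')%N -> hoeffding_rec k x = hoeffding_rec k' x.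
Proof.
elim: k k' p x => [|k ih] [|k'] p x //=.
- by rewrite leqn0 => /eqP p0 _; rewrite big_geq ?p0.
- by move=> _; rewrite leqn0 => /eqP p0; rewrite big_geq ?p0.
move=> pk pk'; congr (_ - _); apply: eq_big_nat => q /andP[_ qp].
apply: eq_bigr => s _; apply: ih; rewrite -ltnS.
- exact: leq_trans qp pk.
- exact: leq_trans qp pk'.
Qed.

Lemma hoeffdingE p (x : p.-tuple T) :
  hoeffding x = hoeffding_g x -
    \sum_(1 <= q < p)
      \sum_(s : q.-tuple 'I_p | sorted (fun i j : 'I_p => (i < j)%N) s)
        hoeffding [tuple tnth x (tnth s j) | j < q].
Proof.
rewrite /hoeffding (@hoeffding_rec_stable p p.+1)//=.
congr (_ - _); apply: eq_big_nat => q /andP[_ qp].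
by apply: eq_bigr => s _; apply: hoeffding_rec_stable; rewrite // ltnW.
Qed.

Lemma hoeffding1 (x : 1.-tuple T) : hoeffding x = hoeffding_g x.
Proof. by rewrite hoeffdingE big_geq// subr0. Qed.

End hoeffding.

Section processes.
Context dO (O : measurableType dO) (R : realType) (P : probability O R).
Context dT (T : measurableType dT) (X : int -> {RV P >-> T}).

(* Strict stationarity: finite-dimensional laws are shift invariant. *)
Definition stationary : Prop :=
  forall (k : nat) (t : k.-tuple int) (h : int) (B : set (k.-tuple T)),
    measurable B ->
    P [set w | B [tuple X (tnth t j + h) w | j < k]] =
    P [set w | B [tuple X (tnth t j) w | j < k]].

Definition sigma_of (J : set int) : set (set O) :=
  <<s \bigcup_(j in J) preimage_set_system setT (X j) measurable >>.

(* The supremum is over a nonempty set of reals bounded by 1. *)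
Definition strong_mixing (A B : set (set O)) : R :=
  sup [set `|fine (P (E `&` F)) - fine (P E) * fine (P F)| | E in A & F in B].

Definition alpha (i : nat) : R :=
  strong_mixing (sigma_of [set j | j <= 0]) (sigma_of [set j | i%:Z <= j]).

(* Indices of 'I_k start at 0, those of the sum at 1, hence the successor. *)
Definition vstat p (g : p.-tuple T -> R) (k : nat) (w : O) : R :=
  \sum_(i : p.-tuple 'I_k) g [tuple X (tnth i j).+1%:Z w | j < p].

End processes.

(* Main.v *)
(* Fourier inversion writes f(x) as a mixture, over frequencies u, of products of m
   bounded functions of the single arguments. Hoeffding projections act factor by
   factor on such products: f_p becomes a mixture of products of p centred factors
   b_l(x_l) - E b_l(X_1) and of m - p means, so V_k(f_p) is dominated, uniformly in
   k <= n, by a mixture of products of p maxima M_l of partial sums of stationary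
   bounded centred sequences.
   For one such maximum M, E exp(t M) <= exp(c + c' t^2 n) when t (log n)^2 is small.
   The sums are handled by removing from the index set Cantor-like families of gaps,
   long enough for mixing to decouple the remaining blocks, and the maximum by
   chaining in base 16.
   With Y the threshold for each M_l, on the event V >= n^p x the mixture of
   (1/p) sum_l exp(t (M_l - Y)) is at least its total mass as soon as t Y >= p, so
   Markov's inequality and Fubini give the tail bound exp(c - t Y + c' t^2 n). The
   prefactor is absorbed by lowering the constant in the exponent. *)

Require Import Defs.
From HB Require Import structures.
From mathcomp Require Import all_boot all_order all_algebra.
From mathcomp Require Import perm complex.
From mathcomp Require Import all_classical all_reals all_analysis.
From mathcomp Require Import measurable_realfun ring lra zify.

Set Implicit Arguments.
Unset Strict Implicit.
Unset Printing Implicit Defensive.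

Import Order.TTheory GRing.Theory Num.Theory.
Import numFieldNormedType.Exports.

Local Open Scope classical_set_scope.
Local Open Scope ring_scope.

(** The obstacle is that a product of p sums has too heavy a tail for its exponential moments to be
    of use: only its p-th root behaves like a single sum, whence the powers 1/p of the statement.
    The pointwise inequality between the product and exponentials of single factors bypasses this;
    being linear in these exponentials, it can be integrated over the frequencies, and no
    independence between the factors is called for. The range of t comes from two scales. With L of
    order log n, one round of gap removal leaves aside a proportion of order t L of the indices, and
    three rounds a proportion (t L)^3, harmless when t^2 L^3 is small. Chaining doubles t at each
    level, so deep levels leave this range and are bounded by their length; with blocks 16 times
    shorter at each level this costs t^5 n L^6, which is of order t^2 n when t L^2 is bounded. This
    is the source of (log n)^(2p) in M. *)

Notation intble mu f := (mu.-integrable setT (EFin \o f)).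

(** * Real-valued integrals: domination, image measures, Fubini *)

Section integrals.
Context d (T : measurableType d) (R : realType) (mu : {measure set T -> \bar R}).
Implicit Types f g : T -> R.

Lemma intble_meas f : intble mu f -> measurable_fun setT f.
Proof. by move=> /(measurable_int mu)/measurable_EFinP. Qed.

Lemma intbleD f g : intble mu f -> intble mu g -> intble mu (fun x => f x + g x).
Proof. exact: integrableD. Qed.

Lemma intbleB f g : intble mu f -> intble mu g -> intble mu (fun x => f x - g x).
Proof. exact: integrableB. Qed.

Lemma intbleZl (k : R) f : intble mu f -> intble mu (fun x => k * f x).
Proof. exact: integrableZl. Qed.

Lemma intble_sum (I : Type) (s : seq I) (Q : pred I) (f : I -> T -> R) :
  (forall i, Q i -> intble mu (f i)) ->
  intble mu (fun x => \sum_(i <- s | Q i) f i x).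
Proof.
move=> fi; have := @integrable_sum _ _ _ mu setT measurableT I s Q (fun i => EFin \o f i) fi.
by congr (mu.-integrable _ _); apply/funext => x /=; rewrite sumEFin.
Qed.

Lemma intble_le f g : measurable_fun setT f ->
  (forall x, `|f x| <= g x) -> intble mu g -> intble mu f.
Proof.
move=> mf fg gi; apply: (le_integrable _ _ _ gi) => //; first exact/measurable_EFinP.
by move=> x _ /=; rewrite lee_fin (le_trans (fg x))// ler_norm.
Qed.

Lemma intble_norm f : intble mu f -> intble mu (fun x => `|f x|).
Proof. exact: integrable_norm. Qed.

Lemma intbleM_bounded f g (M : R) : intble mu f -> measurable_fun setT g ->
  (forall x, `|g x| <= M) -> intble mu (fun x => f x * g x).
Proof.
move=> fi mg gM; apply: (@intble_le _ (fun x => M * `|f x|)).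
- by apply: measurable_funM => //; exact: intble_meas.
- by move=> x; rewrite normrM mulrC ler_wpM2r.
- exact/intbleZl/intble_norm.
Qed.

Lemma Rintegral_sum (I : Type) (s : seq I) (Q : pred I) (f : I -> T -> R) :
  (forall i, Q i -> intble mu (f i)) ->
  \int[mu]_x (\sum_(i <- s | Q i) f i x) = \sum_(i <- s | Q i) \int[mu]_x f i x.
Proof.
move=> fi; elim: s => [|i s ih].
  under eq_Rintegral do rewrite big_nil.
  by rewrite Rintegral_cst// mul0r big_nil.
under eq_Rintegral do rewrite big_cons.
rewrite big_cons; case: ifPn => Qi; last exact: ih.
by rewrite RintegralD// ?ih//; [exact: fi|exact: intble_sum].
Qed.

Lemma Rintegral_le f g : intble mu f -> intble mu g ->
  (forall x, f x <= g x) -> \int[mu]_x f x <= \int[mu]_x g x.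
Proof. by move=> fi gi fg; apply: le_Rintegral. Qed.

Lemma Rintegral_EFin f : intble mu f -> (\int[mu]_x (f x)%:E)%E = (\int[mu]_x f x)%:E.
Proof. by move=> fi; rewrite fineK//; exact: integrable_fin_num. Qed.

Lemma dominated_cvg_Rintegral (f_ : nat -> T -> R) f g :
  (forall n, measurable_fun setT (f_ n)) ->
  (forall x, f_ n x @[n --> \oo] --> f x) ->
  (forall n x, `|f_ n x| <= g x) -> intble mu g ->
  \int[mu]_x f_ n x @[n --> \oo] --> \int[mu]_x f x.
Proof.
move=> mf_ f_f f_g gi.
have mf : measurable_fun setT f.
  by apply: (@measurable_fun_cvg _ _ _ _ f_) => // x _; exact: f_f.
have [|||||fi _ cv] := @dominated_convergence _ _ _ mu setT measurableT
   (fun n => EFin \o f_ n) (EFin \o f) (EFin \o g).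
- by move=> n; exact/measurable_EFinP.
- exact/measurable_EFinP.
- by apply: aeW => x _; apply/fine_cvgP => /=; split; [exact: nearW|exact: f_f].
- exact: gi.
- by apply: aeW => x n _; rewrite /= lee_fin.
have fin : forall n, intble mu (f_ n).
  by move=> n; apply: intble_le gi => //; exact: f_g.
rewrite (_ : \int[mu]_x f x = fine (\int[mu]_x f x)%:E)//.
apply: fine_cvg; rewrite -(Rintegral_EFin fi).
exact: cv.
Qed.

End integrals.

Section image_measure.
Context d d' (T : measurableType d) (T' : measurableType d') (R : realType).
Variables (mu : {measure set T -> \bar R}) (nu : {measure set T' -> \bar R}).
Variables (phi : T -> T') (mphi : measurable_fun setT phi).
Hypothesis nuE : forall A, measurable A -> nu A = mu (phi @^-1` A).
Variables (f : T' -> R) (mf : measurable_fun setT f).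
Hypothesis fi : intble mu (f \o phi).

Let push : {measure set T' -> \bar R} :=
  measure_function_pushforward__canonical__measure_function_Measure mu mphi.

(** [nu] is only asked to agree with the image of [mu] on measurable sets. In this form the change
    of variables applies to the reflected Lebesgue measure, to products on tuples, to laws of random
    variables and to shifted finite-dimensional laws. *)
Lemma intble_image : intble nu f.
Proof.
apply/integrableP; split; first exact/measurable_EFinP.
rewrite (@eq_measure_integral _ _ _ setT push) => [|A mA _]; last exact: nuE.
have mfE : measurable_fun setT (EFin \o f) by exact/measurable_EFinP.
by have /integrableP[] := @integrable_pushforward _ _ _ _ _ _ mphi mu setT _ mfE fi measurableT.
Qed.

Lemma Rintegral_image : \int[nu]_y f y = \int[mu]_x f (phi x).
Proof.
congr fine; rewrite (@eq_measure_integral _ _ _ setT push) => [|A mA _]; last exact: nuE.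
have mfE : measurable_fun setT (EFin \o f) by exact/measurable_EFinP.
by rewrite (@integral_pushforward _ _ _ _ _ _ mphi mu setT _ mfE fi measurableT).
Qed.

End image_measure.

Lemma intble_finite d (T : measurableType d) (R : realType)
    (P : {finite_measure set T -> \bar R}) (f : T -> R) (M : R) :
  measurable_fun setT f -> (forall x, `|f x| <= M) -> intble P f.
Proof.
move=> mf fM; apply: (@intble_le _ _ _ _ f (cst M)) => //.
exact: finite_measure_integrable_cst.
Qed.

Section fubini_bounded.
Context d1 d2 (T1 : measurableType d1) (T2 : measurableType d2) (R : realType).
Variables (m1 : {sigma_finite_measure set T1 -> \bar R})
          (m2 : {sigma_finite_measure set T2 -> \bar R}).
Variables (f : T1 -> T2 -> R) (a : T1 -> R) (b : T2 -> R).
Hypotheses (mf : measurable_fun setT (fun z => f z.1 z.2)).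
Hypotheses (ai : intble m1 a) (bi : intble m2 b).
Hypothesis fab : forall x y, `|f x y| <= a x * b y.

Lemma intble_dominated1 x : intble m2 (f x).
Proof.
apply: (intble_le _ (fab x)); last exact: intbleZl.
by rewrite -[f x]/((fun z => f z.1 z.2) \o pair x); apply: measurableT_comp.
Qed.

Lemma intble_dominated2 y : intble m1 (f^~ y).
Proof.
apply: (intble_le _ (fun x => fab x y)).
  by rewrite -[f^~ y]/((fun z => f z.1 z.2) \o pair^~ y); apply: measurableT_comp.
apply: (@intble_le _ _ _ _ _ (fun x => `|b y| * `|a x|)).
- by apply: measurable_funM => //; exact: intble_meas ai.
- by move=> x; rewrite normrM mulrC.
- by apply/intbleZl/intble_norm.
Qed.

(** Tonelli on the product majorant: the inner integral of |f| is at most [|a x|] times the integral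
    of [|b|]. The absolute values are there because [a] and [b] may take both signs. *)
Lemma intble_dominated : intble (m1 \x m2)%E (fun z => f z.1 z.2).
Proof.
apply/integrable12ltyP; first exact/measurable_EFinP.
apply: (@le_lt_trans _ _ (\int[m1]_x (`|a x| * \int[m2]_y `|b y|)%:E)%E).
  apply: ge0_le_integral => //=.
  - by move=> x _; exact: integral_ge0.
  - have mabs : measurable_fun setT (fun z : T1 * T2 => `|(f z.1 z.2)%:E|%E).
      by apply: measurableT_comp => //; exact/measurable_EFinP.
    exact: (@measurable_fun_fubini_tonelli_F _ _ _ _ _ m2 _ mabs).
  - apply/measurable_EFinP/measurable_funM => //; apply: measurableT_comp => //.
    exact: intble_meas ai.
  - move=> x _; rewrite -RintegralZl//; last exact: intble_norm.
    rewrite -Rintegral_EFin; last exact/intbleZl/intble_norm.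
    apply: ge0_le_integral => //=.
    + by apply/measurable_EFinP/measurableT_comp => //; exact/intble_meas/intble_dominated1.
    + by apply/measurable_EFinP/measurable_funM => //; apply: measurableT_comp => //; exact: intble_meas bi.
    + by move=> y _; rewrite lee_fin (le_trans (fab x y))// -normrM ler_norm.
rewrite (_ : (fun x => _) = (EFin \o (fun x => (\int[m2]_y `|b y|) * `|a x|))).
  by apply: integrable_lty => //; exact/intbleZl/intble_norm.
by apply/funext => x /=; rewrite mulrC.
Qed.

Lemma Rfubini : \int[m1]_x \int[m2]_y f x y = \int[m2]_y \int[m1]_x f x y.
Proof.
have := Fubini intble_dominated => /= eqF.
rewrite /Rintegral; congr fine.
transitivity (\int[m1]_x \int[m2]_y (f x y)%:E)%E.
  by apply: eq_integral => x _; rewrite Rintegral_EFin//; exact: intble_dominated1.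
rewrite eqF; apply: eq_integral => y _; rewrite Rintegral_EFin//.
exact: intble_dominated2.
Qed.

Lemma intble_fubini1 : intble m1 (fun x => \int[m2]_y f x y).
Proof.
have := integrable_fubini_F intble_dominated.
congr (m1.-integrable _ _); apply/funext => x /=.
by rewrite /fubini_F/= Rintegral_EFin//; exact: intble_dominated1.
Qed.

Lemma Rfubini_prod : \int[(m1 \x m2)%E]_z f z.1 z.2 = \int[m1]_x \int[m2]_y f x y.
Proof.
have /= eqF := integral12_prod_meas1 intble_dominated.
rewrite /Rintegral; congr fine; rewrite -eqF; apply: eq_integral => x _.
by rewrite /fubini_F/= Rintegral_EFin//; exact: intble_dominated1.
Qed.

End fubini_bounded.

(** * An exponential inequality for maxima of mixing sums *)

Section geometric_sums.
Context (R : realType).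

(** Inverting exp(-y) >= 1 - y gives exp(y) <= 1/(1 - y), and (1 + y + 2y^2)(1 - y) = 1 + y^2 (1 -
    2y) >= 1. Arbitrarily negative y are allowed. *)
Lemma expR_le_quadratic (y : R) : y <= 2^-1 -> expR y <= 1 + y + 2 * y ^+ 2.
Proof.
move=> yh; have h : 0 < 1 - y by lra.
have e1 : expR y <= (1 - y)^-1.
  rewrite -[expR y]invrK -expRN lef_pV2 ?posrE ?expR_gt0//.
  by rewrite (le_trans _ (expR_ge1Dx _)).
apply: (le_trans e1); rewrite -[leRHS](mulfK (lt0r_neq0 h)) ler_pdivlMr//.
rewrite mulVf ?lt0r_neq0//.
have : 0 <= y ^+ 2 * (1 - 2 * y) by rewrite mulr_ge0 ?sqr_ge0//; lra.
by lra.
Qed.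

Lemma path_gap (i : nat) G s j :
  path ltn i (G ++ s) -> j \in s -> (i + size G < j)%N.
Proof.
elim: G i => [|g G ih] i /=.
  by move=> /(order_path_min ltn_trans)/allP h /h; rewrite addn0.
by move=> /andP[ig /ih h /h]; rewrite addnS; move: ig => /= ig h'; lia.
Qed.

(** Index sets are no longer intervals after a first removal. In a strictly increasing list,
    dropping a run [G] still separates the two sides in time by more than its length, which is what
    mixing needs. *)
Lemma sorted_gap (s1 G s2 : seq nat) i j : sorted ltn (s1 ++ G ++ s2) ->
  i \in s1 -> j \in s2 -> (i + size G < j)%N.
Proof.
elim: s1 => [//|a s1 ih] /= h; rewrite inE => /orP[/eqP ->|is1] js2; last first.
  exact: ih (path_sorted h) is1 js2.
have := @path_gap a (s1 ++ G) s2 j; rewrite -catA => /(_ h js2).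
by rewrite size_cat; lia.
Qed.

(** Seen from its first entry j, the rest of the sum is r^(j - i) times a sum of the same kind; then
    1 + r/(1 - r) = 1/(1 - r) and r^(j - i) <= r. *)
Lemma path_geometric (r : R) (i : nat) s : 0 < r -> r < 1 -> path ltn i s ->
  \sum_(j <- s) r ^+ (j - i) <= r / (1 - r).
Proof.
move=> r0 r1; elim: s i => [|j s ih] i /=.
  by rewrite big_nil divr_ge0// ?ltW// subr_gt0.
move=> /andP[ij p]; rewrite big_cons.
have -> : \sum_(k <- s) r ^+ (k - i) = r ^+ (j - i) * \sum_(k <- s) r ^+ (k - j).
  rewrite big_distrr/= big_seq [RHS]big_seq; apply: eq_bigr => k ks.
  move: (allP (order_path_min ltn_trans p) _ ks) => /= jk.
  by rewrite -exprD; congr (_ ^+ _); move: ij; lia.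
rewrite -{1}[r ^+ _]mulr1 -mulrDr.
have q0 : 0 < 1 - r by rewrite subr_gt0.
apply: (@le_trans _ _ (r ^+ (j - i) * (1 + r / (1 - r)))).
  by rewrite ler_wpM2l ?(exprn_ge0 _ (ltW r0))// lerD2l ih.
have -> : 1 + r / (1 - r) = (1 - r)^-1 by field; apply/lt0r_neq0.
rewrite ler_wpM2r ?invr_ge0 ?(ltW q0)//.
have -> : (j - i = (j - i).-1.+1)%N by move: ij; lia.
by rewrite exprS ger_pMr// exprn_ile1// ltW.
Qed.

End geometric_sums.

(** * Variance and Laplace transform of short mixing sums *)

Section laplace.
Context dO (O : measurableType dO) (R : realType) (P : probability O R).
Local Notation "'Ex' f" := (Rintegral P setT f) (at level 10, f at level 9).

Definition psum (xi : nat -> O -> R) (J : seq nat) (w : O) : R := \sum_(i <- J) xi i w.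

(* The two consequences of geometric strong mixing that the exponential
   inequality uses. *)
Record mixing_seq (xi : nat -> O -> R) (g1 g2 : R) : Prop := MixingSeq {
  mixing_meas : forall i, measurable_fun setT (xi i) ;
  mixing_le1 : forall i w, `|xi i w| <= 1 ;
  mixing_mean0 : forall i, Ex (xi i) = 0 ;
  mixing_exp : forall (J1 J2 : seq nat) (g : nat) (t : R), (1 <= g)%N -> 0 <= t ->
    (forall i j, i \in J1 -> j \in J2 -> (i + g <= j)%N) ->
    Ex (fun w => expR (t * psum xi J1 w) * expR (t * psum xi J2 w)) <=
    Ex (fun w => expR (t * psum xi J1 w)) * Ex (fun w => expR (t * psum xi J2 w))
    + g1 * expR (- (g2 * g%:R)) * expR (t * ((size J1)%:R + (size J2)%:R)) ;
  mixing_cov : forall i j, (i < j)%N ->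
    Ex (fun w => xi i w * xi j w) <= 4 * g1 * expR (- (g2 * (j - i)%:R)) }.

Lemma bounded_intble (f : O -> R) (M : R) :
  measurable_fun setT f -> (forall x, `|f x| <= M) -> intble P f.
Proof. exact: intble_finite. Qed.

Lemma mean_cst (c : R) : Ex (fun=> c) = c.
Proof. by rewrite Rintegral_cst// (_ : _ setT = 1%E) ?mulr1//; exact: probability_setT. Qed.

Variables (xi : nat -> O -> R) (g1 g2 : R).
Hypotheses (g1_gt0 : 0 < g1) (g2_gt0 : 0 < g2) (mix : mixing_seq xi g1 g2).
Local Notation S := (psum xi).

Lemma psum_le_size J w : `|S J w| <= (size J)%:R.
Proof.
rewrite /psum; elim: J => [|i J ih]; first by rewrite big_nil normr0.
rewrite big_cons (le_trans (ler_normD _ _))//= -natr1 addrC lerD//.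
exact: mixing_le1 mix _ _.
Qed.

Lemma measurable_psum J : measurable_fun setT (S J).
Proof.
rewrite (_ : S J = fun w => \sum_(i <- J) xi i w)//.
by apply: measurable_sum => i; exact: mixing_meas mix i.
Qed.

Lemma psum_cat J1 J2 w : S (J1 ++ J2) w = S J1 w + S J2 w.
Proof. by rewrite /psum big_cat. Qed.

Lemma measurable_exp_psum (t : R) J : measurable_fun setT (fun w => expR (t * S J w)).
Proof.
apply: measurableT_comp; first exact: measurable_expR.
by apply: measurable_funM => //; exact: measurable_psum.
Qed.

Lemma exp_psum_le (t : R) J w : 0 <= t -> `|expR (t * S J w)| <= expR (t * (size J)%:R).
Proof.
move=> t0; rewrite ger0_norm ?expR_ge0// ler_expR ler_wpM2l//.
by rewrite (le_trans (ler_norm _))// psum_le_size.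
Qed.

Lemma intble_exp_psum (t : R) J : 0 <= t -> intble P (fun w => expR (t * S J w)).
Proof.
move=> t0; apply: (bounded_intble (measurable_exp_psum t J)) => w.
exact: exp_psum_le.
Qed.

Lemma intble_psum J : intble P (S J).
Proof. by apply: (bounded_intble (measurable_psum J)) => w; exact: psum_le_size. Qed.

Lemma mean_psum J : Ex (S J) = 0.
Proof.
rewrite Rintegral_sum; first by rewrite big1// => i _; exact: mixing_mean0 mix i.
move=> i _; apply: (bounded_intble (mixing_meas mix i)) => w; exact: mixing_le1 mix _ _.
Qed.

(** Jensen's inequality for a centred variable, through 1 + y <= exp(y). It lets additive mixing
    errors become factors in [laplace_cat]. *)
Lemma laplace_ge1 (t : R) J : 0 <= t -> 1 <= Ex (fun w => expR (t * S J w)).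
Proof.
move=> t0; apply: (@le_trans _ _ (Ex (fun w => 1 + t * S J w))).
  rewrite RintegralD//; first last.
  - exact/intbleZl/intble_psum.
  - by apply: (@bounded_intble _ 1) => // x; rewrite normr1.
  by rewrite RintegralZl//; [rewrite mean_psum mulr0 addr0 mean_cst|exact: intble_psum].
apply: Rintegral_le.
- apply: intbleD; last exact/intbleZl/intble_psum.
  by apply: (@bounded_intble _ 1) => // x; rewrite normr1.
- exact: intble_exp_psum.
- by move=> w; exact: expR_ge1Dx.
Qed.

Definition variance_const : R := 1 + 8 * g1 / (1 - expR (- g2)).

Let r := expR (- g2).
Let r_gt0 : 0 < r. Proof. exact: expR_gt0. Qed.
Let r_lt1 : r < 1. Proof. by rewrite /r -expR0 ltr_expR oppr_lt0. Qed.

Lemma variance_const_ge1 : 1 <= variance_const.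
Proof.
rewrite /variance_const lerDl divr_ge0//; first by rewrite mulr_ge0// ltW.
by rewrite subr_ge0 ltW.
Qed.

(** Induction on the first index: its covariances with all later ones add up to at most 4 g1 r/(1 -
    r), with r = exp(-g2), so each index costs at most [variance_const]. *)
Lemma psum_variance J : sorted ltn J ->
  Ex (fun w => S J w ^+ 2) <= variance_const * (size J)%:R.
Proof.
have isq K : intble P (fun w => S K w ^+ 2).
  apply: (@bounded_intble _ ((size K)%:R ^+ 2)).
    by apply: measurable_funX; exact: measurable_psum.
  by move=> w; rewrite normrX lerXn2r ?nnegrE// psum_le_size.
have ipr K i : intble P (fun w => xi i w * S K w).
  apply: (@bounded_intble _ (size K)%:R).
    by apply: measurable_funM; [exact: mixing_meas mix i|exact: measurable_psum].
  move=> w; rewrite normrM (le_trans (ler_wpM2r _ (mixing_le1 mix i w)))//.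
  by rewrite mul1r psum_le_size.
elim: J => [_|i J ih] /=.
  rewrite (_ : (fun w => _) = cst 0) ?mean_cst ?mulr0//.
  by apply/funext => w; rewrite /psum big_nil expr0n.
move=> p; have {}ih := ih (path_sorted p).
have sqE w : S (i :: J) w ^+ 2 = xi i w ^+ 2 + 2 * (xi i w * S J w) + S J w ^+ 2.
  by rewrite /psum big_cons -/(psum xi J w); ring.
under eq_Rintegral do rewrite sqE.
have i1 : intble P (fun w => xi i w ^+ 2).
  apply: (@bounded_intble _ 1); first by apply: measurable_funX; exact: mixing_meas mix i.
  by move=> w; rewrite normrX exprn_ile1// (mixing_le1 mix).
rewrite RintegralD//; last by apply: intbleD => //; exact/intbleZl.
rewrite RintegralD//; last exact/intbleZl.
rewrite RintegralZl//.
have s1 : Ex (fun w => xi i w ^+ 2) <= 1.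
  rewrite -[leRHS]mean_cst; apply: Rintegral_le => //.
    by apply: (@bounded_intble _ 1) => // x; rewrite normr1.
  by move=> w; rewrite -real_normK ?num_real// exprn_ile1// (mixing_le1 mix).
have s2 : Ex (fun w => xi i w * S J w) <= 4 * g1 * (r / (1 - r)).
  rewrite (_ : (fun w => _) = (fun w => \sum_(j <- J) xi i w * xi j w)); last first.
    by apply/funext => w; rewrite /psum big_distrr.
  rewrite Rintegral_sum; last first.
    move=> j _; apply: (@bounded_intble _ 1).
      by apply: measurable_funM; exact: (mixing_meas mix).
    by move=> w; rewrite normrM mulr_ile1// (mixing_le1 mix).
  apply: (@le_trans _ _ (4 * g1 * \sum_(j <- J) r ^+ (j - i))); last first.
    by apply: ler_wpM2l; [rewrite mulr_ge0// ltW|exact: path_geometric].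
  rewrite big_distrr/= big_seq [leRHS]big_seq; apply: ler_sum => j jJ.
  have ij := allP (order_path_min ltn_trans p) _ jJ.
  apply: (le_trans (mixing_cov mix ij)).
  by rewrite /r -expRM_natl mulrN [_ * g2]mulrC.
rewrite -[(size J).+1%:R]natr1 mulrDr mulr1 [leRHS]addrC lerD//.
rewrite /variance_const -/r; apply: lerD => //.
have : 2 * Ex (fun w => xi i w * S J w) <= 2 * (4 * g1 * (r / (1 - r))).
  by rewrite ler_wpM2l.
move=> /le_trans; apply.
have -> : 2 * (4 * g1 * (r / (1 - r))) = 8 * g1 / (1 - r) * r.
  by field; rewrite lt0r_neq0// subr_gt0.
by rewrite ger_pMr ?(ltW r_lt1)// divr_gt0 ?subr_gt0// mulr_gt0.
Qed.

(** Twice the variance constant comes from the second-order expansion in [laplace_small]; the extra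
    g1 pays for the mixing error at a gap in [cantor_rec]. *)
Definition laplace_const : R := 2 * variance_const + g1.

Lemma laplace_const_gt0 : 0 < laplace_const.
Proof. by have := variance_const_ge1; rewrite /laplace_const; move: g1_gt0; lra. Qed.

(** As long as t |J| <= 1/2, the exponential is dominated by a quadratic polynomial whose linear
    term has mean zero. *)
Lemma laplace_small (t : R) J : 0 <= t -> sorted ltn J -> t * (size J)%:R <= 2^-1 ->
  Ex (fun w => expR (t * S J w)) <= expR (laplace_const * t ^+ 2 * (size J)%:R).
Proof.
move=> t0 sJ tJ.
have isq : intble P (fun w => S J w ^+ 2).
  apply: (@bounded_intble _ ((size J)%:R ^+ 2)).
    by apply: measurable_funX; exact: measurable_psum.
  by move=> w; rewrite normrX lerXn2r ?nnegrE// psum_le_size.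
have i1 : intble P (fun=> 1 : R).
  by apply: (@bounded_intble _ 1) => // x; rewrite normr1.
apply: (@le_trans _ _ (Ex (fun w => 1 + t * S J w + 2 * t ^+ 2 * S J w ^+ 2))).
  apply: Rintegral_le.
  - exact: intble_exp_psum.
  - apply: intbleD; last exact: intbleZl.
    by apply: intbleD => //; exact/intbleZl/intble_psum.
  - move=> w; rewrite -mulrA -exprMn; apply: expR_le_quadratic.
    apply: le_trans tJ; rewrite ler_wpM2l//.
    by rewrite (le_trans (ler_norm _))// psum_le_size.
rewrite RintegralD//; first last.
- exact: intbleZl.
- by apply: intbleD => //; exact/intbleZl/intble_psum.
rewrite RintegralD//; last exact/intbleZl/intble_psum.
rewrite mean_cst RintegralZl//; last exact: intble_psum.
rewrite mean_psum mulr0 addr0 RintegralZl//.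
apply: le_trans (expR_ge1Dx _); rewrite lerD2l.
apply: (@le_trans _ _ (2 * t ^+ 2 * (variance_const * (size J)%:R))).
  by rewrite ler_wpM2l ?psum_variance// mulr_ge0// sqr_ge0.
have h : 0 <= g1 * (t ^+ 2 * (size J)%:R) by rewrite !mulr_ge0 ?sqr_ge0// ltW.
by rewrite /laplace_const; lra.
Qed.

End laplace.

(** * Cantor-like splitting of the index set *)

Section cantor.
Context dO (O : measurableType dO) (R : realType) (P : probability O R).
Local Notation "'Ex' f" := (Rintegral P setT f) (at level 10, f at level 9).
Variables (xi : nat -> O -> R) (g1 g2 : R).
Hypotheses (g1_gt0 : 0 < g1) (g2_gt0 : 0 < g2) (mix : mixing_seq P xi g1 g2).
Local Notation S := (psum xi).
Local Notation C := (laplace_const g1 g2).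

(** Both Laplace transforms are at least 1, so the additive error g1 exp(t l - g2 g) may be
    multiplied by their product, and 1 + y <= exp(y) turns it into a factor. *)
Lemma laplace_cat (t : R) K1 K2 (g : nat) (l : R) : 0 <= t -> (1 <= g)%N ->
  (forall i j, i \in K1 -> j \in K2 -> (i + g <= j)%N) ->
  (size K1)%:R + (size K2)%:R <= l ->
  Ex (fun w => expR (t * S (K1 ++ K2) w)) <=
  Ex (fun w => expR (t * S K1 w)) * Ex (fun w => expR (t * S K2 w)) *
  expR (g1 * expR (t * l - g2 * g%:R)).
Proof.
move=> t0 g0 gap sl.
under eq_Rintegral do rewrite psum_cat mulrDr expRD.
apply: (le_trans (mixing_exp mix g0 t0 gap)).
set a := Ex _; set b := Ex _.
have ab1 : 1 <= a * b by rewrite mulr_ege1//; exact: laplace_ge1 mix _ _ t0.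
have ab0 : 0 <= a * b by rewrite (le_trans _ ab1).
apply: (@le_trans _ _ (a * b * (1 + g1 * expR (t * l - g2 * g%:R)))); last first.
  by rewrite ler_wpM2l// expR_ge1Dx.
rewrite [leRHS]mulrDr mulr1 lerD2l -mulrA -expRD [- _ + _]addrC.
apply: (@le_trans _ _ (g1 * expR (t * l - g2 * g%:R))).
  by rewrite ler_pM2l// ler_expR lerD2r ler_wpM2l.
by rewrite ler_peMl// mulr_ge0 ?expR_ge0// ltW.
Qed.

(* A Cantor-like subset: a gap of length about t|J| is removed from the middle of
   J, and so on in the two halves until their length drops below 1/t; the gaps are
   long enough for the mixing error to beat the crude bound exp(t|J|). *)
Lemma cantor_rec (t g0 : R) k J : 0 < t -> 0 <= g0 ->
  expR (- (g2 * g0)) <= t ^+ 2 ->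
  sorted ltn J -> 2 * t * (size J)%:R <= 2 ^+ k ->
  exists K K', [/\ subseq K J, subseq K' J, forall w, S J w = S K w + S K' w,
    Ex (fun w => expR (t * S K w)) <= expR (C * t ^+ 2 * (size J)%:R) &
    (size K')%:R <= g2^-1 * k%:R * t * (size J)%:R + (g0 + 1) * (2 ^+ k - 1)].
Proof.
move=> t0 g00 hg0; have C0 := laplace_const_gt0 g1_gt0 g2_gt0.
have g2i : 0 < g2^-1 by rewrite invr_gt0.
elim: k J => [|k ih] J sJ hk.
  exists J, [::]; split=> //; first exact: sub0seq.
  - by move=> w; rewrite {3}/psum big_nil addr0.
  - apply: laplace_small => //; first exact: ltW.
    by move: hk; rewrite expr0; lra.
  - by rewrite mulr0 !mul0r expr0 subrr mulr0 addr0.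
(* The part t|J|/g2 of the gap beats the crude factor exp(t|J|); the part g0 brings the rest of the
   error below t^2, by [hg0]. *)
set g := (Num.truncn (g2^-1 * t * (size J)%:R + g0)).+1.
have gx0 : 0 <= g2^-1 * t * (size J)%:R + g0 by rewrite addr_ge0// !mulr_ge0// ?(ltW g2i) ?(ltW t0).
have g_lt : g2^-1 * t * (size J)%:R + g0 < g%:R by rewrite /g truncnS_gt.
have g_le : g%:R <= g2^-1 * t * (size J)%:R + g0 + 1.
  by rewrite /g -natr1 lerD2r truncn_le.
have g_gt0 : (0 < g)%N by [].
clearbody g.
have k2 : 1 <= 2 ^+ k :> R by rewrite exprn_ege1// ler1n.
have D0 : 0 <= g2^-1 * k%:R * t * (size J)%:R by rewrite !mulr_ge0// ?(ltW g2i) ?(ltW t0).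
(* A list not longer than its gap is removed entirely. *)
have [Jg|gJ] := leqP (size J) g.
  exists [::], J; split=> //; first exact: sub0seq.
  - by move=> w; rewrite {2}/psum big_nil add0r.
  - rewrite (_ : (fun w => _) = cst 1).
      by rewrite mean_cst -expR0 ler_expR !mulr_ge0 ?sqr_ge0// ltW.
    by apply/funext => w; rewrite /psum big_nil mulr0 expR0.
  - apply: (@le_trans _ _ g%:R); first by rewrite ler_nat.
    apply: (le_trans g_le); rewrite -addrA; apply: lerD.
      by rewrite -natr1 mulrDr mulr1 !mulrDl lerDr.
    rewrite ler_peMr//; first by rewrite addr_ge0.
    by rewrite exprS; lra.
pose h := (size J - g)./2.
pose J1 := take h J; pose G := take g (drop h J); pose J2 := drop (h + g) J.
have hgJ : (h + g <= size J)%N by rewrite /h; move: gJ; clear; lia.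
have JE : J = J1 ++ G ++ J2.
  by rewrite /J1 /G /J2 addnC -drop_drop !cat_take_drop.
have sG : size G = g by rewrite size_takel// size_drop; move: hgJ; clear; lia.
have sJE : size J = (size J1 + g + size J2)%N by rewrite {1}JE !size_cat sG addnA.
have s1' : ((size J1).*2 <= size J)%N by rewrite /J1 size_takel /h; move: gJ; clear; lia.
have s2' : ((size J2).*2 <= size J)%N by rewrite /J2 size_drop /h; move: gJ g_gt0; clear; lia.
have half n : (n.*2 <= size J)%N -> 2 * t * n%:R <= 2 ^+ k.
  move=> n2; have : 2 * n%:R <= (size J)%:R :> R by rewrite -natrM mul2n ler_nat.
  move: hk; rewrite exprS => hk.
  have := ltW t0 => t0'.
  move=> /(ler_wpM2l t0'); move: hk; lra.
have sortJ : sorted ltn (J1 ++ G ++ J2) by rewrite -JE.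
have sort1 : sorted ltn J1 := take_sorted _ sJ.
have sort2 : sorted ltn J2 := drop_sorted _ sJ.
have [K1 [L1 [subK1 subL1 SE1 lap1 szL1]]] := ih J1 sort1 (half _ s1').
have [K2 [L2 [subK2 subL2 SE2 lap2 szL2]]] := ih J2 sort2 (half _ s2').
exists (K1 ++ K2), (L1 ++ G ++ L2); split.
- by rewrite JE cat_subseq// -[K2]cat0s cat_subseq// sub0seq.
- by rewrite JE !cat_subseq.
- by move=> w; rewrite JE !psum_cat SE1 SE2; ring.
- apply: (le_trans (@laplace_cat t K1 K2 g (size J)%:R _ _ _ _)) => //.
  + exact: ltW.
  + move=> i j /(mem_subseq subK1) iJ /(mem_subseq subK2) jJ.
    by have := sorted_gap sortJ iJ jJ; rewrite sG => /ltnW.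
  + rewrite -natrD ler_nat sJE.
    rewrite (leq_trans (leq_add (size_subseq subK1) (size_subseq subK2)))//.
    by rewrite -addnA leq_add2l leq_addl.
  (* The g removed indices free the share C t^2 g of the budget, which covers the mixing error g1
     t^2 since g1 <= C and g >= 1. *)
  rewrite (_ : C * t ^+ 2 * (size J)%:R = C * t ^+ 2 * (size J1)%:R +
     C * t ^+ 2 * (size J2)%:R + C * t ^+ 2 * g%:R); last first.
    by rewrite sJE !natrD; ring.
  rewrite !expRD; apply: ler_pM => //.
  + by rewrite mulr_ge0// Rintegral_ge0// => w _; rewrite expR_ge0.
  + by apply: ler_pM => //; rewrite Rintegral_ge0// => w _; rewrite expR_ge0.
  rewrite ler_expR; apply: (@le_trans _ _ (C * t ^+ 2)); last first.
    by rewrite ler_peMr ?ler1n// mulr_ge0 ?sqr_ge0// ltW.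
  apply: ler_pM; rewrite ?expR_ge0 ?(ltW g1_gt0)//.
    by rewrite /laplace_const lerDr mulr_ge0// (le_trans _ (variance_const_ge1 g1_gt0 g2_gt0)).
  apply: le_trans hg0; rewrite -expRD ler_expR.
  have := ltW g_lt; rewrite -(ler_pM2l g2_gt0) mulrDr !mulrA divff ?lt0r_neq0// mul1r.
  by lra.
(* Each of the k levels removes at most t|J|/g2 in total, plus g0 + 1 for each of the 2^k - 1
   gaps. *)
- rewrite !size_cat sG !natrD.
  have : (size J)%:R = (size J1)%:R + g%:R + (size J2)%:R :> R by rewrite sJE !natrD.
  set a : R := (size J1)%:R in szL1 *; set b : R := (size J2)%:R in szL2 *.
  move=> sz; have ab : a + b <= (size J)%:R by rewrite sz -addrA lerD2l lerDr.
  have hc : 0 <= g2^-1 * k%:R * t by rewrite !mulr_ge0// ?(ltW g2i) ?(ltW t0).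
  have := ler_wpM2l hc ab; move: szL1 szL2 g_le.
  by rewrite exprS -natr1; lra.
Qed.

(** The estimates of [cantor_split] add up to 22/g2 + 4: 6/g2 from the k <= 6L levels, and 4 (4/g2 +
    1) from at most 4t|J| gaps whose constant part is at most (4/g2 + 1) L. The rest is slack. *)
Definition cantor_const : R := 26 * g2^-1 + 4.

Lemma cantor_split (t L : R) J : 0 < t -> t <= 1 -> 1 <= L ->
  sorted ltn J -> (size J)%:R <= expR L ->
  exists K K', [/\ subseq K J, subseq K' J, forall w, S J w = S K w + S K' w,
    Ex (fun w => expR (t * S K w)) <= expR (C * t ^+ 2 * (size J)%:R) &
    (size K')%:R <= cantor_const * t * L * (size J)%:R].
Proof.
move=> t0 t1 L1 sJ JL.
have g2i : 0 < g2^-1 by rewrite invr_gt0.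
have e1 : 2 <= expR 1 :> R by have := @expR_ge1Dx R 1; lra.
have [tJ|tJ] := leP (2 * t * (size J)%:R) 1.
  have [|||K [K' [a b c d e]]] := @cantor_rec t (2 * g2^-1 * - ln t) 0 J t0 _ _ sJ.
  - by rewrite !mulr_ge0 ?(ltW g2i)// oppr_ge0 ln_le0.
  - rewrite (_ : - _ = ln t + ln t); last by field; rewrite lt0r_neq0.
    by rewrite expRD lnK ?posrE.
  - by rewrite expr0.
  exists K, K'; split => //; apply: (le_trans e).
  rewrite expr0 subrr !mulr0 addr0 !mul0r !mulr_ge0//; last exact: le_trans L1.
    by rewrite /cantor_const addr_ge0// mulr_ge0// invr_ge0 ltW.
  exact: ltW.
have J0 : 0 < (size J)%:R :> R.
  rewrite ltr0n lt0n; apply/negP => /eqP j0; move: tJ; rewrite j0 mulr0; lra.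
(* In this branch 1/t <= 2|J| <= exp(2L). *)
have lnt : - ln t <= 2 * L.
  rewrite -lnV ?posrE// -[leRHS]expRK ler_ln ?posrE ?invr_gt0 ?expR_gt0//.
  have h1 : t^-1 <= 2 * (size J)%:R.
    by rewrite -(ler_pM2l t0) divff ?lt0r_neq0// mulrCA mulrA ltW.
  apply: (le_trans h1); rewrite [2 * L]mulr_natl mulr2n expRD ler_pM//.
  by apply: (le_trans e1); rewrite ler_expR.
pose Q (k : nat) := 2 * t * (size J)%:R <= 2 ^+ k.
have exQ : exists k, Q k.
  exists (Num.truncn (2 * t * (size J)%:R)).+1; rewrite /Q.
  apply: (@le_trans _ _ (Num.truncn (2 * t * (size J)%:R)).+1%:R).
    by rewrite ltW// truncnS_gt.
  by rewrite -natrX ler_nat ltnW// ltn_expl.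
have [k Qk kmin] := ex_minnP exQ.
have k0 : (0 < k)%N.
  by rewrite lt0n; apply/negP => /eqP k0; move: Qk; rewrite k0 /Q expr0 leNgt tJ.
have kup : 2 ^+ k <= 4 * t * (size J)%:R.
  have : 2 ^+ k.-1 < 2 * t * (size J)%:R.
    by rewrite ltNge; apply/negP => /kmin; rewrite leqNgt prednK// leqnn.
  by rewrite -[in 2 ^+ k](prednK k0) exprS; lra.
(* exp(k/2) <= 2^k <= 4t|J| <= exp(2 + L), hence k <= 4 + 2L <= 6L. *)
have kL : k%:R <= 6 * L.
  have h : expR 1 <= 4 :> R.
    have := @expR_le_quadratic R (2^-1) (lexx _).
    have -> : expR 1 = expR 2^-1 ^+ 2 :> R by rewrite -expRM_natl; congr expR; field.
    move=> h.
    apply: (@le_trans _ _ (2 ^+ 2)); last by rewrite -natrX ler_nat.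
    by rewrite lerXn2r ?nnegrE//; move: h; lra.
  have h2 : expR 2^-1 <= 2 :> R.
    by have := @expR_le_quadratic R (2^-1) (lexx _); lra.
  have h3 : expR (k%:R / 2) <= expR (2 + L) :> R.
    rewrite mulrC expRM_natr.
    apply: (@le_trans _ _ (2 ^+ k)); first by rewrite lerXn2r ?nnegrE ?expR_ge0.
    apply: (le_trans kup); rewrite expRD ler_pM//.
    - by rewrite mulr_ge0// ltW.
    - apply: (@le_trans _ _ 4); first by rewrite ler_piMr.
      have -> : expR 2 = expR 1 * expR 1 :> R by rewrite -expRD.
      have := @ler_pM R _ _ _ _ (ler0n _ 2) (ler0n _ 2) e1 e1; lra.
  by move: h3; rewrite ler_expR; lra.
have [|||K [K' [a b c d e]]] := @cantor_rec t (2 * g2^-1 * - ln t) k J t0 _ _ sJ _.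
- by rewrite !mulr_ge0 ?(ltW g2i)// oppr_ge0 ln_le0.
- rewrite (_ : - _ = ln t + ln t); last by field; rewrite lt0r_neq0.
  by rewrite expRD lnK ?posrE.
- exact: Qk.
exists K, K'; split => //; apply: (le_trans e).
have tJ0 : 0 < t * (size J)%:R by rewrite mulr_gt0.
have tg0 : 0 < t * (size J)%:R * g2^-1 by rewrite mulr_gt0.
rewrite /cantor_const.
have e1' : g2^-1 * k%:R * t * (size J)%:R <= 6 * L * (t * (size J)%:R * g2^-1).
  by have := ler_wpM2r (ltW tg0) kL; lra.
have x1 : 2 * g2^-1 * - ln t + 1 <= (4 * g2^-1 + 1) * L.
  by have := ler_wpM2l (ltW g2i) lnt; lra.
have x0 : 0 <= 2 * g2^-1 * - ln t + 1.
  by rewrite addr_ge0// !mulr_ge0 ?(ltW g2i)// oppr_ge0 ln_le0.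
have x2 : 2 ^+ k - 1 <= 4 * t * (size J)%:R by lra.
have x3 : 0 <= 2 ^+ k - 1 :> R by rewrite subr_ge0 exprn_ege1// ler1n.
have e2' := ler_pM x0 x3 x1 x2.
apply: (le_trans (lerD e1' e2')).
suff : 0 <= 4 * g2^-1 * (t * L * (size J)%:R) by lra.
by rewrite !mulr_ge0// ?(ltW g2i)// ?(ltW t0)// (le_trans _ L1).
Qed.

End cantor.

Section laplace_bound.
Context dO (O : measurableType dO) (R : realType) (P : probability O R).
Local Notation "'Ex' f" := (Rintegral P setT f) (at level 10, f at level 9).
Variables (xi : nat -> O -> R) (g1 g2 : R).
Hypotheses (g1_gt0 : 0 < g1) (g2_gt0 : 0 < g2) (mix : mixing_seq P xi g1 g2).
Local Notation S := (psum xi).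
Local Notation C := (laplace_const g1 g2).

(* Three rounds of Cantor splitting leave a remainder so short that the trivial
   bound is enough for it; the four pieces are recombined by convexity. *)
Lemma laplace_bound (t L : R) J : 0 < t -> 4 * t <= 1 -> 1 <= L ->
  cantor_const g2 ^+ 3 * (4 * t) ^+ 2 * L ^+ 3 <= C ->
  sorted ltn J -> (size J)%:R <= expR L ->
  Ex (fun w => expR (t * S J w)) <= expR (16 * C * t ^+ 2 * (size J)%:R).
Proof.
move=> t0 t1 L1 tL sJ JL; set s := 4 * t.
have s0 : 0 < s by rewrite mulr_gt0.
have C0 := laplace_const_gt0 g1_gt0 g2_gt0.
set c := cantor_const g2 in tL *.
have c0 : 0 <= c by rewrite addr_ge0// mulr_ge0// invr_ge0 ltW.
have c0' : 0 <= c * s * L by apply: mulr_ge0; [apply: mulr_ge0 => //; exact: ltW|exact: le_trans L1].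
have subJ J' : subseq J' J -> sorted ltn J' /\ (size J')%:R <= expR L.
  move=> h; split; first exact: (subseq_sorted ltn_trans h sJ).
  by apply: le_trans JL; rewrite ler_nat size_subseq.
have [K1 [J1 [_ sub1 S1 E1 l1]]] := cantor_split g1_gt0 g2_gt0 mix s0 t1 L1 sJ JL.
have [sJ1 J1L] := subJ _ sub1.
have [K2 [J2 [_ sub2 S2 E2 l2]]] := cantor_split g1_gt0 g2_gt0 mix s0 t1 L1 sJ1 J1L.
have [sJ2 J2L] := subJ _ (subseq_trans sub2 sub1).
have [K3 [J3 [_ sub3 S3 E3 l3]]] := cantor_split g1_gt0 g2_gt0 mix s0 t1 L1 sJ2 J2L.
have Cs : 0 <= C * s ^+ 2 by rewrite mulr_ge0 ?sqr_ge0// ltW.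
set B := expR (C * s ^+ 2 * (size J)%:R).
have E2' : Ex (fun w => expR (s * S K2 w)) <= B.
  by rewrite (le_trans E2)// ler_expR ler_wpM2l// ler_nat size_subseq.
have E3' : Ex (fun w => expR (s * S K3 w)) <= B.
  by rewrite (le_trans E3)// ler_expR ler_wpM2l// ler_nat size_subseq// (subseq_trans sub2).
(* Three rounds give s|J3| <= c^3 s^4 L^3 |J|, at most C s^2 |J| under the hypothesis on t. The
   third round is what allows t of order L^(-3/2), beyond the order L^(-2) of the maximal
   inequality; chaining lives on this margin. *)
have l3' : (size J3)%:R <= (c * s * L) ^+ 3 * (size J)%:R.
  rewrite (le_trans l3)// (le_trans (ler_wpM2l c0' l2))//.
  rewrite (le_trans (ler_wpM2l c0' (ler_wpM2l c0' l1)))//.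
  by rewrite !exprS expr0 mulr1 !mulrA.
have E4 : Ex (fun w => expR (s * S J3 w)) <= B.
  apply: (@le_trans _ _ (Ex (fun=> B))); last by rewrite mean_cst.
  apply: Rintegral_le.
  - exact: (intble_exp_psum mix _ (ltW s0)).
  - apply: (@bounded_intble _ _ _ _ _ B) => // w; rewrite ger0_norm ?expR_ge0//.
  - move=> w; rewrite (le_trans (ler_norm _))// (le_trans (exp_psum_le mix _ _ (ltW s0)))//.
    rewrite ler_expR (le_trans (ler_wpM2l (ltW s0) l3'))//.
    rewrite mulrA ler_wpM2r//.
    have -> : s * (c * s * L) ^+ 3 = c ^+ 3 * s ^+ 2 * L ^+ 3 * s ^+ 2 by ring.
    by rewrite ler_wpM2r ?sqr_ge0.
rewrite (_ : 16 * C * t ^+ 2 = C * s ^+ 2); last by rewrite /s; ring.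
have i K : intble P (fun w => expR (s * S K w)).
  exact: (intble_exp_psum mix _ (ltW s0)).
apply: (@le_trans _ _ (Ex (fun w => 4^-1 * (expR (s * S K1 w) + expR (s * S K2 w)
   + expR (s * S K3 w) + expR (s * S J3 w))))).
  apply: Rintegral_le.
  - exact: (intble_exp_psum mix _ (ltW t0)).
  - by apply/intbleZl; do 3 (apply: intbleD; last by []).
  - move=> w; rewrite S1 S2 S3.
    set x := S K1 w; set y := S K2 w; set z := S K3 w; set u := S J3 w.
    set m := t * (x + (y + (z + u))).
    (* Tangent of exp at the mean m of the four exponents; the linear terms cancel in the sum. *)
    have tan v : expR m * (1 + (v - m)) <= expR v.
      rewrite -[in leRHS](subrK m v) expRD mulrC ler_wpM2r ?expR_ge0//.
      exact: expR_ge1Dx.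
    have := tan (s * x); have := tan (s * y); have := tan (s * z); have := tan (s * u).
    have : expR m * (s * x + s * y + s * z + s * u - 4 * m) = 0.
      by rewrite /m /s; ring.
    by move: (expR m) => e; clear; lra.
have i3 := intbleD (intbleD (i K1) (i K2)) (i K3).
rewrite RintegralZl//; last by apply: intbleD.
rewrite RintegralD// RintegralD//; last exact: intbleD.
rewrite RintegralD//; move: E1 E2' E3' E4; rewrite -/B.
move: (Ex (fun w => expR (s * S K1 w))) (Ex (fun w => expR (s * S K2 w)))
      (Ex (fun w => expR (s * S K3 w))) (Ex (fun w => expR (s * S J3 w))) => e1 e2 e3 e4.
move: B => b; clear -b e1 e2 e3 e4 g1_gt0 g2_gt0 mix.
by lra.
Qed.

End laplace_bound.

Lemma measurable_bigmax d (T : measurableType d) (R : realType) (I : Type) (s : seq I)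
    (F : I -> T -> R) : (forall i, measurable_fun setT (F i)) ->
  measurable_fun setT (fun w => \big[Num.max/0]_(i <- s) F i w).
Proof.
move=> mF; elim: s => [|i s ih].
  rewrite (_ : (fun w => _) = cst 0); first exact: measurable_cst.
  by apply/funext => w; rewrite big_nil.
rewrite (_ : (fun w => _) = F i \max (fun w => \big[Num.max/0]_(i <- s) F i w))%O; last first.
  by apply/funext => w; rewrite big_cons.
exact: (measurable_maxr (mF i) ih).
Qed.

(** * From partial sums to maxima by chaining *)

Section maximal.
Context dO (O : measurableType dO) (R : realType) (P : probability O R).
Local Notation "'Ex' f" := (Rintegral P setT f) (at level 10, f at level 9).
Variable xi : nat -> O -> R.
Hypotheses (mxi : forall i, measurable_fun setT (xi i)).
Hypotheses (xi1 : forall i w, `|xi i w| <= 1).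
Local Notation S := (psum xi).

Definition maxsum (a n : nat) (w : O) : R :=
  \big[Num.max/0]_(0 <= k < n.+1) `|S (iota a k) w|.

Lemma maxsum_ge a n k w : (k <= n)%N -> `|S (iota a k) w| <= maxsum a n w.
Proof.
move=> kn; apply: (@le_bigmax_seq _ _ _ _ 0 k xpredT (fun k => `|S (iota a k) w|)) => //.
by rewrite mem_index_iota.
Qed.

Lemma maxsum_le a n w (x : R) : 0 <= x ->
  (forall k, (k <= n)%N -> `|S (iota a k) w| <= x) -> maxsum a n w <= x.
Proof.
move=> x0 h; rewrite /maxsum big_seq; apply: bigmax_le => // k.
by rewrite mem_index_iota => /andP[_]; exact: h.
Qed.

Lemma maxsum_ge0 a n w : 0 <= maxsum a n w.
Proof. by rewrite (le_trans _ (@maxsum_ge a n 0 w _)). Qed.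

Lemma measurable_psum' J : measurable_fun setT (S J).
Proof.
rewrite (_ : S J = fun w => \sum_(i <- J) xi i w)//.
exact: measurable_sum.
Qed.

Lemma measurable_maxsum a n : measurable_fun setT (maxsum a n).
Proof.
apply: measurable_bigmax => k; apply: measurableT_comp => //.
exact: measurable_psum'.
Qed.

Lemma psum_iota_le a k w : `|S (iota a k) w| <= k%:R.
Proof.
rewrite -[in leRHS](size_iota a k) /psum; elim: (iota a k) => [|i J ih].
  by rewrite big_nil normr0.
rewrite big_cons (le_trans (ler_normD _ _))//= -natr1 addrC lerD//.
Qed.

Lemma maxsum_le_size a n w : maxsum a n w <= n%:R.
Proof.
by apply: maxsum_le => // k kn; rewrite (le_trans (psum_iota_le _ _ _))// ler_nat.
Qed.

Lemma intble_exp_maxsum (t : R) a n : 0 <= t -> intble P (fun w => expR (t * maxsum a n w)).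
Proof.
move=> t0; apply: (@bounded_intble _ _ _ _ _ (expR (t * n%:R))).
  apply: measurableT_comp; first exact: measurable_expR.
  by apply: measurable_funM => //; exact: measurable_maxsum.
by move=> w; rewrite ger0_norm ?expR_ge0// ler_expR ler_wpM2l// maxsum_le_size.
Qed.

(** Write k = (k / h) h + k mod h. The quotient ranges over 0, ..., 16, hence 17 grid points. *)
Lemma maxsum_split a h w : (0 < h)%N -> maxsum a (16 * h) w <=
  \big[Num.max/0]_(q < 17) `|S (iota a (q * h)) w| +
  \big[Num.max/0]_(q < 17) maxsum (a + q * h) h w.
Proof.
move=> h0.
have max0 (F : 'I_17 -> R) : 0 <= \big[Num.max/0]_(q < 17) F q.
  exact: bigmax_ge_id.
apply: maxsum_le => [|k kn]; first exact: addr_ge0.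
have q17 : (k %/ h < 17)%N by rewrite ltn_divLR// (leq_ltn_trans kn)// ltn_pmul2r.
rewrite {1}(divn_eq k h) iotaD psum_cat (le_trans (ler_normD _ _))//.
apply: lerD; first exact: (le_bigmax _ (fun q : 'I_17 => `|S (iota a (q * h)) w|) (Ordinal q17)).
apply: (@le_trans _ _ (maxsum (a + (k %/ h) * h) h w)).
  by apply: maxsum_ge; rewrite ltnW// ltn_mod.
exact: (le_bigmax _ (fun q : 'I_17 => maxsum (a + q * h) h w) (Ordinal q17)).
Qed.

(** Cauchy-Schwarz without square roots: for u = 2X - x and v = 2Y - y both exponentials have mean
    at most 1, and exp((u + v)/2) <= (exp u + exp v)/2. *)
Lemma mean_exp_half (X Y : O -> R) (x y : R) :
  intble P (fun w => expR (2 * X w)) -> intble P (fun w => expR (2 * Y w)) ->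
  measurable_fun setT X -> measurable_fun setT Y ->
  Ex (fun w => expR (2 * X w)) <= expR x -> Ex (fun w => expR (2 * Y w)) <= expR y ->
  intble P (fun w => expR (X w + Y w)) /\
  Ex (fun w => expR (X w + Y w)) <= expR ((x + y) / 2).
Proof.
move=> iX iY mX mY Xx Yy.
have ineq w : expR (X w + Y w) <= expR ((x + y) / 2) / 2 *
    (expR (- x) * expR (2 * X w) + expR (- y) * expR (2 * Y w)).
  rewrite -!expRD.
  have -> : X w + Y w = (x + y) / 2 + ((- x + 2 * X w) / 2 + (- y + 2 * Y w) / 2) by field.
  set u := - x + _; set v := - y + _.
  rewrite expRD -mulrA ler_pM2l ?expR_gt0//.
  have -> : expR u = expR (u / 2) ^+ 2 by rewrite -expRM_natl; congr expR; field.
  have -> : expR v = expR (v / 2) ^+ 2 by rewrite -expRM_natl; congr expR; field.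
  rewrite expRD; have := sqr_ge0 (expR (u / 2) - expR (v / 2)).
  by rewrite sqrrB; lra.
have ib : intble P (fun w => expR ((x + y) / 2) / 2 *
    (expR (- x) * expR (2 * X w) + expR (- y) * expR (2 * Y w))).
  by apply/intbleZl/intbleD; exact/intbleZl.
have ia : intble P (fun w => expR (X w + Y w)).
  apply: (intble_le _ _ ib).
    apply: measurableT_comp; first exact: measurable_expR.
    exact: measurable_funD.
  by move=> w; rewrite ger0_norm ?expR_ge0.
split=> //; apply: (le_trans (Rintegral_le ia ib ineq)).
rewrite RintegralZl//; last by apply: intbleD; exact: intbleZl.
rewrite RintegralD//; try exact: intbleZl.
rewrite RintegralZl// RintegralZl//.
rewrite -[leRHS]mulr1 -mulrA ler_pM2l ?expR_gt0//.
have := ler_wpM2l (expR_ge0 (- x)) Xx; have := ler_wpM2l (expR_ge0 (- y)) Yy.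
by rewrite -!expRD !addNr expR0; lra.
Qed.

(** A union bound at the level of exponentials. Nonnegativity makes the maximum, which starts from
    0, equal to one of its terms. *)
Lemma exp_bigmax_le (F : 'I_17 -> O -> R) (t b : R) : 0 <= t ->
  (forall q w, 0 <= F q w) -> (forall q, intble P (fun w => expR (t * F q w))) ->
  (forall q, measurable_fun setT (F q)) ->
  (forall q, Ex (fun w => expR (t * F q w)) <= b) ->
  intble P (fun w => expR (t * \big[Num.max/0]_(q < 17) F q w)) /\
  Ex (fun w => expR (t * \big[Num.max/0]_(q < 17) F q w)) <= 17 * b.
Proof.
move=> t0 F0 iF mF Fb.
have ineq w : expR (t * \big[Num.max/0]_(q < 17) F q w) <= \sum_(q < 17) expR (t * F q w).
  have [q _ ->] : exists2 q : 'I_17, true & \big[Num.max/0]_(q < 17) F q w = F q w.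
    exists [arg max_(q > (ord0 : 'I_17)) F q w]%O => //.
    by apply: bigmax_eq_arg => // q _; exact: F0.
  by rewrite (bigD1 q)//= lerDl sumr_ge0// => *; rewrite expR_ge0.
have is' : intble P (fun w => \sum_(q < 17) expR (t * F q w)).
  by apply: intble_sum => q _; exact: iF.
have ia : intble P (fun w => expR (t * \big[Num.max/0]_(q < 17) F q w)).
  apply: (intble_le _ _ is').
    apply: measurableT_comp; first exact: measurable_expR.
    by apply: measurable_funM => //; exact: measurable_bigmax.
  by move=> w; rewrite ger0_norm ?expR_ge0.
split=> //; apply: (le_trans (Rintegral_le ia is' ineq)).
rewrite Rintegral_sum//; apply: (@le_trans _ _ (\sum_(q < 17) b)).
  by apply: ler_sum => q _; exact: Fb.
by rewrite sumr_const card_ord mulr_natl.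
Qed.

(* Chaining: the maximum over 16 h terms is at most the maximum over the grid of
   multiples of h plus the maximum inside a block, separated by Cauchy-Schwarz, which
   doubles t while the blocks are 16 times shorter. *)
Lemma maxsum_laplace (D tau2 : R) r : 0 <= D -> 0 < tau2 -> tau2 <= 1 ->
  (forall a k s, 0 < s -> s ^+ 2 <= tau2 -> (k <= 16 ^ r)%N ->
    Ex (fun w => expR (s * S (iota a k) w)) <= expR (D * s ^+ 2 * k%:R) /\
    Ex (fun w => expR (s * - S (iota a k) w)) <= expR (D * s ^+ 2 * k%:R)) ->
  forall a t, 0 < t ->
  Ex (fun w => expR (t * maxsum a (16 ^ r) w)) <=
  expR (8 + 3 * D * t ^+ 2 * (16 ^ r)%:R + 16 * t ^+ 5 * (16 ^ r)%:R / tau2 ^+ 2).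
Proof.
move=> D0 tau0 tau1 lap.
(* Once 2t leaves the range of [lap], the maximum is bounded by the length n, and t n <= 16 t^5 n /
   tau2^2 because (2t)^4 > tau2^2. This shape is stable under chaining: passing from (t, 16h) to
   (2t, h) doubles t^5 n, and Cauchy-Schwarz halves the exponent. *)
have triv r' a t : 0 < t -> tau2 < (2 * t) ^+ 2 ->
  Ex (fun w => expR (t * maxsum a (16 ^ r') w)) <=
  expR (8 + 3 * D * t ^+ 2 * (16 ^ r')%:R + 16 * t ^+ 5 * (16 ^ r')%:R / tau2 ^+ 2).
  move=> t0 t2; set n := (16 ^ _)%N.
  apply: (@le_trans _ _ (Ex (fun=> expR (t * n%:R)))).
    apply: Rintegral_le; first exact: intble_exp_maxsum (ltW t0).
      apply: (@bounded_intble _ _ _ _ _ (expR (t * n%:R))) => // w.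
      by rewrite ger0_norm ?expR_ge0.
    by move=> w; rewrite ler_expR ler_wpM2l ?(ltW t0)// maxsum_le_size.
  rewrite mean_cst ler_expR -[leLHS]add0r lerD//.
    by rewrite addr_ge0// mulr_ge0// mulr_ge0 ?sqr_ge0// mulr_ge0.
  have -> : 16 * t ^+ 5 * n%:R / tau2 ^+ 2 = t * n%:R * (((2 * t) ^+ 2) ^+ 2 / tau2 ^+ 2).
    by field; rewrite lt0r_neq0.
  rewrite ler_peMr ?mulr_ge0 ?(ltW t0)// ler_pdivlMr ?exprn_gt0// mul1r.
  by rewrite lerXn2r ?nnegrE ?sqr_ge0 ?(ltW tau0)// ltW.
elim: r lap => [|r ih] lap a t t0.
all: have [t2|t2] := leP ((2 * t) ^+ 2) tau2; last exact: triv.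
- have th : t <= 1.
    rewrite leNgt; apply/negP => t1; move: t2; apply/negP; rewrite -ltNge.
    apply: (le_lt_trans tau1); rewrite exprn_egt1//.
    by move: t1; lra.
  apply: (@le_trans _ _ (Ex (fun=> expR 1))).
    apply: Rintegral_le; first exact: intble_exp_maxsum (ltW t0).
      by apply: (@bounded_intble _ _ _ _ _ (expR 1)) => // w; rewrite ger0_norm ?expR_ge0.
    move=> w; rewrite ler_expR mulr_ile1 ?maxsum_ge0 ?(ltW t0)//.
    by rewrite (le_trans (maxsum_le_size _ _ _)).
  rewrite mean_cst ler_expR -addrA -[leLHS]addr0 lerD//; first by rewrite ler1n.
  by rewrite addr_ge0 ?divr_ge0 ?mulr_ge0 ?exprn_ge0 ?(ltW t0) ?(ltW tau0).
set h := (16 ^ r)%N; have h0 : (0 < h)%N by rewrite expn_gt0.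
have hE : (16 ^ r.+1 = 16 * h)%N by rewrite expnS.
have lap' a' k s : 0 < s -> s ^+ 2 <= tau2 -> (k <= h)%N ->
    Ex (fun w => expR (s * S (iota a' k) w)) <= expR (D * s ^+ 2 * k%:R) /\
    Ex (fun w => expR (s * - S (iota a' k) w)) <= expR (D * s ^+ 2 * k%:R).
  by move=> s0 s2 kh; apply: lap => //; rewrite hE (leq_trans kh)// leq_pmull.
have {}ih a' := ih lap' a' _ (mulr_gt0 (ltr0n _ 2) t0).
have tt0 : 0 < 2 * t by rewrite mulr_gt0.
have bS J (s : R) : intble P (fun w => expR (s * S J w)).
  apply: (@bounded_intble _ _ _ _ _ (expR (`|s| * (size J)%:R))).
    apply: measurableT_comp; first exact: measurable_expR.
    by apply: measurable_funM => //; exact: measurable_psum'.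
  move=> w; rewrite ger0_norm ?expR_ge0// ler_expR (le_trans (ler_norm _))// normrM.
  rewrite ler_wpM2l// /psum; elim: J => [|i J ihJ]; first by rewrite big_nil normr0.
  by rewrite big_cons (le_trans (ler_normD _ _))//= -natr1 addrC lerD.
pose G w := \big[Num.max/0]_(q < 17) `|S (iota a (q * h)) w|.
pose H w := \big[Num.max/0]_(q < 17) maxsum (a + q * h) h w.
have [iG EG] : intble P (fun w => expR (2 * t * G w)) /\
    Ex (fun w => expR (2 * t * G w)) <= 17 * (2 * expR (D * (2 * t) ^+ 2 * (16 * h)%:R)).
  apply: exp_bigmax_le => //; first exact: ltW.
  - move=> q; apply: (@bounded_intble _ _ _ _ _ (expR (2 * t * (q * h)%:R))).
      apply: measurableT_comp; first exact: measurable_expR.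
      by apply: measurable_funM => //; apply: measurableT_comp => //; exact: measurable_psum'.
    move=> w; rewrite ger0_norm ?expR_ge0// ler_expR ler_wpM2l ?(ltW tt0)//.
    exact: psum_iota_le.
  - by move=> q; apply: measurableT_comp => //; exact: measurable_psum'.
  move=> q; have qh : (q * h <= 16 ^ r.+1)%N by rewrite hE leq_mul2r -ltnS ltn_ord orbT.
  have [l1 l2] := lap a (q * h)%N _ tt0 t2 qh.
  have i2 : intble P (fun w => expR (2 * t * - S (iota a (q * h)) w)).
    have := bS (iota a (q * h)) (- (2 * t)).
    by under eq_fun do rewrite mulNr -mulrN.
  have iA : intble P (fun w => expR (2 * t * S (iota a (q * h)) w)
                         + expR (2 * t * - S (iota a (q * h)) w)) by exact: intbleD.
  have ineq w : expR (2 * t * `|S (iota a (q * h)) w|) <=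
      expR (2 * t * S (iota a (q * h)) w) + expR (2 * t * - S (iota a (q * h)) w).
    by case: (ger0P (S (iota a (q * h)) w)) => _; rewrite ?lerDl ?lerDr expR_ge0.
  apply: (@le_trans _ _ (Ex (fun w => expR (2 * t * S (iota a (q * h)) w)
                         + expR (2 * t * - S (iota a (q * h)) w)))).
    apply: Rintegral_le => //.
      apply: (intble_le _ _ iA).
        apply: measurableT_comp; first exact: measurable_expR.
        by apply: measurable_funM => //; apply: measurableT_comp => //; exact: measurable_psum'.
      by move=> w; rewrite ger0_norm ?expR_ge0.
  rewrite RintegralD// [leRHS]mulr_natl mulr2n.
  have le16 : expR (D * (2 * t) ^+ 2 * (q * h)%:R) <= expR (D * (2 * t) ^+ 2 * (16 * h)%:R).
    rewrite ler_expR; apply: ler_wpM2l; first by rewrite mulr_ge0// sqr_ge0.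
    by rewrite ler_nat -hE.
  by apply: lerD; [apply: le_trans l1 _|apply: le_trans l2 _].
have [iH EH] : intble P (fun w => expR (2 * t * H w)) /\
    Ex (fun w => expR (2 * t * H w)) <= 17 * expR (8 + 3 * D * (2 * t) ^+ 2 * h%:R
       + 16 * (2 * t) ^+ 5 * h%:R / tau2 ^+ 2).
  apply: exp_bigmax_le => //; first exact: ltW.
  - by move=> q w; exact: maxsum_ge0.
  - by move=> q; exact: intble_exp_maxsum (ltW tt0).
  - by move=> q; exact: measurable_maxsum.
(* Both 34 (17 grid points, two signs) and 17 are at most e^4. The additive constant 8 is the fixed
   point of c -> (4 + 4 + c)/2. *)
have e17 : 17 * 2 <= expR 4 :> R.
  have e2 : 1 + 4^-1 <= expR 4^-1 :> R by exact: expR_ge1Dx.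
  have -> : expR 4 = expR 4^-1 ^+ 16 :> R by rewrite -expRM_natl; congr expR; field.
  apply: (@le_trans _ _ ((1 + 4^-1) ^+ 16)); first by lra.
  by rewrite lerXn2r ?nnegrE ?expR_ge0.
have mG : measurable_fun setT G.
  apply: measurable_bigmax => q; apply: measurableT_comp => //; exact: measurable_psum'.
have mH : measurable_fun setT H by apply: measurable_bigmax => q; exact: measurable_maxsum.
have EG' : Ex (fun w => expR (2 * (t * G w))) <= expR (4 + D * (2 * t) ^+ 2 * (16 * h)%:R).
  under eq_Rintegral do rewrite mulrA.
  by rewrite (le_trans EG)// mulrA expRD ler_wpM2r// expR_ge0.
have EH' : Ex (fun w => expR (2 * (t * H w))) <= expR (4 + (8 + 3 * D * (2 * t) ^+ 2 * h%:R
       + 16 * (2 * t) ^+ 5 * h%:R / tau2 ^+ 2)).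
  under eq_Rintegral do rewrite mulrA.
  rewrite (le_trans EH)// [leRHS]expRD ler_wpM2r ?expR_ge0//; move: e17; lra.
have [||||iGH EGH] := mean_exp_half _ _ _ _ EG' EH'.
- by under eq_fun do rewrite mulrA.
- by under eq_fun do rewrite mulrA.
- exact: measurable_funM.
- exact: measurable_funM.
apply: (le_trans (Rintegral_le (intble_exp_maxsum _ _ (ltW t0)) iGH _)).
  by move=> w; rewrite ler_expR -mulrDr hE ler_wpM2l ?(ltW t0)// maxsum_split.
apply: (le_trans EGH); rewrite ler_expR hE natrM.
set u := h%:R : R.
(* Balance of the quadratic terms, in units of D t^2 h: (64 + 12)/2 = 38 is obtained and 3 times 16
   = 48 is available. *)
have Dt : 0 <= D * t ^+ 2 * u by rewrite mulr_ge0// mulr_ge0 ?sqr_ge0.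
rewrite (_ : 16 * (2 * t) ^+ 5 * u / tau2 ^+ 2 = 2 * (16 * t ^+ 5 * (16 * u) / tau2 ^+ 2)); last by ring.
by move: (16 * t ^+ 5 * (16 * u) / tau2 ^+ 2) => v; lra.
Qed.

End maximal.

(** * Constants of the maximal inequality *)

Section maximal_laplace.
Variables (R : realType) (g1 g2 : R).
Hypotheses (g1_gt0 : 0 < g1) (g2_gt0 : 0 < g2).
Local Notation C := (laplace_const g1 g2).
Local Notation c1 := (cantor_const g2).

(** The entry 1/16 yields 4s <= 1 for the parameter s of a block, the other one the remaining
    hypothesis of [laplace_bound]; 20 = 4 times 5 combines the [4 * t] found there with L = 5 ln
    n. *)
Definition range_const : R := Num.min 16^-1 (C / (20 * c1) ^+ 3).

(** The factor 16 is the price of rounding n up to a power of 16; 48 C is three times 16 C, the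
    quadratic term of [maxsum_laplace], and 16 / [range_const] stands for the levels bounded by
    their length. *)
Definition growth_const : R := 16 * (48 * C + 16 / range_const).

Let C_gt0 : 0 < C := laplace_const_gt0 g1_gt0 g2_gt0.

Let c1_gt0 : 0 < c1.
Proof. by rewrite /cantor_const addr_gt0// mulr_gt0// invr_gt0. Qed.

Lemma range_const_gt0 : 0 < range_const.
Proof.
rewrite /range_const lt_min invr_gt0 ltr0n/= divr_gt0//.
by rewrite exprn_gt0// mulr_gt0.
Qed.

Lemma growth_const_gt0 : 0 < growth_const.
Proof.
by rewrite mulr_gt0// addr_gt0// ?divr_gt0 ?range_const_gt0// mulr_gt0.
Qed.

Let k := range_const.
Let k_gt0 : 0 < k := range_const_gt0.
Let k_le : k <= 16^-1. Proof. by rewrite /k /range_const ge_min lexx. Qed.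
Let k2_le : (20 * c1) ^+ 3 * k ^+ 2 <= C.
Proof.
have h : k <= C / (20 * c1) ^+ 3 by rewrite /k /range_const ge_min lexx orbT.
have c0 : 0 < (20 * c1) ^+ 3 by rewrite exprn_gt0// mulr_gt0.
move: h; rewrite ler_pdivlMr// => h.
rewrite mulrC expr2 -mulrA; apply: le_trans h; rewrite ler_piMl//.
  by rewrite mulr_ge0// ltW.
by rewrite (le_trans k_le)// invf_le1// ler1n.
Qed.

Lemma ln_ge_half (n : nat) : (2 <= n)%N -> 2^-1 <= ln n%:R :> R.
Proof.
move=> n2; rewrite -[leLHS]expRK ler_ln ?posrE ?expR_gt0 ?ltr0n ?(leq_trans _ n2)//.
apply: (@le_trans _ _ 2); last by rewrite ler_nat.
by have := @expR_le_quadratic R (2^-1) (lexx _); lra.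
Qed.

Theorem maximal_laplace dO (O : measurableType dO) (P : probability O R)
    (xi : nat -> O -> R) (n : nat) (t : R) :
  mixing_seq P xi g1 g2 -> mixing_seq P (fun i w => - xi i w) g1 g2 ->
  (2 <= n)%N -> 0 < t -> t * ln n%:R ^+ 2 <= range_const ->
  \int[P]_w expR (t * maxsum xi 0 n w) <= expR (8 + growth_const * t ^+ 2 * n%:R).
Proof.
move=> mix mixN n2 t0 tk; set l := ln n%:R in tk *.
have l2 : 2^-1 <= l := ln_ge_half n2.
have l0 : 0 < l by apply: lt_le_trans l2; rewrite invr_gt0.
have n0 : 0 < n%:R :> R by rewrite ltr0n (leq_trans _ n2).
pose r := up_log 16 n.
have /andP[rl ru] : (16 ^ r.-1 < n <= 16 ^ r)%N by exact: up_log_bounds.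
have r0 : (0 < r)%N by rewrite up_log_gt0.
have r16 : (16 ^ r <= 16 * n)%N by rewrite -(prednK r0) expnS leq_mul2l/= ltnW.
(* The factor 5 serves 16^r <= 16 n <= n^5, valid for n >= 2; ln 2 >= 1/2 gives L >= 1. *)
pose L := 5 * l; have L1 : 1 <= L by rewrite /L; lra.
have nL : (16 ^ r)%:R <= expR L.
  have -> : expR L = n%:R ^+ 5.
    by rewrite /L -[5]/(5%:R) mulrC expRM_natr lnK ?posrE.
  rewrite -natrX ler_nat (leq_trans r16)//.
  rewrite expnS mulnC leq_mul2l; apply/orP; right.
  by apply: (@leq_trans (2 ^ 4)); rewrite // leq_exp2r.
(* Keeps s^2 L^3 bounded on the blocks, as [laplace_bound] demands. *)
pose tau2 := k ^+ 2 / l ^+ 3.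
have l3 : 0 < l ^+ 3 by rewrite exprn_gt0.
have tau0 : 0 < tau2 by rewrite divr_gt0 ?exprn_gt0.
have l3' : 8^-1 <= l ^+ 3.
  have -> : 8^-1 = 2^-1 ^+ 3 :> R by field.
  by rewrite lerXn2r ?nnegrE ?(ltW l0)//.
have tauk : 16 * tau2 <= 1.
  have h : k ^+ 2 <= 16^-1 ^+ 2 by rewrite lerXn2r ?nnegrE ?(ltW k_gt0).
  rewrite /tau2 mulrA ler_pdivrMr//; lra.
have lapx (x : nat -> O -> R) a j s : mixing_seq P x g1 g2 -> 0 < s -> s ^+ 2 <= tau2 ->
    (j <= 16 ^ r)%N ->
    \int[P]_w expR (s * psum x (iota a j) w) <= expR (16 * C * s ^+ 2 * j%:R).
  move=> mx s0 s2 jr.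
  have := @laplace_bound _ O R P x g1 g2 g1_gt0 g2_gt0 mx s L (iota a j) s0 _ L1.
  rewrite size_iota; apply.
  - have : (4 * s) ^+ 2 <= 1 ^+ 2 by rewrite exprMn expr1n; lra.
    by rewrite ler_pXn2r ?nnegrE// mulr_ge0// ltW.
  - apply: le_trans k2_le.
    have -> : c1 ^+ 3 * (4 * s) ^+ 2 * L ^+ 3 = (20 * c1) ^+ 3 * (s ^+ 2 * l ^+ 3) / 4.
      by rewrite /L; field.
    have d0 : 0 <= (20 * c1) ^+ 3 by rewrite exprn_ge0// mulr_ge0// ltW.
    apply: (@le_trans _ _ ((20 * c1) ^+ 3 * (s ^+ 2 * l ^+ 3))).
      by rewrite ler_pdivrMr// ler_peMr ?ler1n// mulr_ge0// mulr_ge0 ?sqr_ge0// ltW.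
    apply: ler_wpM2l => //.
    by rewrite -ler_pdivlMr.
  - exact: iota_ltn_sorted.
  - by apply: le_trans nL; rewrite ler_nat.
have D0 : 0 <= 16 * C by rewrite mulr_ge0// ltW.
have tau1 : tau2 <= 1 by lra.
have lap a j s : 0 < s -> s ^+ 2 <= tau2 -> (j <= 16 ^ r)%N ->
    \int[P]_w expR (s * psum xi (iota a j) w) <= expR (16 * C * s ^+ 2 * j%:R) /\
    \int[P]_w expR (s * - psum xi (iota a j) w) <= expR (16 * C * s ^+ 2 * j%:R).
  move=> s0 s2 jr; split; first exact: lapx.
  under eq_Rintegral do rewrite /psum -sumrN.
  exact: lapx.
have := @maxsum_laplace _ O R P xi (mixing_meas mix) (mixing_le1 mix) (16 * C) tau2 r
  D0 tau0 tau1 lap 0%N t t0.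
set RHS := expR _ => h.
apply: (@le_trans _ _ RHS); last first.
  rewrite /RHS ler_expR -addrA lerD2l.
  have ur : (16 ^ r)%:R <= 16 * n%:R :> R by rewrite -natrM ler_nat.
  (* This is where t (ln n)^2 <= k enters: t^5 / tau2^2 = t^2 (t l^2)^3 / k^4. *)
  have t3 : t ^+ 5 / tau2 ^+ 2 <= t ^+ 2 / k.
    have -> : t ^+ 5 / tau2 ^+ 2 = t ^+ 2 * (t * l ^+ 2) ^+ 3 / k ^+ 4.
      by rewrite /tau2; field; rewrite !lt0r_neq0.
    rewrite -mulrA ler_wpM2l ?sqr_ge0//.
    have -> : k^-1 = k ^+ 3 / k ^+ 4 by field; rewrite lt0r_neq0.
    rewrite ler_wpM2r ?invr_ge0 ?exprn_ge0 ?(ltW k_gt0)//.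
    by rewrite lerXn2r ?nnegrE ?(ltW k_gt0)// mulr_ge0 ?sqr_ge0 ?(ltW t0).
  have -> : 16 * t ^+ 5 * (16 ^ r)%:R / tau2 ^+ 2 = 16 * (16 ^ r)%:R * (t ^+ 5 / tau2 ^+ 2).
    by field; rewrite lt0r_neq0.
  have a1 : 48 * C * t ^+ 2 * (16 ^ r)%:R <= 48 * C * t ^+ 2 * (16 * n%:R).
    by apply: ler_wpM2l => //; rewrite mulr_ge0// mulr_ge0// ltW.
  have a2 : 16 * (16 ^ r)%:R * (t ^+ 5 / tau2 ^+ 2) <= 16 * (16 * n%:R) * (t ^+ 2 / k).
    apply: ler_pM => //.
      by rewrite divr_ge0 ?exprn_ge0 ?(ltW t0) ?(ltW tau0).
    by apply: ler_wpM2l.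
  have -> : growth_const * t ^+ 2 * n%:R =
      48 * C * t ^+ 2 * (16 * n%:R) + 16 * (16 * n%:R) * (t ^+ 2 / k).
    by rewrite /growth_const -/k; field; rewrite lt0r_neq0.
  apply: lerD a2; apply: le_trans a1.
  by rewrite mulrA -[3 * 16]natrM.
apply: le_trans h; apply: Rintegral_le.
- apply: intble_exp_maxsum (ltW t0); [exact: mixing_meas mix|exact: mixing_le1 mix].
- apply: intble_exp_maxsum (ltW t0); [exact: mixing_meas mix|exact: mixing_le1 mix].
- move=> w; rewrite ler_expR ler_wpM2l ?(ltW t0)//; apply: maxsum_le.
    exact: maxsum_ge0.
  by move=> j jn; apply: maxsum_ge; exact: leq_trans jn ru.
Qed.

End maximal_laplace.

(** * Strong mixing and stationary sums *)

Lemma Rintegral_indic d (T : measurableType d) (R : realType)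
    (mu : {measure set T -> \bar R}) (A : set T) : measurable A ->
  \int[mu]_x (\1_A x) = fine (mu A).
Proof. by move=> mA; rewrite /Rintegral integral_indic// setIT. Qed.

Section discretization.
Context (R : realType).

(** A mean of indicators of upper level sets, equal on [0, 1] to the integer part of N u divided by
    N: mixing, known for events, applies to it term by term. *)
Definition discretize (N : nat) (u : R) : R :=
  N%:R^-1 * \sum_(k < N) (k.+1%:R / N%:R <= u)%R%:R.

Lemma discretizeE N u : 0 <= u <= 1 -> (0 < N)%N ->
  discretize N u = N%:R^-1 * (Num.truncn (N%:R * u))%:R.
Proof.
move=> /andP[u0 u1] N0; have N0' : 0 < N%:R :> R by rewrite ltr0n.
have tN : (Num.truncn (N%:R * u) <= N)%N.
  by rewrite -ltnS truncn_lt_nat ?mulr_ge0 ?(ltW N0')// -natr1 ltr_pwDr// ler_piMr// ltW.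
congr (_ * _); under eq_bigr do rewrite ler_pdivrMr// mulrC -truncn_gt_nat.
rewrite -natr_sum; congr (_%:R).
set t := Num.truncn _ in tN *.
transitivity (\sum_(k < N | (k < t)%N) 1)%N.
  by rewrite [RHS]big_mkcond; apply: eq_bigr => k _; case: (_ < _)%N.
by rewrite -(big_ord_widen _ (fun=> 1%N) tN) sum1_card card_ord.
Qed.

Lemma discretize_itv N u : 0 <= u <= 1 -> (0 < N)%N ->
  discretize N u <= u <= discretize N u + N%:R^-1.
Proof.
move=> u01 N0; have /andP[u0 u1] := u01; have N0' : 0 < N%:R :> R by rewrite ltr0n.
have Nu0 : 0 <= N%:R * u by rewrite mulr_ge0// ltW.
rewrite discretizeE//.
have /andP[h1 h2] := truncn_itv Nu0.
apply/andP; split.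
  by rewrite ler_pdivrMl.
by rewrite -[X in _ + X]mulr1 -mulrDr ler_pdivlMl// natr1 ltW.
Qed.

Lemma discretize_01 N u : 0 <= u <= 1 -> (0 < N)%N -> 0 <= discretize N u <= 1.
Proof.
move=> u01 N0; have /andP[h _] := discretize_itv u01 N0; move/andP: u01 => [u0 u1].
rewrite (le_trans h)// andbT mulr_ge0// ?invr_ge0// sumr_ge0// => k _.
Qed.

End discretization.

Section covariance.
Context dO (O : measurableType dO) (R : realType) (P : probability O R).
Local Notation "'Ex' f" := (Rintegral P setT f) (at level 10, f at level 9).
Variables (A B : set (set O)) (al : R).
Hypotheses (Am : A `<=` measurable) (Bm : B `<=` measurable).
Hypothesis mixAB : forall E F, A E -> B F ->
  `|fine (P (E `&` F)) - fine (P E) * fine (P F)| <= al.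

(** After discretisation the covariance is an average of N^2 covariances of level events, each at
    most [al]; letting N grow keeps the constant 1. *)
Lemma covariance_01 (U V : O -> R) :
  (forall w, 0 <= U w <= 1) -> (forall w, 0 <= V w <= 1) ->
  measurable_fun setT U -> measurable_fun setT V ->
  (forall s, A [set w | s <= U w]) -> (forall s, B [set w | s <= V w]) ->
  `|Ex (fun w => U w * V w) - Ex U * Ex V| <= al.
Proof.
move=> U01 V01 mU mV AU BV.
have bd01 (f : O -> R) w : 0 <= f w <= 1 -> `|f w| <= 1.
  by move=> /andP[f0 f1]; rewrite ger0_norm.
have iU : intble P U by apply: (@bounded_intble _ _ _ _ _ 1) => // w; exact: bd01.
have iV : intble P V by apply: (@bounded_intble _ _ _ _ _ 1) => // w; exact: bd01.
have iUV : intble P (fun w => U w * V w).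
  by apply: (intbleM_bounded iU mV (M := 1)) => w; exact: bd01.
pose E (k N : nat) := [set w | k.+1%:R / N%:R <= U w].
pose F (k N : nat) := [set w | k.+1%:R / N%:R <= V w].
have dE N (f : O -> R) w : discretize N (f w) =
   N%:R^-1 * \sum_(k < N) \1_[set w | k.+1%:R / N%:R <= f w] w.
  congr (_ * _); apply: eq_bigr => k _; rewrite indicE; congr (_%:R); congr nat_of_bool.
  by apply/idP/idP; rewrite inE.
have i1 X : measurable X -> intble P (\1_X : O -> R).
  by move=> mX; apply: (@bounded_intble _ _ _ _ _ 1) => // w; rewrite indicE; case: (_ \in _); rewrite ?normr1 ?normr0.
have mE k N : measurable (E k N) by exact/Am/AU.
have mF k N : measurable (F k N) by exact/Bm/BV.
have dcov N : (0 < N)%N -> `|Ex (fun w => discretize N (U w) * discretize N (V w))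
   - Ex (fun w => discretize N (U w)) * Ex (fun w => discretize N (V w))| <= al.
  move=> N0; have N0' : 0 < N%:R :> R by rewrite ltr0n.
  have EU : Ex (fun w => discretize N (U w)) = N%:R^-1 * \sum_(k < N) fine (P (E k N)).
    under eq_Rintegral do rewrite dE.
    rewrite RintegralZl//; last by apply: intble_sum => k _; exact/i1/mE.
    rewrite Rintegral_sum; last by move=> k _; exact/i1/mE.
    by congr (_ * _); apply: eq_bigr => k _; rewrite Rintegral_indic//; exact: mE.
  have EV : Ex (fun w => discretize N (V w)) = N%:R^-1 * \sum_(k < N) fine (P (F k N)).
    under eq_Rintegral do rewrite dE.
    rewrite RintegralZl//; last by apply: intble_sum => k _; exact/i1/mF.
    rewrite Rintegral_sum; last by move=> k _; exact/i1/mF.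
    by congr (_ * _); apply: eq_bigr => k _; rewrite Rintegral_indic//; exact: mF.
  have EUV : Ex (fun w => discretize N (U w) * discretize N (V w)) =
      N%:R^-1 * N%:R^-1 * \sum_(k < N) \sum_(l < N) fine (P (E k N `&` F l N)).
    have mEF k l : measurable (E k N `&` F l N) by exact: measurableI.
    under eq_Rintegral => w _.
      rewrite !dE mulrACA big_distrlr/=.
      under eq_bigr do under eq_bigr do rewrite -[_ * _]/((\1_(E _ N) \* \1_(F _ N)) w) -indicI.
      over.
    rewrite RintegralZl//; last by do 2 (apply: intble_sum => ? _); exact/i1/mEF.
    rewrite Rintegral_sum; last by move=> k _; apply: intble_sum => l _; exact/i1/mEF.
    congr (_ * _); apply: eq_bigr => k _.
    rewrite Rintegral_sum; last by move=> l _; exact/i1/mEF.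
    by apply: eq_bigr => l _; rewrite Rintegral_indic//; exact: mEF.
  rewrite EU EV EUV mulrACA -mulrBr normrM ger0_norm ?mulr_ge0 ?invr_ge0 ?(ltW N0')//.
  rewrite -invfM ler_pdivrMl ?mulr_gt0// big_distrlr/= -sumrB.
  apply: (le_trans (ler_norm_sum _ _ _)).
  have -> : N%:R * N%:R * al = \sum_(k < N) \sum_(l < N) al.
    by rewrite !sumr_const !card_ord -mulrnA -natrM mulr_natl.
  apply: ler_sum => k _; rewrite -sumrB; apply: (le_trans (ler_norm_sum _ _ _)).
  by apply: ler_sum => l _; apply: mixAB; [exact: AU|exact: BV].
apply/ler_addgt0Pr => e e0.
(* Two errors of 2/N: one for the mean of the product, one for the product of the means. *)
pose N := (Num.truncn (4 / e)).+1.
have N0' : 0 < N%:R :> R by [].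
have Ne : 4 * N%:R^-1 <= e.
  by rewrite ler_pdivrMr// mulrC -ler_pdivrMr// ltW// truncnS_gt.
have N0 : (0 < N)%N by [].
clearbody N.
pose U' w := discretize N (U w); pose V' w := discretize N (V w).
have U'01 w : 0 <= U' w <= 1 by exact: discretize_01.
have V'01 w : 0 <= V' w <= 1 by exact: discretize_01.
have mU' : measurable_fun setT U'.
  rewrite (_ : U' = fun w => N%:R^-1 * \sum_(k < N) \1_(E k N) w).
    apply: measurable_funM => //; apply: measurable_sum => k.
    exact: measurable_indic.
  by apply/funext => w; rewrite /U' dE.
have mV' : measurable_fun setT V'.
  rewrite (_ : V' = fun w => N%:R^-1 * \sum_(k < N) \1_(F k N) w).
    apply: measurable_funM => //; apply: measurable_sum => k.
    exact: measurable_indic.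
  by apply/funext => w; rewrite /V' dE.
have iU' : intble P U' by apply: (@bounded_intble _ _ _ _ _ 1) => // w; exact: bd01.
have iV' : intble P V' by apply: (@bounded_intble _ _ _ _ _ 1) => // w; exact: bd01.
have iUV' : intble P (fun w => U' w * V' w).
  by apply: (intbleM_bounded iU' mV' (M := 1)) => w; exact: bd01.
have dist (f g : O -> R) c : intble P f -> intble P g -> (forall w, `|f w - g w| <= c) ->
    `|Ex f - Ex g| <= c.
  move=> fi gi fg; rewrite -RintegralB//.
  apply: (le_trans (le_normr_Rintegral measurableT (intbleB fi gi))).
  rewrite -[leRHS](mean_cst P); apply: Rintegral_le => //.
    exact/intble_norm/intbleB.
  by apply: (@bounded_intble _ _ _ _ _ c) => // w; rewrite ger0_norm// (le_trans _ (fg w)).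
have dU w : `|U w - U' w| <= N%:R^-1.
  have /andP[h1 h2] := discretize_itv (U01 w) N0.
  by rewrite ger0_norm ?subr_ge0// lerBlDl.
have dV w : `|V w - V' w| <= N%:R^-1.
  have /andP[h1 h2] := discretize_itv (V01 w) N0.
  by rewrite ger0_norm ?subr_ge0// lerBlDl.
have hU := dist _ _ _ iU iU' dU; have hV := dist _ _ _ iV iV' dV.
have prod (a b a' b' : R) : 0 <= a <= 1 -> 0 <= b' <= 1 -> `|a - a'| <= N%:R^-1 ->
    `|b - b'| <= N%:R^-1 -> `|a * b - a' * b'| <= 2 * N%:R^-1.
  move=> a01 b01 ha hb; have -> : a * b - a' * b' = a * (b - b') + (a - a') * b' by ring.
  rewrite (le_trans (ler_normD _ _))// !normrM mulr2n mulrDl mul1r.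
  move: a01 b01 => /andP[a0 a1] /andP[b0 b1].
  apply: lerD.
    by rewrite -[leRHS]mul1r ler_pM// ger0_norm.
  by rewrite -[leRHS]mulr1 ler_pM// ger0_norm.
have hUV := dist _ _ _ iUV iUV' (fun w => prod _ _ _ _ (U01 w) (V'01 w) (dU w) (dV w)).
have E01 (f : O -> R) : intble P f -> (forall w, 0 <= f w <= 1) -> 0 <= Ex f <= 1.
  move=> fi f01; rewrite Rintegral_ge0/=; last by move=> w _; case/andP: (f01 w).
  rewrite -[leRHS](mean_cst P); apply: Rintegral_le => //.
    by apply: (@bounded_intble _ _ _ _ _ 1) => // w; rewrite normr1.
  by move=> w; case/andP: (f01 w).
have hUVp := prod _ _ _ _ (E01 _ iU U01) (E01 _ iV' V'01) hU hV.
have := dcov N N0; rewrite -/U' -/V' => hd.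
have -> : Ex (fun w => U w * V w) - Ex U * Ex V =
  (Ex (fun w => U w * V w) - Ex (fun w => U' w * V' w)) +
  (Ex (fun w => U' w * V' w) - Ex U' * Ex V') - (Ex U * Ex V - Ex U' * Ex V') by ring.
apply: (le_trans (ler_normB _ _)); apply: (le_trans (lerD (ler_normD _ _) (lexx _))).
by move: hd hUV hUVp Ne; lra.
Qed.

Lemma covariance_bounded (U V : O -> R) (a b : R) : 0 < a -> 0 < b ->
  (forall w, 0 <= U w <= a) -> (forall w, 0 <= V w <= b) ->
  measurable_fun setT U -> measurable_fun setT V ->
  (forall s, A [set w | s <= U w]) -> (forall s, B [set w | s <= V w]) ->
  `|Ex (fun w => U w * V w) - Ex U * Ex V| <= al * a * b.
Proof.
move=> a0 b0 Ua Vb mU mV AU BV.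
have iU : intble P U.
  by apply: (@bounded_intble _ _ _ _ _ a) => // w; case/andP: (Ua w) => h1 h2; rewrite ger0_norm.
have iV : intble P V.
  by apply: (@bounded_intble _ _ _ _ _ b) => // w; case/andP: (Vb w) => h1 h2; rewrite ger0_norm.
have iUV : intble P (fun w => U w * V w).
  apply: (intbleM_bounded iU mV (M := b)) => w.
  by case/andP: (Vb w) => h1 h2; rewrite ger0_norm.
have := @covariance_01 (fun w => a^-1 * U w) (fun w => b^-1 * V w).
have ai : 0 < a^-1 by rewrite invr_gt0. have bi : 0 < b^-1 by rewrite invr_gt0.
move=> /(_ _ _ _ _ _ _)/wrap[].
- move=> w; case/andP: (Ua w) => h1 h2; rewrite mulr_ge0 ?(ltW ai)//=.
  by rewrite ler_pdivrMl// mulr1.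
- move=> w; case/andP: (Vb w) => h1 h2; rewrite mulr_ge0 ?(ltW bi)//=.
  by rewrite ler_pdivrMl// mulr1.
- exact: measurable_funM.
- exact: measurable_funM.
- move=> s; have := AU (a * s); congr A; apply/seteqP; split=> w /=; rewrite ler_pdivlMl//.
- move=> s; have := BV (b * s); congr B; apply/seteqP; split=> w /=; rewrite ler_pdivlMl//.
rewrite RintegralZl// RintegralZl//.
under eq_Rintegral do rewrite mulrACA.
rewrite RintegralZl// mulrACA -mulrBr normrM ger0_norm; last by rewrite mulr_ge0 ?(ltW ai) ?(ltW bi).
rewrite -invfM ler_pdivrMl ?mulr_gt0// => /le_trans; apply.
by rewrite mulrC mulrA.
Qed.

End covariance.

Lemma bigmax_in_seq (s : seq nat) : s != [::] -> \max_(i <- s) i \in s.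
Proof.
elim: s => // a [|b s] ih _; first by rewrite big_seq1 mem_head.
rewrite big_cons; case: leqP => _; last by rewrite mem_head.
by rewrite in_cons ih ?orbT.
Qed.

(** * Stationarity, and the mixing properties of centred sequences *)

Section stationary_sums.
Context dO (O : measurableType dO) (R : realType) (P : probability O R).
Context dT (T : measurableType dT) (X : int -> {RV P >-> T}).
Hypothesis statX : stationary X.
Local Notation "'Ex' f" := (Rintegral P setT f) (at level 10, f at level 9).

(** Stationarity speaks of tuple events; it passes to bounded functionals because the two tuples
    have the same image measure. *)
Lemma stationary_mean k (t : k.-tuple int) (h : int) (Phi : k.-tuple T -> R) (M : R) :
  measurable_fun setT Phi -> (forall x, `|Phi x| <= M) ->
  Ex (fun w => Phi [tuple X (tnth t j + h) w | j < k]) =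
  Ex (fun w => Phi [tuple X (tnth t j) w | j < k]).
Proof.
move=> mPhi PhiM.
have mY h' : measurable_fun setT (fun w => [tuple X (tnth t j + h') w | j < k]).
  apply/measurable_fun_tnthP => j.
  rewrite (_ : _ \o _ = X (tnth t j + h')) //.
  by apply/funext => w /=; rewrite tnth_mktuple.
have mY0 : measurable_fun setT (fun w => [tuple X (tnth t j) w | j < k]).
  by have := mY 0; under eq_fun do under eq_mktuple do rewrite addr0.
pose nu : {measure set (k.-tuple T) -> \bar R} :=
  measure_function_pushforward__canonical__measure_function_Measure P mY0.
have bd (Y : O -> k.-tuple T) : measurable_fun setT Y -> intble P (Phi \o Y).
  move=> mYY; apply: (@bounded_intble _ _ _ _ _ M) => [|w]; last exact: PhiM.
  exact: measurableT_comp.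
rewrite -(@Rintegral_image _ _ _ _ _ P nu _ (mY h) _ _ mPhi (bd _ (mY h))).
  by rewrite -(@Rintegral_image _ _ _ _ _ P nu _ mY0 _ _ mPhi (bd _ mY0)).
by move=> A mA; rewrite /nu/= /pushforward; exact/esym/statX.
Qed.

Variable b : T -> R.
Hypotheses (mb : measurable_fun setT b) (b1 : forall x, `|b x| <= 1).

Definition law_mean : R := Ex (fun w => b (X 1 w)).

Lemma law_mean_le1 : `|law_mean| <= 1.
Proof.
have ib : intble P (fun w => b (X 1 w)).
  by apply: (@bounded_intble _ _ _ _ _ 1) => [|w]; [exact: measurableT_comp|exact: b1].
apply: (le_trans (le_normr_Rintegral measurableT ib)).
rewrite -[leRHS](mean_cst P); apply: Rintegral_le.
- exact: intble_norm.
- by apply: (@bounded_intble _ _ _ _ _ 1) => // w; rewrite normr1.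
- by move=> w; exact: b1.
Qed.

(* Halved so as to be bounded by one. *)
Definition centered (h : int) (i : nat) (w : O) : R :=
  (b (X (i.+1%:Z + h) w) - law_mean) / 2.

Lemma centered_le1 h i w : `|centered h i w| <= 1.
Proof.
rewrite /centered normrM [`|2^-1|]ger0_norm// ler_pdivrMr// mul1r.
by rewrite (le_trans (ler_normB _ _))// [leRHS]mulr2n lerD// law_mean_le1.
Qed.

Lemma measurable_centered h i : measurable_fun setT (centered h i).
Proof.
apply: measurable_funM => //; apply: measurable_funB => //.
exact: measurableT_comp.
Qed.

Let tuple_sum k (x : k.-tuple T) : R := \sum_(l < k) (b (tnth x l) - law_mean) / 2.

Let measurable_tuple_sum k : measurable_fun setT (@tuple_sum k).
Proof.
apply: measurable_sum => l; apply: measurable_funM => //; apply: measurable_funB => //.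
apply: measurableT_comp => //; exact: measurable_tnth.
Qed.

(** Presents a partial sum over any index list as a function of one tuple of variables, the form in
    which [stationary] applies. *)
Let psum_tuple h J w : psum (centered h) J w =
  tuple_sum [tuple X (tnth (in_tuple [seq i.+1%:Z | i <- J]) j + h) w | j < _].
Proof.
rewrite /psum /tuple_sum.
transitivity (\sum_(z <- [seq i.+1%:Z | i <- J]) (b (X (z + h) w) - law_mean) / 2).
  by rewrite big_map.
by rewrite big_tnth; apply: eq_bigr => l _; rewrite tnth_mktuple.
Qed.

Let tuple_sum_le k (x : k.-tuple T) : `|tuple_sum x| <= k%:R.
Proof.
apply: (le_trans (ler_norm_sum _ _ _)).
rewrite -[k in leRHS]card_ord -sumr_const; apply: ler_sum => l _.
rewrite normrM [`|2^-1|]ger0_norm// ler_pdivrMr// mul1r.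
by rewrite (le_trans (ler_normB _ _))// [leRHS]mulr2n lerD// law_mean_le1.
Qed.

Lemma laplace_shift (t : R) J h :
  Ex (fun w => expR (t * psum (centered h) J w)) =
  Ex (fun w => expR (t * psum (centered 0) J w)).
Proof.
pose k := size [seq i.+1%:Z | i <- J].
have mPhi : measurable_fun setT (fun x : k.-tuple T => expR (t * tuple_sum x)).
  apply: measurableT_comp; first exact: measurable_expR.
  by apply: measurable_funM => //; exact: measurable_tuple_sum.
have bPhi (x : k.-tuple T) : `|expR (t * tuple_sum x)| <= expR (`|t| * k%:R).
  rewrite ger0_norm ?expR_ge0// ler_expR (le_trans (ler_norm _))// normrM.
  by rewrite ler_wpM2l.
under eq_Rintegral do rewrite psum_tuple.
under [RHS]eq_Rintegral do rewrite psum_tuple.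
rewrite (stationary_mean (in_tuple _) h mPhi bPhi).
by rewrite (stationary_mean (in_tuple _) 0 mPhi bPhi).
Qed.

Lemma centered_mean0 h i : Ex (centered h i) = 0.
Proof.
have ib z : intble P (fun w => b (X z w)).
  by apply: (@bounded_intble _ _ _ _ _ 1) => [|w]; [exact: measurableT_comp|exact: b1].
have ic : intble P (fun=> law_mean).
  by apply: (@bounded_intble _ _ _ _ _ 1) => // w; exact: law_mean_le1.
rewrite /centered RintegralZr//; last exact: intbleB.
rewrite RintegralB// mean_cst.
have mPhi : measurable_fun setT (fun x : 1.-tuple T => b (tnth x ord0)).
  by apply: measurableT_comp => //; exact: measurable_tnth.
have := stationary_mean [tuple 1%:Z] (i%:Z + h) mPhi (fun x => b1 _).
under eq_Rintegral do rewrite tnth_mktuple (tnth_nth 0)/=.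
under [in X in _ = X]eq_Rintegral do rewrite tnth_mktuple (tnth_nth 0)/=.
have -> : 1%:Z + (i%:Z + h) = i.+1%:Z + h by rewrite addrA -intS.
by move=> ->; rewrite subrr mul0r.
Qed.

Lemma covariance_shift i j h :
  Ex (fun w => centered h i w * centered h j w) =
  Ex (fun w => centered 0 i w * centered 0 j w).
Proof.
pose Phi (x : 2.-tuple T) := ((b (tnth x ord0) - law_mean) / 2) *
  ((b (tnth x ord_max) - law_mean) / 2).
have mPhi : measurable_fun setT Phi.
  apply: measurable_funM; apply: measurable_funM => //; apply: measurable_funB => //;
  by apply: measurableT_comp => //; exact: measurable_tnth.
have bPhi x : `|Phi x| <= 1.
  have h1 y : `|(b y - law_mean) / 2| <= 1.
    rewrite normrM [`|2^-1|]ger0_norm// ler_pdivrMr// mul1r.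
    by rewrite (le_trans (ler_normB _ _))// [leRHS]mulr2n lerD// law_mean_le1.
  by rewrite normrM mulr_ile1.
have E h' : (fun w => centered h' i w * centered h' j w) =
   (fun w => Phi [tuple X (tnth [tuple i.+1%:Z; j.+1%:Z] l + h') w | l < 2]).
  by apply/funext => w; rewrite /Phi !tnth_mktuple !(tnth_nth 0).
by rewrite !E (stationary_mean _ h mPhi bPhi) (stationary_mean _ 0 mPhi bPhi).
Qed.

Section sigma_of.
Variable J : set int.

Let G := \bigcup_(j in J) preimage_set_system setT (X j) measurable.

Lemma sigma_of_measurable : sigma_of X J `<=` measurable.
Proof.
apply: smallest_sub; first exact: sigma_algebra_measurable.
by move=> A [j _ [B mB <-]]; exact: measurable_funPT.
Qed.

(** The sample space with the sigma-algebra generated by the X_j, j in J. Measurability over [OJ] is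
    stable under the usual operations and puts level sets in [sigma_of]. *)
Let OJ := g_sigma_algebraType G.

Let measurable_RV j : J j -> measurable_fun [set: OJ] (X j : OJ -> T).
Proof.
move=> Jj _ B mB; apply: sub_sigma_algebra; exists j => //.
by exists B.
Qed.

Lemma sigma_of_level (U : O -> R) (s : R) : measurable_fun [set: OJ] (U : OJ -> R) ->
  sigma_of X J [set w | s <= U w].
Proof.
move=> mU; have := mU measurableT `[s, +oo[%classic (measurable_itv _).
rewrite setTI; congr (_ _); apply/seteqP; split => w /=; rewrite in_itv/= andbT//.
Qed.

Lemma sigma_of_centered h i : J (i.+1%:Z + h) ->
  measurable_fun [set: OJ] (centered h i : OJ -> R).
Proof.
move=> Ji; apply: measurable_funM => //; apply: measurable_funB => //.
by apply: measurableT_comp => //; exact: measurable_RV.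
Qed.

Lemma sigma_of_psum h L : (forall i, i \in L -> J (i.+1%:Z + h)) ->
  measurable_fun [set: OJ] (psum (centered h) L : OJ -> R).
Proof.
(* The membership test makes every summand measurable, as [measurable_sum] quantifies over all
   indices. *)
move=> LJ; apply: (eq_measurable_fun (fun w : OJ =>
    \sum_(i <- L) (if i \in L then centered h i w else 0))) => [w _|].
  by apply: eq_big_seq => i ->.
apply: measurable_sum => i; have [/LJ iL|_] := boolP (i \in L); last exact: measurable_cst.
exact: sigma_of_centered.
Qed.

End sigma_of.

Lemma alpha_ub (i : nat) E F : sigma_of X [set j | j <= 0] E ->
  sigma_of X [set j | i%:Z <= j] F ->
  `|fine (P (E `&` F)) - fine (P E) * fine (P F)| <= alpha X i.
Proof.
move=> sE sF; apply: ub_le_sup; last by exists E => //; exists F.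
exists 2 => _ [A sA [B sB <-]].
have mA := sigma_of_measurable sA; have mB := sigma_of_measurable sB.
have p1 C : measurable C -> 0 <= fine (P C) <= 1.
  move=> mC; rewrite fine_ge0//= -lee_fin fineK ?probability_le1//.
  by rewrite ge0_fin_numE// (le_lt_trans (probability_le1 P mC))// ltry.
have /andP[a0 a1] := p1 _ mA; have /andP[b0 b1'] := p1 _ mB.
have /andP[c0 c1] := p1 _ (measurableI _ _ mA mB).
apply: (le_trans (ler_normB _ _)); rewrite !ger0_norm ?mulr_ge0// mulr2n.
by rewrite lerD// mulr_ile1.
Qed.

Variables (g1 g2 : R).
Hypothesis alphaX : forall i : nat, (1 <= i)%N -> alpha X i <= g1 * expR (- (g2 * i%:R)).

(** The coefficient [alpha] compares the past of time 0 with a future. Stationarity allows a shift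
    that brings the last index of the first block to time 0, after which the covariance inequality
    applies. *)
Lemma mixing_seq_centered : mixing_seq P (centered 0) g1 g2.
Proof.
have alpha0 g : (1 <= g)%N -> 0 <= g1 * expR (- (g2 * g%:R)).
  move=> g0; apply: le_trans (alphaX g0).
  have sT (J : set int) : sigma_of X J set0 by exact: sigma_algebra0.
  by apply: le_trans (alpha_ub (sT _) (sT _)); exact: normr_ge0.
split.
- exact: measurable_centered.
- exact: centered_le1.
- exact: centered_mean0.
- move=> J1 J2 g t g0 t0 gap.
  (* An empty block has no last index; there the nonnegativity of the error term suffices. *)
  case: J1 gap => [_|i0 J1'].
    under eq_Rintegral do rewrite {1}/psum big_nil mulr0 expR0 mul1r.
    under [X in _ <= X * _ + _]eq_Rintegral do rewrite {1}/psum big_nil mulr0 expR0.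
    by rewrite mean_cst mul1r lerDl mulr_ge0 ?expR_ge0// alpha0.
  set J1 := i0 :: J1' => gap.
  (* Index i stands for time i + 1, hence the shift by -(M + 1). *)
  pose M := \max_(i <- J1) i; pose h : int := - M.+1%:Z.
  have leM i : i \in J1 -> (i <= M)%N by move=> iJ; exact: leq_bigmax_seq.
  have MJ : M \in J1 by exact: bigmax_in_seq.
  rewrite -(laplace_shift t J1 h) -(laplace_shift t J2 h).
  have -> : Ex (fun w => expR (t * psum (centered 0) J1 w) * expR (t * psum (centered 0) J2 w))
     = Ex (fun w => expR (t * psum (centered h) J1 w) * expR (t * psum (centered h) J2 w)).
    under eq_Rintegral do rewrite -expRD -mulrDr -psum_cat.
    rewrite -(laplace_shift t (J1 ++ J2) h).
    by under eq_Rintegral do rewrite psum_cat mulrDr expRD.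
  have mE J : measurable_fun setT (fun w => expR (t * psum (centered h) J w)).
    apply: measurableT_comp; first exact: measurable_expR.
    by apply: measurable_funM => //; apply: measurable_psum' => i; exact: measurable_centered.
  have bE J w : 0 <= expR (t * psum (centered h) J w) <= expR (t * (size J)%:R).
    rewrite expR_ge0 ler_expR ler_wpM2l// /psum; elim: J => [|i J ih].
      by rewrite big_nil.
    by rewrite big_cons -natr1 addrC lerD// (le_trans (ler_norm _))// centered_le1.
  have lev (J : set int) L s : (forall i, i \in L -> J (i.+1%:Z + h)) ->
      sigma_of X J [set w | s <= expR (t * psum (centered h) L w)].
    move=> LJ; apply: sigma_of_level.
    apply: measurableT_comp; first exact: measurable_expR.
    by apply: measurable_funM => //; exact: sigma_of_psum.
  have := @covariance_bounded _ O R P (sigma_of X [set j | j <= 0])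
    (sigma_of X [set j | g%:Z <= j]) (alpha X g) (@sigma_of_measurable _)
    (@sigma_of_measurable _) (@alpha_ub g) _ _ _ _ (expR_gt0 _) (expR_gt0 _)
    (bE J1) (bE J2) (mE J1) (mE J2).
  move=> /(_ _ _)/wrap[].
  + by move=> s; apply: lev => i /leM iM /=; rewrite /h; lia.
  + move=> s; apply: lev => j jJ /=; rewrite /h.
    by have := gap _ _ MJ jJ; lia.
  move=> /ler_normlP[_]; rewrite lerBlDl => /le_trans; apply.
  rewrite lerD2l mulrDr expRD mulrA ler_wpM2r ?expR_ge0//.
  by rewrite ler_wpM2r ?expR_ge0// alphaX.
- move=> i j ij; pose h : int := - i.+1%:Z; pose g := (j - i)%N.
  have g0 : (1 <= g)%N by rewrite subn_gt0.
  rewrite -(covariance_shift i j h).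
  (* Maps [-1, 1] onto [0, 1]. Halving both variables divides the covariance by 4, the origin of the
     factor 4 in [mixing_cov]. *)
  pose U l w := (centered h l w + 1) / 2.
  have U01 l w : 0 <= U l w <= 1.
    by rewrite /U; have := centered_le1 h l w; rewrite ler_norml => /andP[? ?]; lra.
  have mU l : measurable_fun setT (U l).
    apply: measurable_funM => //; apply: measurable_funD => //; exact: measurable_centered.
  have lev (J : set int) l s : J (l.+1%:Z + h) -> sigma_of X J [set w | s <= U l w].
    move=> Jl; apply: sigma_of_level.
    by apply: measurable_funM => //; apply: measurable_funD => //; exact: sigma_of_centered.
  have := @covariance_01 _ O R P (sigma_of X [set j | j <= 0])
    (sigma_of X [set j | g%:Z <= j]) (alpha X g) (@sigma_of_measurable _)
    (@sigma_of_measurable _) (@alpha_ub g) _ _ (U01 i) (U01 j) (mU i) (mU j).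
  move=> /(_ _ _)/wrap[].
  + by move=> s; apply: lev => /=; rewrite /h subrr.
  + by move=> s; apply: lev => /=; rewrite /h /g; lia.
  have ic l : intble P (centered h l).
    by apply: (@bounded_intble _ _ _ _ _ 1) => [|w]; [exact: measurable_centered|exact: centered_le1].
  have icc : intble P (fun w => centered h i w * centered h j w).
    by apply: (intbleM_bounded (ic i) (measurable_centered h j) (M := 1)) => w; exact: centered_le1.
  have i1 : intble P (fun=> 1 : R).
    by apply: (@bounded_intble _ _ _ _ _ 1) => // w; rewrite normr1.
  have EU l : Ex (U l) = 2^-1.
    rewrite RintegralZr//; last exact: intbleD.
    by rewrite RintegralD// centered_mean0 mean_cst add0r mul1r.
  have -> : Ex (fun w => U i w * U j w) =
      4^-1 * Ex (fun w => centered h i w * centered h j w) + 4^-1.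
    have E w : U i w * U j w = 4^-1 * (centered h i w * centered h j w +
       (centered h i w + centered h j w + 1)) by rewrite /U; field.
    under eq_Rintegral do rewrite E.
    have i3 : intble P (fun w => centered h i w + centered h j w) by exact: intbleD.
    have i4 : intble P (fun w => centered h i w + centered h j w + 1) by exact: intbleD.
    rewrite RintegralZl//; last exact: intbleD.
    rewrite RintegralD// RintegralD// RintegralD// !centered_mean0 mean_cst.
    by rewrite !add0r mulrDr mulr1.
  rewrite !EU => /ler_normlP[_ hh].
  have := alphaX g0; rewrite -/g; lra.
Qed.

End stationary_sums.

(** * Fourier inversion *)

Section derivatives.
Context (R : realType).
Implicit Types (f g : R -> R) (x : R).

Lemma derD f g x df dg : is_derive x 1 f df -> is_derive x 1 g dg ->
  is_derive x 1 (fun y => f y + g y) (df + dg).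
Proof. by move=> a b; exact: is_deriveD. Qed.

Lemma derM f g x df dg : is_derive x 1 f df -> is_derive x 1 g dg ->
  is_derive x 1 (fun y => f y * g y) (f x * dg + g x * df).
Proof. by move=> a b; exact: is_deriveM. Qed.

Lemma der_cst (c x : R) : is_derive x 1 (fun=> c : R) 0.
Proof. exact: is_derive_cst. Qed.

Lemma derZ (c : R) f x df : is_derive x 1 f df -> is_derive x 1 (fun y => c * f y) (c * df).
Proof.
move=> h; apply: (is_derive_eq (derM (der_cst c x) h)).
by rewrite mulr0 addr0.
Qed.

Lemma der_id x : is_derive x 1 (fun y : R => y) 1.
Proof. exact: is_derive_id. Qed.

Lemma der_comp f g x df dg : is_derive (g x) 1 f df -> is_derive x 1 g dg ->
  is_derive x 1 (fun y => f (g y)) (df * dg).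
Proof.
move=> a b; have h := @is_derive1_comp R f g x df dg a b.
by apply: (is_derive_eq h); rewrite mulrC.
Qed.

Lemma der_scaled f (c x df : R) : is_derive (c * x) 1 f df ->
  is_derive x 1 (fun y => f (c * y)) (c * df).
Proof.
move=> h; apply: (is_derive_eq (der_comp h (derZ c (der_id x)))).
by rewrite mulr1 mulrC.
Qed.

Lemma der_continuous f x df : is_derive x 1 f df -> {for x, continuous f}.
Proof.
by move=> [/derivable1_diffP df' _]; exact: differentiable_continuous.
Qed.

Lemma integral_ray (f F : R -> R) (l : R) :
  (forall x, 0 <= x -> 0 <= f x) -> continuous f -> (forall x, is_derive x 1 F (f x)) ->
  F x @[x --> +oo%R] --> l ->
  (\int[@lebesgue_measure R]_(x in `]0%R, +oo[) (f x)%:E = (l - F 0)%:E)%E.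
Proof.
move=> f0 cf dF Fl.
rewrite integral_itv_obnd_cbnd; last first.
  by apply/measurable_EFinP; apply: measurable_funTS; exact: continuous_measurable_fun.
rewrite EFinB; apply: ge0_continuous_FTC2y => //.
- exact: continuous_subspaceT.
- by apply: cvg_at_right_filter; exact: der_continuous (dF 0).
- by move=> x _; rewrite derive1E derive_val.
Qed.

Lemma integral_segment (f F : R -> R) (a b : R) : a < b ->
  continuous f -> (forall x, is_derive x 1 F (f x)) ->
  (\int[@lebesgue_measure R]_(x in `[a, b]) (f x)%:E = (F b - F a)%:E)%E.
Proof.
move=> ab cf dF; rewrite EFinB; apply: continuous_FTC2 => //.
- exact: continuous_subspaceT.
- split=> //.
  + by apply: cvg_at_right_filter; exact: der_continuous (dF a).
  + by apply: cvg_at_left_filter; exact: der_continuous (dF b).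
- by move=> x _; rewrite derive1E derive_val.
Qed.

End derivatives.

(** * The integral of (1 - cos(a u)) / u^2 over the line *)

Section dirichlet.
Context (R : realType).
Local Notation mu := (@lebesgue_measure R).

Lemma sin_le_norm (x : R) : `|sin x| <= `|x|.
Proof.
wlog x0 : x / 0 <= x => [h|].
  have [x0|x0] := leP 0 x; first exact: h.
  by rewrite -normrN -[leRHS]normrN -sinN; apply: h; rewrite oppr_ge0 ltW.
have [->|x0'] := eqVneq x 0; first by rewrite sin0 normr0.
have xgt0 : 0 < x by rewrite lt_neqAle eq_sym x0' x0.
have hd (y : R) : y \in `]0, x[ -> is_derive y 1 sin (cos y) by move=> _; exact: is_derive_sin.
have hc : {within `[0, x], continuous (@sin R)}.
  by apply: continuous_subspaceT; exact: continuous_sin.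
have [c _] := MVT xgt0 hd hc; rewrite sin0 !subr0.
move=> ->; rewrite normrM ler_piMl// cos_max//.
Qed.

Lemma cvg_inv_pinfty : (x^-1 : R) @[x --> +oo%R] --> (0 : R).
Proof.
have pos : \forall x \near +oo%R, (0 : R) < x by exact: nbhs_pinfty_gt.
by have [_ h] := gtr0_cvgV0 pos; apply: h; exact: cvg_id.
Qed.

Lemma cvg_bounded_exp (f : R -> R) (M s : R) : 0 < s -> (forall x, `|f x| <= M) ->
  f x * expR (- (s * x)) @[x --> +oo%R] --> (0 : R).
Proof.
move=> s0 fM.
apply/norm_cvg0P; apply: (@squeeze_cvgr _ _ _ _ (fun=> 0) (fun x => M / s * x^-1)).
- near=> x; rewrite normr_ge0/= normrM (ger0_norm (expR_ge0 _)).
  have x0 : 0 < x by near: x; exact: nbhs_pinfty_gt.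
  rewrite -mulrA ler_pM ?expR_ge0// expRN -invfM lef_pV2 ?posrE ?expR_gt0 ?mulr_gt0//.
  by rewrite (le_trans _ (expR_ge1Dx _))// lerDr.
- exact: cvg_cst.
- rewrite -(mulr0 (M / s)); apply: cvgMr; exact: cvg_inv_pinfty.
Unshelve. all: by end_near. Qed.

Lemma cvg_id_exp (s : R) : 0 < s -> x * expR (- (s * x)) @[x --> +oo%R] --> (0 : R).
Proof.
move=> s0.
apply: (@squeeze_cvgr _ _ _ _ (fun=> 0) (fun x => 4 / s ^+ 2 * x^-1)).
- near=> x.
  have x0 : 0 < x by near: x; exact: nbhs_pinfty_gt.
  rewrite mulr_ge0 ?expR_ge0 ?(ltW x0)//= expRN ler_pdivrMr ?expR_gt0//.
  have -> : expR (s * x) = expR (s * x / 2) ^+ 2 by rewrite -expRM_natl; congr expR; field.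
  have h : s * x / 2 <= expR (s * x / 2) by rewrite (le_trans _ (expR_ge1Dx _))// lerDr.
  have h2 : (s * x / 2) ^+ 2 <= expR (s * x / 2) ^+ 2.
    by rewrite lerXn2r ?nnegrE ?expR_ge0// divr_ge0// mulr_ge0 ?(ltW s0) ?(ltW x0).
  apply: (@le_trans _ _ (4 / s ^+ 2 * x^-1 * (s * x / 2) ^+ 2)).
    rewrite le_eqVlt; apply/orP; left; apply/eqP; field.
    by rewrite !lt0r_neq0.
  by rewrite ler_wpM2l// mulr_ge0 ?invr_ge0 ?(ltW x0)// divr_ge0 ?sqr_ge0.
- exact: cvg_cst.
- rewrite -(mulr0 (4 / s ^+ 2)); apply: cvgMr; exact: cvg_inv_pinfty.
Unshelve. all: by end_near. Qed.

Lemma continuous_exp_scaled (s : R) : continuous (fun x : R => expR (- (s * x))).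
Proof.
move=> x; under eq_fun do rewrite -mulNr.
exact: der_continuous (der_scaled (is_derive_expR _)).
Qed.

Lemma der_exp_scaled (s x : R) :
  is_derive x 1 (fun y => expR (- (s * y))) (- s * expR (- (s * x))).
Proof.
under eq_fun do rewrite -mulNr; rewrite -mulNr.
exact: (der_scaled (is_derive_expR _)).
Qed.

Lemma continuous_cos_scaled (a : R) : continuous (fun x : R => cos (a * x)).
Proof. by move=> x; exact: der_continuous (der_scaled (is_derive_cos _)). Qed.

Lemma integral_gamma2 (u : R) : 0 < u ->
  (\int[mu]_(s in `]0%R, +oo[) (s * expR (- (u * s)))%:E = (u ^- 2)%:E)%E.
Proof.
move=> u0.
pose F (s : R) := - (u^-1 * (s * expR (- (u * s))) + u ^- 2 * expR (- (u * s))).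
have pos (s : R) : 0 <= s -> 0 <= s * expR (- (u * s)) by move=> s0; rewrite mulr_ge0 ?expR_ge0.
have cf : continuous (fun s : R => s * expR (- (u * s))).
  by move=> x; apply: cvgM; [exact: cvg_id|exact: continuous_exp_scaled].
have dF (x : R) : is_derive x 1 F (x * expR (- (u * x))).
  have h := der_exp_scaled u x.
  have := derZ (- 1) (derD (derZ u^-1 (derM (der_id x) h)) (derZ (u ^- 2) h)).
  rewrite (_ : (fun y => _) = F) => [h1|]; last by apply/funext => s; rewrite mulN1r.
  by apply: (is_derive_eq h1); field; rewrite lt0r_neq0.
have lF : F x @[x --> +oo%R] --> (0 : R).
  rewrite -oppr0; apply: cvgN; rewrite -[X in _ --> X]addr0; apply: cvgD.
    by rewrite -(mulr0 u^-1); apply: cvgMr; exact: cvg_id_exp.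
  rewrite -(mulr0 (u ^- 2)); apply: cvgMr.
  under eq_fun do rewrite -[expR _]mul1r.
  by apply: (@cvg_bounded_exp (fun=> 1) 1) => // x; rewrite normr1.
rewrite (integral_ray pos cf dF lF) /F.
by congr (_%:E); rewrite mul0r !mulr0 oppr0 expR0; ring.
Qed.

Lemma integral_laplace_cos (a s : R) : 0 < s ->
  (\int[mu]_(u in `]0%R, +oo[) ((1 - cos (a * u)) * expR (- (s * u)))%:E
   = (a ^+ 2 / (s * (s ^+ 2 + a ^+ 2)))%:E)%E.
Proof.
move=> s0; have s2 : 0 < s ^+ 2 + a ^+ 2 by rewrite ltr_pwDl ?exprn_gt0 ?sqr_ge0.
pose c := (s ^+ 2 + a ^+ 2)^-1.
pose G (u : R) := - s^-1 - c * (a * sin (a * u) - s * cos (a * u)).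
have pos (x : R) : 0 <= x -> 0 <= (1 - cos (a * x)) * expR (- (s * x)).
  by move=> x0; rewrite mulr_ge0 ?expR_ge0// subr_ge0 cos_le1.
have cf : continuous (fun x : R => (1 - cos (a * x)) * expR (- (s * x))).
  move=> x; apply: cvgM; last exact: continuous_exp_scaled.
  by apply: cvgB; [exact: cvg_cst|exact: continuous_cos_scaled].
have dF (x : R) : is_derive x 1 (fun u => G u * expR (- (s * u))) ((1 - cos (a * x)) * expR (- (s * x))).
  have he := der_exp_scaled s x.
  have hs := der_scaled (is_derive_sin (a * x)).
  have hc := der_scaled (is_derive_cos (a * x)).
  have hG := derD (der_cst (- s^-1) x) (derZ (- c) (derD (derZ a hs) (derZ (- s) hc))).
  have := derM hG he.
  rewrite (_ : (fun y => _) = fun u => G u * expR (- (s * u))) => [h1|]; last first.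
    by apply/funext => y; rewrite /G !mulNr.
  by apply: (is_derive_eq h1); rewrite /c; field; rewrite !lt0r_neq0.
have lF : G x * expR (- (s * x)) @[x --> +oo%R] --> (0 : R).
  apply: (@cvg_bounded_exp G (s^-1 + `|c| * (`|a| + `|s|))) => // x.
  rewrite /G (le_trans (ler_normB _ _))// normrN lerD ?normrM ?ler_wpM2l//.
    by rewrite ger0_norm// invr_ge0 ltW.
  rewrite (le_trans (ler_normB _ _))// !normrM lerD// ler_piMr//.
    exact: sin_max.
  exact: cos_max.
rewrite (integral_ray pos cf dF lF).
rewrite /G !mulr0 sin0 cos0 oppr0 expR0 /c; congr (_%:E); field.
by rewrite !lt0r_neq0.
Qed.

Lemma integral_cauchy_scaled (a : R) : 0 < a ->
  (\int[mu]_(s in `]0%R, +oo[) (a ^+ 2 / (s ^+ 2 + a ^+ 2))%:E = (a * (pi / 2))%:E)%E.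
Proof.
move=> a0.
have d0 (x : R) : 0 < x ^+ 2 + a ^+ 2 by rewrite ltr_wpDl ?exprn_gt0 ?sqr_ge0.
have dd (x : R) : is_derive x 1 (fun s : R => s ^+ 2 + a ^+ 2) (2 * x).
  apply: (is_derive_eq (derD (derM (der_id x) (der_id x)) (der_cst _ x))).
  by rewrite addr0 mulr1 mulr_natl.
have pos (x : R) : 0 <= x -> 0 <= a ^+ 2 / (x ^+ 2 + a ^+ 2).
  by move=> x0; rewrite divr_ge0 ?sqr_ge0 ?(ltW (d0 _)).
have cf : continuous (fun x : R => a ^+ 2 / (x ^+ 2 + a ^+ 2)).
  move=> x; apply: cvgM; first exact: cvg_cst.
  by apply: cvgV; [rewrite lt0r_neq0|exact: der_continuous (dd x)].
have dF (x : R) : is_derive x 1 (fun s => a * atan (a^-1 * s)) (a ^+ 2 / (x ^+ 2 + a ^+ 2)).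
  apply: (is_derive_eq (derZ a (der_scaled (is_derive1_atan _)))).
  by field; rewrite !lt0r_neq0.
have lF : a * atan (a^-1 * x) @[x --> +oo%R] --> (a * (pi / 2)).
  apply: cvgMr; apply: (cvg_comp (fun s => a^-1 * s) (@atan R)); last exact: cvgy_atan.
  by apply: gt0_cvgMry; [rewrite invr_gt0|exact: cvg_id].
by rewrite (integral_ray pos cf dF lF) mulr0 atan0 mulr0 subr0.
Qed.

(* Tonelli, after writing u^-2 as the integral of s exp(-us) over s > 0. *)
Lemma integral_one_minus_cos (a : R) :
  (\int[mu]_u ((1 - cos (a * u)) / u ^+ 2)%:E = (pi * `|a|)%:E)%E.
Proof.
wlog a0 : a / 0 < a => [h|].
  have [a0|a0|->] := ltgtP a 0.
  - rewrite -[`|a|]normrN -h ?oppr_gt0//; apply: eq_integral => u _.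
    by rewrite mulNr cosN.
  - exact: h.
  - by rewrite normr0 mulr0 integral0_eq// => u _; rewrite mul0r cos0 subrr mul0r.
rewrite gtr0_norm//.
pose f (z : R * R) := (z.2 * expR (- (`|z.1| * z.2)) * (1 - cos (a * z.1)))%:E.
pose D : set R := `]0%R, +oo[%classic.
have mD : measurable D by exact: measurable_itv.
pose g (z : R * R) := (f z * (\1_D z.2)%:E)%E.
have mf : measurable_fun setT f.
  apply/measurable_EFinP; apply: measurable_funM.
    apply: measurable_funM; first exact: measurable_snd.
    apply: measurableT_comp; first exact: measurable_expR.
    apply: measurableT_comp => //; apply: measurable_funM; last exact: measurable_snd.
    by apply: measurableT_comp => //; exact: measurable_fst.
  apply: measurable_funB => //.
  apply: measurableT_comp; first exact: continuous_measurable_fun (@continuous_cos R).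
  by apply: measurable_funM => //; exact: measurable_fst.
have mg : measurable_fun setT g.
  apply: emeasurable_funM => //; apply/measurable_EFinP.
  by apply: measurableT_comp; [exact: measurable_indic|exact: measurable_snd].
have g0 z : (0 <= g z)%E.
  rewrite /g /f -EFinM lee_fin indicE; case: (boolP (z.2 \in D)) => [|_]; last by rewrite mulr0.
  rewrite inE /D/= in_itv/= andbT => z0.
  by rewrite mulr1 !mulr_ge0 ?expR_ge0 ?(ltW z0)// subr_ge0 cos_le1.
have onD (h : R -> R) : (\int[mu]_s ((h s)%:E * (\1_D s)%:E) = \int[mu]_(s in D) (h s)%:E)%E.
  rewrite [RHS]integral_mkcond; apply: eq_integral => s _.
  by rewrite patchE indicE; case: ifPn => sD; rewrite ?mule1 ?mule0.
have inner_s u : (\int[mu]_s g (u, s) = ((1 - cos (a * u)) / u ^+ 2)%:E)%E.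
  rewrite /g /f/= (onD (fun s => s * expR (- (`|u| * s)) * (1 - cos (a * u)))).
  (* At u = 0 the factor 1 - cos(a u) kills both sides; [integral_gamma2] covers only u > 0. *)
  have [->|u0] := eqVneq u 0.
    by rewrite mulr0 cos0 subrr mul0r integral0_eq// => s _; rewrite mulr0.
  under eq_integral do rewrite mulrC EFinM.
  rewrite ge0_integralZl//; first last.
  - move=> s; rewrite /D/= in_itv/= andbT => s0.
    by rewrite lee_fin mulr_ge0 ?expR_ge0// ltW.
  - apply/measurable_EFinP; apply: measurable_funTS; apply: measurable_funM => //.
    by apply: continuous_measurable_fun; exact: continuous_exp_scaled.
  by rewrite integral_gamma2 ?normr_gt0// -EFinM real_normK ?num_real.
transitivity (\int[mu]_s \int[mu]_u g (u, s))%E.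
  apply: etrans (@fubini_tonelli _ _ _ _ R mu mu g mg g0).
  by apply: eq_integral => u _; rewrite inner_s.
(* The integrand is even in u, hence twice a Laplace transform over the half line. *)
have inner_u s : (\int[mu]_u g (u, s) = (2 * (a ^+ 2 / (s ^+ 2 + a ^+ 2)))%:E * (\1_D s)%:E)%E.
  rewrite /g indicE /=; have [|_] := boolP (s \in D); last first.
    by rewrite mule0 integral0_eq// => u _; rewrite mule0.
  rewrite inE /D/= in_itv/= andbT => s0; rewrite mule1.
  under eq_integral do rewrite mule1 /f/=.
  have expc : continuous (fun v : R => expR (- (v * s))).
    rewrite (_ : (fun v => _) = fun v => expR (- (s * v))); first exact: continuous_exp_scaled.
    by apply/funext => v; rewrite mulrC.
  rewrite ge0_symfun_integralT; last 3 first.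
  - by move=> u; rewrite !mulr_ge0 ?expR_ge0 ?(ltW s0)// subr_ge0 cos_le1.
  - move=> u; apply: cvgM; last first.
      by apply: cvgB; [exact: cvg_cst|exact: continuous_cos_scaled].
    apply: cvgM; first exact: cvg_cst.
    apply: (continuous_comp (f := fun u : R => `|u|) (g := fun v => expR (- (v * s)))).
      exact: norm_continuous.
    exact: expc.
  - by move=> u /=; rewrite normrN mulrN cosN.
  rewrite -set_itvcy -integral_itv_obnd_cbnd; last first.
    apply: measurable_funTS; exact: measurableT_comp mf (measurable_pair2 s).
  rewrite EFinM; congr (_ * _)%E.
  transitivity (\int[mu]_(u in `]0%R, +oo[) (s%:E * ((1 - cos (a * u)) * expR (- (s * u)))%:E))%E.
    apply: eq_integral => u; rewrite inE/= in_itv/= andbT => u0.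
    by rewrite gtr0_norm// -EFinM [u * s]mulrC -mulrA [expR _ * _]mulrC.
  rewrite ge0_integralZl//; first last.
  - by rewrite lee_fin ltW.
  - apply/measurable_EFinP; apply: measurable_funTS; apply: measurable_funM.
      apply: measurable_funB => //.
      by apply: continuous_measurable_fun; exact: continuous_cos_scaled.
    by apply: continuous_measurable_fun; exact: continuous_exp_scaled.
  rewrite integral_laplace_cos// -EFinM; congr (_%:E); field.
  by rewrite !lt0r_neq0// ltr_wpDl ?exprn_gt0 ?sqr_ge0.
under eq_integral do rewrite inner_u.
rewrite (onD (fun s => 2 * (a ^+ 2 / (s ^+ 2 + a ^+ 2)))).
under eq_integral do rewrite EFinM.
rewrite ge0_integralZl//; first last.
- by move=> s _; rewrite lee_fin divr_ge0 ?sqr_ge0// addr_ge0 ?sqr_ge0.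
- apply/measurable_EFinP; apply: measurable_funTS; apply: continuous_measurable_fun => s.
  apply: cvgM; first exact: cvg_cst.
  apply: cvgV; first by rewrite lt0r_neq0// ltr_wpDl ?exprn_gt0 ?sqr_ge0.
  by apply: cvgD; [exact: exprn_continuous|exact: cvg_cst].
by rewrite integral_cauchy_scaled// -EFinM; congr (_%:E); field.
Qed.

End dirichlet.

(** * The Fejer kernel and its transform in one variable *)

Section sinc_tent.
Context (R : realType).
Local Notation mu := (@lebesgue_measure R).
Implicit Types (D z u x : R).

(** A point is a null set, so identities involving a division by u^2 are needed only away from the
    removable singularity. *)
Lemma Rintegral_change_at0 (f g : R -> R) : measurable_fun setT f -> intble mu g ->
  (forall u, u != 0 -> f u = g u) ->
  intble mu f /\ \int[mu]_u f u = \int[mu]_u g u.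
Proof.
move=> mf gi fg; have mg := intble_meas gi.
have h (h1 h2 : R -> \bar R) : measurable_fun setT h1 -> measurable_fun setT h2 ->
    (forall u, u != 0 -> h1 u = h2 u) -> (\int[mu]_u h1 u = \int[mu]_u h2 u)%E.
  move=> m1 m2 h12; have m0 : measurable ([set: R] `\ 0) by exact: measurableD.
  rewrite -(@integral_setD1 _ h1 0 setT)//; last exact: measurable_funTS.
  rewrite -(@integral_setD1 _ h2 0 setT)//; last exact: measurable_funTS.
  by apply: eq_integral => u; rewrite inE => -[_ /eqP u0]; exact: h12.
split; last first.
  congr fine; apply: h => [||u u0]; [exact/measurable_EFinP|exact/measurable_EFinP|].
  by rewrite fg.
apply/integrableP; split; first exact/measurable_EFinP.
rewrite (h _ (fun u => `|(g u)%:E|%E)).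
- by case/integrableP: gi.
- by apply: measurableT_comp => //; exact/measurable_EFinP.
- by apply: measurableT_comp => //; exact/measurable_EFinP.
- by move=> u u0 /=; rewrite fg.
Qed.

Lemma Rintegral_odd (f : R -> R) : measurable_fun setT f -> intble mu f ->
  (forall u, f (- u) = - f u) -> \int[mu]_u f u = 0.
Proof.
move=> mf fi fodd.
have fi' : intble mu (f \o -%R).
  rewrite (_ : f \o -%R = fun u => -1 * f u); first exact: intbleZl.
  by apply/funext => u /=; rewrite fodd mulN1r.
have muN A : measurable A -> mu A = mu (-%R @^-1` A).
  by move=> mA; rewrite -[in LHS](lebesgue_measureN mA).
have mN : measurable_fun [set: R] (-%R : R -> R) by exact: oppr_measurable.
have := @Rintegral_image _ _ _ _ _ mu mu -%R mN muN f mf fi'.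
under [in X in _ = X -> _]eq_Rintegral do rewrite fodd -mulN1r.
by rewrite RintegralZl// mulN1r => /eqP; rewrite -addr_eq0 -mulr2n mulrn_eq0/= => /eqP.
Qed.

Definition cosker (a u : R) : R := (1 - cos (a * u)) / u ^+ 2.

Lemma measurable_cos_scaled (a : R) : measurable_fun setT (fun u : R => cos (a * u)).
Proof. by apply: continuous_measurable_fun; exact: continuous_cos_scaled. Qed.

Lemma measurable_sin_scaled (a : R) : measurable_fun setT (fun u : R => sin (a * u)).
Proof.
apply: continuous_measurable_fun => x.
exact: der_continuous (der_scaled (is_derive_sin (a * x))).
Qed.

Lemma measurable_sqr_inv : measurable_fun setT (fun u : R => (u ^+ 2)^-1).
Proof.
under eq_fun do rewrite -powR_inv1 ?sqr_ge0//.
apply: (@measurableT_comp _ _ _ _ _ _ (@powR R ^~ (-1))); first exact: measurable_powR.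
exact: exprn_measurable.
Qed.

Lemma measurable_cosker a : measurable_fun setT (cosker a).
Proof.
apply: measurable_funM; last exact: measurable_sqr_inv.
by apply: measurable_funB => //; exact: measurable_cos_scaled.
Qed.

Lemma cosker_ge0 a u : 0 <= cosker a u.
Proof. by rewrite divr_ge0 ?sqr_ge0// subr_ge0 cos_le1. Qed.

Lemma intble_cosker a : intble mu (cosker a).
Proof.
apply/integrableP; split; first by apply/measurable_EFinP; exact: measurable_cosker.
suff -> : (\int[mu]_u `|(EFin \o cosker a) u| = (pi * `|a|)%:E)%E by rewrite ltry.
rewrite -integral_one_minus_cos; apply: eq_integral => u _.
by rewrite /= ger0_norm ?cosker_ge0.
Qed.

Lemma Rintegral_cosker a : \int[mu]_u cosker a u = pi * `|a|.
Proof. by rewrite /Rintegral integral_one_minus_cos. Qed.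

(* The Fejer pair: tent D z is (D - |z|)^+ / D^2, and sinc2 D is its Fourier transform. *)
Definition sinc2 D u : R :=
  if u == 0 then 1 else (1 - cos (2 * pi * D * u)) / (2 * pi ^+ 2 * D ^+ 2 * u ^+ 2).

Definition tent D z : R := (`|D + z| + `|D - z| - 2 * `|z|) / (2 * D ^+ 2).

Lemma one_minus_cos x : 1 - cos (2 * x) = 2 * sin x ^+ 2.
Proof.
have -> : 2 * x = x *+ 2 by rewrite mulr_natl.
by rewrite cos_mulr2n cos2sin2 -mulr_natl; ring.
Qed.

Lemma sinc2_sin D u : 0 < D -> u != 0 -> sinc2 D u = (sin (pi * D * u) / (pi * D * u)) ^+ 2.
Proof.
move=> D0 u0; rewrite /sinc2 (negbTE u0).
have -> : 2 * pi * D * u = 2 * (pi * D * u) by ring.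
rewrite one_minus_cos; move: (pi_gt0 R); move: (@pi R) => p p0; field.
by rewrite u0 !lt0r_neq0.
Qed.

Lemma sinc2_01 D u : 0 < D -> 0 <= sinc2 D u <= 1.
Proof.
move=> D0; have [->|u0] := eqVneq u 0; first by rewrite /sinc2 eqxx ler01 lexx.
rewrite sinc2_sin// sqr_ge0/= -real_normK ?num_real// exprn_ile1//.
rewrite normrM normfV ler_pdivrMr ?mul1r ?sin_le_norm// normr_gt0.
by rewrite !mulf_neq0// lt0r_neq0 ?pi_gt0.
Qed.

Lemma measurable_sinc2 D : measurable_fun setT (sinc2 D).
Proof.
rewrite (_ : sinc2 D = fun u => \1_[set 0] u + (1 - cos (2 * pi * D * u)) *
   ((2 * pi ^+ 2 * D ^+ 2)^-1 * (u ^+ 2)^-1)).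
  apply: measurable_funD; first exact: measurable_indic.
  apply: measurable_funM; first by apply: measurable_funB => //; exact: measurable_cos_scaled.
  by apply: measurable_funM => //; exact: measurable_sqr_inv.
apply/funext => u; rewrite /sinc2 indicE; have [->|u0] := eqVneq u 0.
  by rewrite mem_set// mulr0 cos0 subrr mul0r addr0.
by rewrite memNset ?add0r ?invfM// => /eqP; rewrite (negbTE u0).
Qed.

(** (1 - cos a) cos b = (1 - cos(a + b))/2 + (1 - cos(a - b))/2 - (1 - cos b), and each term over
    u^2 integrates to pi times an absolute value: the tent appears as a second difference of |z|. *)
Lemma Rintegral_sinc2_cos D z : 0 < D ->
  intble mu (fun u => sinc2 D u * cos (2 * pi * z * u)) /\
  \int[mu]_u (sinc2 D u * cos (2 * pi * z * u)) = tent D z.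
Proof.
move=> D0; have pi0 := pi_gt0 R.
pose c := (4 * pi ^+ 2 * D ^+ 2)^-1.
pose g u := c * (cosker (2 * pi * (D + z)) u + cosker (2 * pi * (D - z)) u
   - 2 * cosker (2 * pi * z) u).
have i1 : intble mu (fun u => cosker (2 * pi * (D + z)) u + cosker (2 * pi * (D - z)) u).
  by apply: intbleD; exact: intble_cosker.
have i2 : intble mu (fun u => 2 * cosker (2 * pi * z) u).
  by apply: intbleZl; exact: intble_cosker.
have gi : intble mu g by apply/intbleZl/intbleB.
have [||hi ->] := @Rintegral_change_at0 (fun u => sinc2 D u * cos (2 * pi * z * u)) g _ gi.
- by apply: measurable_funM; [exact: measurable_sinc2|exact: measurable_cos_scaled].
- move=> u u0; rewrite /sinc2 (negbTE u0) /g /cosker /c.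
  have -> : 2 * pi * (D + z) * u = 2 * pi * D * u + 2 * pi * z * u by ring.
  have -> : 2 * pi * (D - z) * u = 2 * pi * D * u - 2 * pi * z * u by ring.
  rewrite cosD cosB; move: (cos _) (cos _) (sin _) (sin _) => ? ? ? ?.
  by move: (@pi R) pi0 => p p0; field; rewrite u0 !lt0r_neq0.
split=> //.
rewrite /g RintegralZl//; last exact: intbleB.
rewrite RintegralB// RintegralD//; [|exact: intble_cosker|exact: intble_cosker].
rewrite RintegralZl//; last exact: intble_cosker.
rewrite !Rintegral_cosker !normrM (gtr0_norm pi0) [`|2|]gtr0_norm// /c /tent.
by move: (@pi R) pi0 => p p0; field; rewrite !lt0r_neq0.
Qed.

Lemma intble_sinc2 D : 0 < D -> intble mu (sinc2 D).
Proof.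
move=> D0; have [+ _] := Rintegral_sinc2_cos 0 D0.
congr (mu.-integrable _ _); apply/funext => u /=.
by rewrite mulr0 mul0r cos0 mulr1.
Qed.

Lemma Rintegral_sinc2_sin D z : 0 < D ->
  \int[mu]_u (sinc2 D u * sin (2 * pi * z * u)) = 0.
Proof.
move=> D0.
have m : measurable_fun setT (fun u => sinc2 D u * sin (2 * pi * z * u)).
  by apply: measurable_funM; [exact: measurable_sinc2|exact: measurable_sin_scaled].
apply: Rintegral_odd => //.
  apply: (intbleM_bounded (intble_sinc2 D0) (measurable_sin_scaled _) (M := 1)) => u.
  exact: sin_max.
by move=> u; rewrite mulrN sinN mulrN /sinc2 oppr_eq0 mulrN cosN sqrrN.
Qed.

Lemma tent_ge0 D z : 0 < D -> 0 <= tent D z.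
Proof.
move=> D0; rewrite divr_ge0//; last by rewrite mulr_ge0// sqr_ge0.
rewrite subr_ge0; have -> : 2 * `|z| = `|(D + z) - (D - z)|.
  have -> : D + z - (D - z) = 2 * z by ring.
  by rewrite normrM gtr0_norm.
exact: ler_normB.
Qed.

Lemma tent_le_inv D z : 0 < D -> tent D z <= D^-1.
Proof.
move=> D0; have -> : D^-1 = 2 * D / (2 * D ^+ 2) by field; exact: lt0r_neq0.
apply: ler_wpM2r; first by rewrite invr_ge0 mulr_ge0// sqr_ge0.
have := ler_normD D z; have := ler_normB D z; rewrite (gtr0_norm D0); lra.
Qed.

Lemma tent_out D z : 0 < D -> D <= `|z| -> tent D z = 0.
Proof.
move=> D0; rewrite /tent; case: (ger0P z) => z0 Dz.
  by rewrite ger0_norm ?ler0_norm; [|lra|lra]; apply/eqP; rewrite mulf_eq0; apply/orP; left; apply/eqP; ring.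
by rewrite ler0_norm ?ger0_norm; [|lra|lra]; apply/eqP; rewrite mulf_eq0; apply/orP; left; apply/eqP; ring.
Qed.

Lemma continuous_tent D x : continuous (fun y : R => tent D (x - y)).
Proof.
move=> y; apply: cvgM; last exact: cvg_cst.
have cx : (fun y : R => x - y) y' @[y' --> y] --> x - y by apply: cvgB; [exact: cvg_cst|exact: cvg_id].
apply: cvgB.
  by apply: cvgD; apply: cvg_norm; [apply: cvgD|apply: cvgB] => //; exact: cvg_cst.
by apply: cvgM; [exact: cvg_cst|exact: cvg_norm].
Qed.

Lemma measurable_tent D x : measurable_fun setT (fun y : R => tent D (x - y)).
Proof. by apply: continuous_measurable_fun; exact: continuous_tent. Qed.

Lemma integral_tent D x : 0 < D -> (\int[mu]_y (tent D (x - y))%:E = 1)%E.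
Proof.
move=> D0.
have seg (a b s : R) : a < b -> (\int[mu]_(y in `[a, b]) ((D + s * (x - y)) / D ^+ 2)%:E =
    ((D * b + s * (x * b - b ^+ 2 / 2)) / D ^+ 2 -
     (D * a + s * (x * a - a ^+ 2 / 2)) / D ^+ 2)%:E)%E.
  move=> ab; pose F (y : R) := (D * y + s * (x * y - y ^+ 2 / 2)) / D ^+ 2.
  have cf : continuous (fun y : R => (D + s * (x - y)) / D ^+ 2).
    move=> y; apply: cvgM; last exact: cvg_cst.
    apply: cvgD; first exact: cvg_cst.
    apply: cvgM; first exact: cvg_cst.
    by apply: cvgB; [exact: cvg_cst|exact: cvg_id].
  have dF (y : R) : is_derive y 1 F ((D + s * (x - y)) / D ^+ 2).
    have d1 := der_id y.
    have := derZ (D ^+ 2)^-1 (derD (derZ D d1) (derZ s (derD (derZ x d1) (derZ (- 2^-1) (derM d1 d1))))).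
    rewrite (_ : (fun y => _) = F) => [h|]; last first.
      by apply/funext => v; rewrite /F; field; rewrite lt0r_neq0.
    by apply: (is_derive_eq h); field; rewrite lt0r_neq0.
  exact: integral_segment ab cf dF.
have tE : (fun y : R => (tent D (x - y))%:E) =
    ((fun y : R => (tent D (x - y))%:E) \_ `[x - D, x + D]).
  apply/funext => y; rewrite patchE; case: ifPn => //.
  rewrite notin_setE/= in_itv/= => /negP; rewrite negb_and -!ltNge => h.
  rewrite tent_out//; case/orP: h => h; first by rewrite ger0_norm; lra.
  by rewrite ler0_norm; lra.
rewrite tE -integral_mkcond.
rewrite (@itv_bndbnd_setU _ _ _ (BRight x)) ?bnd_simp; [|lra|lra].
have mt A : measurable_fun A (fun y : R => (tent D (x - y))%:E).
  by apply/measurable_EFinP; apply: measurable_funTS; exact: measurable_tent.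
rewrite ge0_integral_setU//=; first last.
- apply/disj_setPS => y [/=]; rewrite !in_itv/= => /andP[_ h1] /andP[h2 _].
  by move: h1; rewrite leNgt h2.
- by move=> y _; rewrite lee_fin tent_ge0.
- exact: mt.
rewrite integral_itv_obnd_cbnd//.
have e1 : (\int[mu]_(y in `[(x - D)%R, x]) (tent D (x - y))%:E =
    \int[mu]_(y in `[(x - D)%R, x]) ((D + -1 * (x - y)) / D ^+ 2)%:E)%E.
  apply: eq_integral => y; rewrite inE/= in_itv/= => /andP[h1 h2]; congr (_%:E).
  rewrite /tent !ger0_norm; [|lra|lra|lra]; field; exact: lt0r_neq0.
have e2 : (\int[mu]_(y in `[x, (x + D)%R]) (tent D (x - y))%:E =
    \int[mu]_(y in `[x, (x + D)%R]) ((D + 1 * (x - y)) / D ^+ 2)%:E)%E.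
  apply: eq_integral => y; rewrite inE/= in_itv/= => /andP[h1 h2]; congr (_%:E).
  rewrite /tent ger0_norm; last by lra.
  rewrite ger0_norm; last by lra.
  rewrite ler0_norm; last by lra.
  by field; exact: lt0r_neq0.
rewrite e1 e2.
rewrite !seg; [|lra|lra]; rewrite -EFinD; congr (_%:E); field; exact: lt0r_neq0.
Qed.

Lemma intble_tent D x : 0 < D -> intble mu (fun y : R => tent D (x - y)).
Proof.
move=> D0; apply/integrableP; split; first by apply/measurable_EFinP; exact: measurable_tent.
suff -> : (\int[mu]_y `|(EFin \o (fun y : R => tent D (x - y))) y| = 1)%E by rewrite ltry.
rewrite -[RHS](integral_tent x D0); apply: eq_integral => y _.
by rewrite /= ger0_norm ?tent_ge0.
Qed.

Lemma Rintegral_tent D x : 0 < D -> \int[mu]_y tent D (x - y) = 1.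
Proof. by move=> D0; rewrite /Rintegral integral_tent. Qed.

Lemma cvg_sin_ratio (h : nat -> R) : (forall n, h n != 0) -> h n @[n --> \oo] --> (0 : R) ->
  sin (h n) / h n @[n --> \oo] --> (1 : R).
Proof.
move=> h0 hc; have [hd hv] := is_derive_sin (0 : R).
have cv : (fun t : R => t^-1 *: ((sin \o shift 0) (t *: 1) - sin 0)) t @[t --> 0^'] --> (1 : R).
  have E : 'D_1 sin (0 : R) = 1 by rewrite hv cos0.
  by rewrite -[X in _ --> X]E; exact: hd.
apply/cvgrPdist_le => e e0.
have /cvgrPdist_le/(_ _ e0) := cv; rewrite near_withinE => nr.
near=> n.
have : h n != 0 -> `|1 - (h n)^-1 *: ((sin \o shift 0) (h n *: 1) - sin 0)| <= e.
  by near: n; exact: (hc _ nr).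
move=> /(_ (h0 n)) /=.
rewrite addr0 sin0 subr0 /GRing.scale/= mulr1.
by rewrite [_^-1 * _]mulrC.
Unshelve. all: by end_near. Qed.

Lemma cvg_sinc2 u : sinc2 n.+1%:R^-1 u @[n --> \oo] --> (1 : R).
Proof.
have [->|u0] := eqVneq u 0.
  by rewrite /sinc2 eqxx; exact: cvg_cst.
under eq_fun do rewrite sinc2_sin//.
have c1 := @cvg_sin_ratio (fun n => pi * n.+1%:R^-1 * u) _ _.
have {}c1 : sin (pi * n.+1%:R^-1 * u) / (pi * n.+1%:R^-1 * u) @[n --> \oo] --> (1 : R).
  apply: c1 => [n|]; first by rewrite !mulf_neq0// ?invr_eq0 ?pnatr_eq0// lt0r_neq0// pi_gt0.
  rewrite -(mul0r u); apply: cvgM; last exact: cvg_cst.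
  rewrite -(mulr0 pi); apply: cvgM; first exact: cvg_cst.
  exact: cvg_harmonic.
under eq_fun do rewrite expr2.
by have := cvgM c1 c1; rewrite mulr1; apply.
Qed.

End sinc_tent.

Lemma cvg_prod_seq (R : realType) (I : Type) (s : seq I) (F : I -> nat -> R) (l : I -> R) :
  (forall i, F i n @[n --> \oo] --> l i) ->
  \prod_(i <- s) F i n @[n --> \oo] --> \prod_(i <- s) l i.
Proof.
move=> Fl; elim: s => [|i s ih].
  by under eq_fun do rewrite big_nil; rewrite big_nil; exact: cvg_cst.
by under eq_fun do rewrite big_cons; rewrite big_cons; exact: cvgM.
Qed.

(** * Integration over product measures on tuples *)

Section power_measure_integrals.
Context d (T : measurableType d) (R : realType).
Variable mu : {sigma_finite_measure set T -> \bar R}.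

Lemma tnth_tcons0 n (x : T) (t : n.-tuple T) : tnth (tcons (x, t)) ord0 = x.
Proof. by []. Qed.

Lemma tnth_tcons_lift n (x : T) (t : n.-tuple T) i :
  tnth (tcons (x, t)) (lift ord0 i) = tnth t i.
Proof. by rewrite tnthS; congr tnth; apply: val_inj. Qed.

(** Fubini along the decomposition of a tuple into head and tail, with integrability supplied by the
    product majorant. *)
Lemma power_measureS n (f : n.+1.-tuple T -> R) (a : T -> R) (b : n.-tuple T -> R) :
  measurable_fun setT f -> intble mu a -> intble (power_measure mu n) b ->
  (forall x t, `|f (tcons (x, t))| <= a x * b t) ->
  intble (power_measure mu n.+1) f /\
  \int[power_measure mu n.+1]_u f u =
    \int[mu]_x \int[power_measure mu n]_t f (tcons (x, t)).
Proof.
move=> mf ai bi fab.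
have mz : measurable_fun setT (fun z : T * n.-tuple T => f (tcons (z.1, z.2))).
  have -> : (fun z : T * n.-tuple T => f (tcons (z.1, z.2))) = f \o @tcons T n.
    by apply/funext => -[].
  exact: measurableT_comp mf (@measurable_tcons _ T n).
have iz := intble_dominated mz ai bi fab.
have iz' : intble (mu \x power_measure mu n)%E (f \o @tcons T n).
  by move: iz; congr (_.-integrable _ _); apply/funext => -[].
have E A : measurable A -> power_measure mu n.+1 A =
    (mu \x power_measure mu n)%E (@tcons T n @^-1` A) by [].
split; first exact: (@intble_image _ _ _ _ _ _ _ _ (@measurable_tcons _ T n) E).
rewrite (@Rintegral_image _ _ _ _ _ _ _ _ (@measurable_tcons _ T n) E _ mf iz').
rewrite -(Rfubini_prod mz ai bi fab).
by apply: eq_Rintegral => -[].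
Qed.

Lemma measurable_prod_tnth n (w : 'I_n -> T -> R) :
  (forall i, measurable_fun setT (w i)) ->
  measurable_fun setT (fun u : n.-tuple T => \prod_(i < n) w i (tnth u i)).
Proof.
move=> mw; apply: measurable_prod => i _; apply: measurableT_comp => //.
exact: measurable_tnth.
Qed.

Lemma Rintegral_power0 (f : 0.-tuple T -> R) : measurable_fun setT f ->
  intble (power_measure mu 0) f /\ \int[power_measure mu 0]_u f u = f [tuple].
Proof.
move=> mf; split; last by rewrite /Rintegral integral_dirac ?diracT ?mul1e//; exact/measurable_EFinP.
apply: (@intble_finite _ _ R (\d_ ([tuple] : 0.-tuple T)) f `|f [tuple]|) => // u.
by rewrite (tuple0 u).
Qed.

Lemma Rintegral_power_prod n (w : 'I_n -> T -> R) : (forall i, intble mu (w i)) ->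
  intble (power_measure mu n) (fun u => \prod_(i < n) w i (tnth u i)) /\
  \int[power_measure mu n]_u (\prod_(i < n) w i (tnth u i)) = \prod_(i < n) \int[mu]_x w i x.
Proof.
elim: n w => [|n ih] w iw.
  have [|i E] := @Rintegral_power0 (fun u => \prod_(i < 0) w i (tnth u i)).
    by apply: measurable_prod_tnth => -[].
  by rewrite E !big_ord0.
have [ih1 ih2] := ih (fun i => w (lift ord0 i)) (fun i => iw _).
have E x (t : n.-tuple T) : \prod_(i < n.+1) w i (tnth (tcons (x, t)) i) =
    w ord0 x * \prod_(i < n) w (lift ord0 i) (tnth t i).
  rewrite big_ord_recl tnth_tcons0; congr (_ * _).
  by apply: eq_bigr => i _; rewrite tnth_tcons_lift.
have [||i ->] := @power_measureS n (fun u => \prod_(i < n.+1) w i (tnth u i))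
   (fun x => `|w ord0 x|) (fun t => `|\prod_(i < n) w (lift ord0 i) (tnth t i)|)
   _ (intble_norm (iw ord0)) (intble_norm ih1).
- by apply: measurable_prod_tnth => i; exact: intble_meas (iw i).
- by move=> x t; rewrite E normrM.
split=> //.
rewrite big_ord_recl -ih2 -RintegralZr//; apply: eq_Rintegral => x _.
by under eq_Rintegral do rewrite E; rewrite RintegralZl.
Qed.

Lemma measurable_sum_tnth n (w : 'I_n -> T -> R) :
  (forall i, measurable_fun setT (w i)) ->
  measurable_fun setT (fun u : n.-tuple T => \sum_(i < n) w i (tnth u i)).
Proof.
move=> mw; apply: measurable_sum => i; apply: measurableT_comp => //.
exact: measurable_tnth.
Qed.

Lemma measurable_cos : measurable_fun setT (@cos R).
Proof. by apply: continuous_measurable_fun; exact: continuous_cos. Qed.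

Lemma measurable_sin : measurable_fun setT (@sin R).
Proof. by apply: continuous_measurable_fun; exact: continuous_sin. Qed.

(** The free phase [al] carries the induction: cos(al + th) expands by the addition formula and the
    sine integrals vanish. The lemma serves twice, for the d coordinates of a row and for the m
    rows. *)
Lemma Rintegral_power_cos n (w th : 'I_n -> T -> R) (al : R) :
  (forall i, intble mu (w i)) -> (forall i, measurable_fun setT (th i)) ->
  (forall i, \int[mu]_x (w i x * sin (th i x)) = 0) ->
  \int[power_measure mu n]_u (\prod_(i < n) w i (tnth u i) *
      cos (al + \sum_(i < n) th i (tnth u i))) =
  cos al * \prod_(i < n) \int[mu]_x (w i x * cos (th i x)).
Proof.
move=> iw mth sin0.
have mf k (v e : 'I_k -> T -> R) be : (forall i, measurable_fun setT (v i)) ->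
  (forall i, measurable_fun setT (e i)) ->
  measurable_fun setT (fun u : k.-tuple T => \prod_(i < k) v i (tnth u i) *
      cos (be + \sum_(i < k) e i (tnth u i))).
  move=> mv me; apply: measurable_funM; first exact: measurable_prod_tnth.
  apply: measurableT_comp; first exact: measurable_cos.
  by apply: measurable_funD => //; exact: measurable_sum_tnth.
elim: n w th al iw mth sin0 => [|n ih] w th al iw mth sin0.
  have [|_ ->] := @Rintegral_power0 (fun u => \prod_(i < 0) w i (tnth u i) *
      cos (al + \sum_(i < 0) th i (tnth u i))).
    by apply: mf => -[].
  by rewrite !big_ord0 addr0 mul1r mulr1.
have mw i : measurable_fun setT (w i) := intble_meas (iw i).
have [ip _] := Rintegral_power_prod (fun i => iw (lift ord0 i)).
have E x (t : n.-tuple T) : \prod_(i < n.+1) w i (tnth (tcons (x, t)) i) *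
    cos (al + \sum_(i < n.+1) th i (tnth (tcons (x, t)) i)) =
    w ord0 x * (\prod_(i < n) w (lift ord0 i) (tnth t i) *
    cos (al + th ord0 x + \sum_(i < n) th (lift ord0 i) (tnth t i))).
  rewrite !big_ord_recl !tnth_tcons0 -!mulrA addrA.
  under eq_bigr do rewrite tnth_tcons_lift.
  by under [in cos _]eq_bigr do rewrite tnth_tcons_lift.
have [||_ ->] := @power_measureS n (fun u => \prod_(i < n.+1) w i (tnth u i) *
      cos (al + \sum_(i < n.+1) th i (tnth u i)))
   (fun x => `|w ord0 x|) (fun t => `|\prod_(i < n) w (lift ord0 i) (tnth t i)|)
   _ (intble_norm (iw ord0)) (intble_norm ip).
- exact: mf.
- by move=> x t; rewrite E !normrM ler_wpM2l// ler_piMr// cos_max.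
pose Pr := \prod_(i < n) \int[mu]_x (w (lift ord0 i) x * cos (th (lift ord0 i) x)).
have inner x : \int[power_measure mu n]_t (\prod_(i < n.+1) w i (tnth (tcons (x, t)) i) *
    cos (al + \sum_(i < n.+1) th i (tnth (tcons (x, t)) i))) =
    Pr * (cos al * (w ord0 x * cos (th ord0 x)) - sin al * (w ord0 x * sin (th ord0 x))).
  under eq_Rintegral do rewrite E.
  rewrite RintegralZl//; last first.
    apply: (intble_le _ _ (intble_norm ip)).
      exact: (@mf n (fun i => w (lift ord0 i)) (fun i => th (lift ord0 i))).
    by move=> t; rewrite normrM ler_piMr// cos_max.
  by rewrite (ih (fun i => w (lift ord0 i)) (fun i => th (lift ord0 i)))// cosD -/Pr; ring.
under eq_Rintegral do rewrite inner.
have ic : intble mu (fun x => w ord0 x * cos (th ord0 x)).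
  apply: (intbleM_bounded (iw ord0) (M := 1)); last by move=> x; exact: cos_max.
  by apply: measurableT_comp => //; exact: measurable_cos.
have is' : intble mu (fun x => w ord0 x * sin (th ord0 x)).
  apply: (intbleM_bounded (iw ord0) (M := 1)); last by move=> x; exact: sin_max.
  by apply: measurableT_comp => //; exact: measurable_sin.
rewrite RintegralZl//; last by apply: intbleB; exact: intbleZl.
rewrite RintegralB//; try exact: intbleZl.
rewrite RintegralZl// RintegralZl// sin0 mulr0 subr0 big_ord_recl -/Pr.
by rewrite mulrC -mulrA.
Qed.

End power_measure_integrals.

(** * Fourier inversion in several variables *)

Section inversion.
Context (R : realType) (m d : nat).
Local Notation V := (m.-tuple (Rvec R d)).
Local Notation lam := (lebesgue_tuple R m d).
Local Notation leb := (@lebesgue_measure R).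
Local Notation c x i j := (tnth (tnth x i) j).

Definition sinc2_prod (D : R) (u : V) : R := \prod_(i < m) \prod_(j < d) sinc2 D (c u i j).
Definition tent_prod (D : R) (x y : V) : R :=
  \prod_(i < m) \prod_(j < d) tent D (c x i j - c y i j).

Let row_sinc2 (D : R) (v : Rvec R d) : R := \prod_(j < d) sinc2 D (tnth v j).

Let intble_row (D : R) : 0 < D -> intble (power_measure leb d) (row_sinc2 D).
Proof.
move=> D0; have [] := @Rintegral_power_prod _ _ R leb d (fun=> sinc2 D) => //.
by move=> _; exact: intble_sinc2.
Qed.

Lemma intble_sinc2_prod D : 0 < D -> intble lam (sinc2_prod D).
Proof.
move=> D0; have [] := @Rintegral_power_prod _ _ R (power_measure leb d) m (fun=> row_sinc2 D) => //.
by move=> _; exact: intble_row.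
Qed.

Lemma Rintegral_sinc2_prod D (z : 'I_m -> 'I_d -> R) : 0 < D ->
  \int[lam]_u (sinc2_prod D u * cos (\sum_(i < m) \sum_(j < d) 2 * pi * z i j * c u i j)) =
  \prod_(i < m) \prod_(j < d) tent D (z i j).
Proof.
move=> D0.
pose th i (v : Rvec R d) := \sum_(j < d) 2 * pi * z i j * tnth v j.
have mth i : measurable_fun setT (th i).
  apply: (@measurable_sum_tnth _ _ _ d (fun j v => 2 * pi * z i j * v)) => j.
  by apply: measurable_funM.
have row i al : \int[power_measure leb d]_v (row_sinc2 D v * cos (al + th i v)) =
    cos al * \prod_(j < d) tent D (z i j).
  rewrite (@Rintegral_power_cos _ _ R leb d (fun=> sinc2 D) (fun j v => 2 * pi * z i j * v) al).
  - by congr (_ * _); apply: eq_bigr => j _; case: (Rintegral_sinc2_cos (z i j) D0).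
  - by move=> _; exact: intble_sinc2.
  - by move=> j; apply: measurable_funM.
  - by move=> j; exact: Rintegral_sinc2_sin.
have := @Rintegral_power_cos _ _ R (power_measure leb d) m (fun=> row_sinc2 D) th 0
  (fun _ => intble_row D0) mth.
rewrite cos0 mul1r => h.
transitivity (\int[lam]_u (\prod_(i < m) row_sinc2 D (tnth u i) *
   cos (0 + \sum_(i < m) th i (tnth u i)))).
  by apply: eq_Rintegral => u _; rewrite add0r.
rewrite h; last first.
  (* A sine is a cosine with phase shifted by -pi/2, for which the row formula carries the factor
     cos(pi/2) = 0. *)
  move=> i; have := row i (- (pi / 2)); rewrite cosN cos_pihalf mul0r => <-.
  by apply: eq_Rintegral => v _; rewrite addrC cosBpihalf.
apply: eq_bigr => i _; have := row i 0; rewrite cos0 mul1r => <-.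
by apply: eq_Rintegral => v _; rewrite add0r.
Qed.

Lemma tent_prod_mass D x : 0 < D ->
  intble lam (tent_prod D x) /\ \int[lam]_y tent_prod D x y = 1.
Proof.
move=> D0.
have row i : intble (power_measure leb d) (fun v => \prod_(j < d) tent D (c x i j - tnth v j)) /\
    \int[power_measure leb d]_v (\prod_(j < d) tent D (c x i j - tnth v j)) = 1.
  have [|h1 h2] := @Rintegral_power_prod _ _ R leb d (fun j v => tent D (c x i j - v)).
    by move=> j; exact: intble_tent.
  by split=> //; rewrite h2 big1// => j _; exact: Rintegral_tent.
have [|h1 h2] := @Rintegral_power_prod _ _ R (power_measure leb d) m
   (fun i v => \prod_(j < d) tent D (c x i j - tnth v j)).
  by move=> i; case: (row i).
by split=> //; rewrite h2 big1// => i _; case: (row i).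
Qed.

Lemma measurable_coord i j : measurable_fun setT (fun u : V => c u i j).
Proof.
apply: (@measurableT_comp _ _ _ _ _ _ (fun v : Rvec R d => tnth v j)); exact: measurable_tnth.
Qed.

Lemma measurable_dotv : measurable_fun setT (fun z : V * V => dotv z.1 z.2).
Proof.
apply: measurable_sum => i; apply: measurable_sum => j; apply: measurable_funM.
  by apply: (measurableT_comp (measurable_coord i j)); exact: measurable_fst.
by apply: (measurableT_comp (measurable_coord i j)); exact: measurable_snd.
Qed.

Lemma measurable_dotv1 x : measurable_fun setT (fun u : V => dotv u x).
Proof.
apply: measurable_sum => i; apply: measurable_sum => j; apply: measurable_funM => //.
exact: measurable_coord.
Qed.

Lemma measurable_dotv2 u : measurable_fun setT (fun x : V => dotv u x).
Proof.
apply: measurable_sum => i; apply: measurable_sum => j; apply: measurable_funM => //.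
exact: measurable_coord.
Qed.

Variable f : V -> R.
Hypotheses (fi : intble lam f) (fc : continuous_kernel f).

Definition cos_transform u : R := \int[lam]_y (f y * cos (2 * pi * dotv u y)).
Definition sin_transform u : R := \int[lam]_y (f y * sin (2 * pi * dotv u y)).

Lemma kernel_near (x : V) (e : R) : 0 < e ->
  exists2 D : R, 0 < D & forall y : V,
    (forall i j, `|c x i j - c y i j| < D) -> `|f y - f x| < e.
Proof.
move=> e0; pose mx (x : V) : 'M[R]_(m, d) := \matrix_(i, j) c x i j.
have mxK y : tuple_of_mx (mx y) = y.
  apply: eq_from_tnth => i; rewrite tnth_mktuple; apply: eq_from_tnth => j.
  by rewrite tnth_mktuple mxE.
have /(_ (mx x))/cvgrPdist_lt/(_ _ e0) : continuous (f \o @tuple_of_mx R m d) := fc.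
rewrite -(nbhs_ballE) => -[D /= D0 h]; exists D => // y xy.
have := h (mx y); rewrite /= !mxK distrC; apply.
by split=> // i j; rewrite !mxE /ball/=; exact: xy.
Qed.

(** The tents are nonnegative, of mass 1 and supported in cubes shrinking to x, so continuity at x
    makes them an approximate identity. *)
Lemma tent_prod_cvg x : \int[lam]_y (f y * tent_prod n.+1%:R^-1 x y) @[n --> \oo] --> f x.
Proof.
apply/cvgrPdist_le => e e0; have [D D0 hD] := kernel_near x e0.
near=> n.
have : n.+1%:R^-1 < D by near: n; exact: near_infty_natSinv_lt (PosNum D0).
set D' := n.+1%:R^-1 : R => D'D.
have D'0 : 0 < D' by rewrite invr_gt0.
have [ti t1] := tent_prod_mass x D'0.
have t0 y : 0 <= tent_prod D' x y by rewrite prodr_ge0// => i _; rewrite prodr_ge0// => j _; exact: tent_ge0.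
have tout y : e < `|f y - f x| -> tent_prod D' x y = 0.
  move=> ey; apply: contrapT => /eqP; rewrite /tent_prod.
  move=> /prodf_neq0 h; suff : `|f y - f x| < e by rewrite ltNge (ltW ey).
  apply: hD => i j; apply: lt_trans D'D; rewrite ltNge; apply/negP => Dij.
  have /prodf_neq0/(_ j isT) := h i isT.
  by rewrite (tent_out D'0 Dij) eqxx.
have fti : intble lam (fun y => f y * tent_prod D' x y).
  apply: (intbleM_bounded fi (intble_meas ti) (M := (D'^-1 ^+ d) ^+ m)) => y.
  rewrite ger0_norm// /tent_prod -[m in X in _ <= X]card_ord -prodr_const.
  apply: ler_prod => i _; rewrite prodr_ge0/=; last by move=> j _; exact: tent_ge0.
  rewrite -[d in X in _ <= X]card_ord -prodr_const.
  by apply: ler_prod => j _; rewrite tent_ge0//= tent_le_inv.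
have -> : f x - \int[lam]_y (f y * tent_prod D' x y) =
    \int[lam]_y (f x * tent_prod D' x y - f y * tent_prod D' x y).
  by rewrite RintegralB// ?RintegralZl// ?t1 ?mulr1//; exact: intbleZl.
apply: (le_trans (le_normr_Rintegral measurableT (intbleB (intbleZl _ ti) fti))).
apply: (@le_trans _ _ (\int[lam]_y (e * tent_prod D' x y))).
  apply: Rintegral_le.
  - exact/intble_norm/intbleB/fti/intbleZl.
  - exact: intbleZl.
  - move=> y; rewrite -mulrBl normrM distrC (ger0_norm (t0 y)).
    have [ey|ey] := leP `|f y - f x| e; first exact: ler_wpM2r.
    by rewrite (tout y ey) !mulr0.
by rewrite RintegralZl// t1 mulr1.
Unshelve. all: by end_near. Qed.

Lemma intble_f_cos u : intble lam (fun y => f y * cos (2 * pi * dotv u y)).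
Proof.
apply: (intbleM_bounded fi (M := 1)); last by move=> y; exact: cos_max.
apply: measurableT_comp; first exact: measurable_cos.
by apply: measurable_funM => //; exact: measurable_dotv2.
Qed.

Lemma intble_f_sin u : intble lam (fun y => f y * sin (2 * pi * dotv u y)).
Proof.
apply: (intbleM_bounded fi (M := 1)); last by move=> y; exact: sin_max.
apply: measurableT_comp; first exact: measurable_sin.
by apply: measurable_funM => //; exact: measurable_dotv2.
Qed.

(** The real part of the Fourier transform at u times exp(2 i pi u.x), written with real
    integrals. *)
Definition inverse_kernel x u : R :=
  cos_transform u * cos (2 * pi * dotv u x) + sin_transform u * sin (2 * pi * dotv u x).

Lemma inverse_kernelE x u : inverse_kernel x u =
  \int[lam]_y (f y * cos (2 * pi * dotv u x - 2 * pi * dotv u y)).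
Proof.
rewrite /inverse_kernel /cos_transform /sin_transform.
rewrite -RintegralZr//; last exact: intble_f_cos.
rewrite -RintegralZr//; last exact: intble_f_sin.
rewrite -RintegralD//.
- by apply: eq_Rintegral => y _; rewrite cosB; ring.
- have := intbleZl (cos (2 * pi * dotv u x)) (intble_f_cos u).
  by congr (_.-integrable _ _); apply/funext => y /=; rewrite mulrC.
- have := intbleZl (sin (2 * pi * dotv u x)) (intble_f_sin u).
  by congr (_.-integrable _ _); apply/funext => y /=; rewrite mulrC.
Qed.

Lemma sinc2_prod_01 D u : 0 < D -> 0 <= sinc2_prod D u <= 1.
Proof.
move=> D0; have r01 v : 0 <= row_sinc2 D v <= 1.
  rewrite prodr_ge0/=; last by move=> j _; case/andP: (sinc2_01 (tnth v j) D0).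
  by rewrite prodr_ile1// => j _; exact: sinc2_01.
rewrite prodr_ge0/=; last by move=> i _; case/andP: (r01 (tnth u i)).
by rewrite prodr_ile1// => i _; exact: r01.
Qed.

(** The weight [sinc2_prod] is integrable, which makes Fubini legitimate; integrating it first
    against the cosine returns the tents. *)
Lemma regularized_inversion D x : 0 < D ->
  \int[lam]_u (sinc2_prod D u * inverse_kernel x u) = \int[lam]_y (f y * tent_prod D x y).
Proof.
move=> D0; pose F (u y : V) := sinc2_prod D u * (f y * cos (2 * pi * dotv u x - 2 * pi * dotv u y)).
have is2 := intble_sinc2_prod D0.
have ic u : intble lam (fun y => f y * cos (2 * pi * dotv u x - 2 * pi * dotv u y)).
  apply: (intbleM_bounded fi (M := 1)); last by move=> y; exact: cos_max.
  apply: measurableT_comp; first exact: measurable_cos.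
  by apply: measurable_funB => //; apply: measurable_funM => //; exact: measurable_dotv2.
have mF : measurable_fun setT (fun z : V * V => F z.1 z.2).
  apply: measurable_funM.
    by apply: (measurableT_comp (intble_meas is2)); exact: measurable_fst.
  apply: measurable_funM.
    by apply: (measurableT_comp (intble_meas fi)); exact: measurable_snd.
  apply: measurableT_comp; first exact: measurable_cos.
  apply: measurable_funB; apply: measurable_funM => //; last exact: measurable_dotv.
  by apply: (measurableT_comp (measurable_dotv1 x)); exact: measurable_fst.
have Fab u y : `|F u y| <= sinc2_prod D u * `|f y|.
  have /andP[s0 s1] := sinc2_prod_01 u D0.
  by rewrite !normrM (ger0_norm s0) ler_wpM2l// ler_piMr// cos_max.
transitivity (\int[lam]_u \int[lam]_y F u y).
  apply: eq_Rintegral => u _; rewrite inverse_kernelE /F RintegralZl//.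
rewrite (Rfubini mF is2 (intble_norm fi) Fab); apply: eq_Rintegral => y _.
rewrite /tent_prod -(Rintegral_sinc2_prod (fun i j => c x i j - c y i j) D0) -RintegralZl//.
  apply: eq_Rintegral => u _; rewrite /F mulrCA; congr (_ * (_ * cos _)).
  rewrite /dotv -mulrBr -sumrB mulr_sumr; apply: eq_bigr => i _.
  rewrite -sumrB mulr_sumr; apply: eq_bigr => j _; ring.
apply: (intbleM_bounded is2 (M := 1)); last by move=> u; exact: cos_max.
apply: measurableT_comp; first exact: measurable_cos.
apply: measurable_sum => i; apply: measurable_sum => j; apply: measurable_funM => //.
exact: measurable_coord.
Qed.

(** As D tends to 0 in the regularised identity, the weights tend to 1 while dominated by the
    integrable [inverse_kernel], and the tents concentrate at x. *)
Theorem fourier_inversion x : intble lam cos_transform -> intble lam sin_transform ->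
  f x = \int[lam]_u inverse_kernel x u.
Proof.
move=> iC iS.
have mcos : measurable_fun setT (fun u : V => cos (2 * pi * dotv u x)).
  apply: measurableT_comp; first exact: measurable_cos.
  by apply: measurable_funM => //; exact: measurable_dotv1.
have msin : measurable_fun setT (fun u : V => sin (2 * pi * dotv u x)).
  apply: measurableT_comp; first exact: measurable_sin.
  by apply: measurable_funM => //; exact: measurable_dotv1.
have iK : intble lam (inverse_kernel x).
  apply: intbleD.
    by apply: (intbleM_bounded iC mcos (M := 1)) => u; exact: cos_max.
  by apply: (intbleM_bounded iS msin (M := 1)) => u; exact: sin_max.
have Dn n : 0 < n.+1%:R^-1 :> R by rewrite invr_gt0.
have cvK : \int[lam]_u (sinc2_prod n.+1%:R^-1 u * inverse_kernel x u) @[n --> \oo]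
    --> \int[lam]_u inverse_kernel x u.
  apply: (dominated_cvg_Rintegral (g := fun u => `|inverse_kernel x u|)).
  - move=> n; apply: measurable_funM; last exact: intble_meas iK.
    exact: intble_meas (intble_sinc2_prod (Dn n)).
  - move=> u; rewrite -[X in _ --> X]mul1r; apply: cvgM; last exact: cvg_cst.
    have cv : sinc2_prod n.+1%:R^-1 u @[n --> \oo] --> \prod_(i < m) \prod_(j < d) (1 : R).
      apply: (cvg_prod_seq (l := fun=> \prod_(j < d) (1 : R))) => i.
      by apply: (cvg_prod_seq (l := fun=> (1 : R))) => j; exact: cvg_sinc2.
    by move: cv; rewrite [X in _ --> X -> _]big1// => i _; rewrite big1.
  - move=> n u; have /andP[s0 s1] := sinc2_prod_01 u (Dn n).
    by rewrite normrM (ger0_norm s0) ler_piMl.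
  - exact: intble_norm.
have Rh := @norm_hausdorff R R.
rewrite -(cvg_lim Rh (@tent_prod_cvg x)) -(cvg_lim Rh cvK); congr (limn _).
by apply/funext => n; rewrite regularized_inversion.
Qed.

End inversion.

Lemma measurable_fun_param d1 d2 (T1 : measurableType d1) (T2 : measurableType d2)
    (R : realType) (m2 : {sigma_finite_measure set T2 -> \bar R}) (F : T1 -> T2 -> R) :
  measurable_fun setT (fun z => F z.1 z.2) ->
  measurable_fun setT (fun x => \int[m2]_y F x y).
Proof.
move=> mF; have mE : measurable_fun setT (fun z : T1 * T2 => (F z.1 z.2)%:E).
  exact/measurable_EFinP.
apply: (@measurableT_comp _ _ _ _ _ _ (@fine R)) => //.
have mp := measurable_funepos mE; have mn := measurable_funeneg mE.
have hp := @measurable_fun_fubini_tonelli_F _ _ T1 T2 R m2 _ mp (@funepos_ge0 _ _ _).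
have hn := @measurable_fun_fubini_tonelli_F _ _ T1 T2 R m2 _ mn (@funeneg_ge0 _ _ _).
rewrite (_ : (fun x => _) = fubini_F m2 (fun z : T1 * T2 => (F z.1 z.2)%:E)^\+
   \- fubini_F m2 (fun z : T1 * T2 => (F z.1 z.2)%:E)^\-)%E; first exact: emeasurable_funB.
apply/funext => x /=; rewrite [LHS]integralE /fubini_F.
by congr (_ - _)%E; apply: eq_integral => y _; rewrite ?funeposE ?funenegE.
Qed.

(** * Integrability of the Fourier transform *)

Section transforms.
Context (R : realType) (m d : nat).
Local Notation V := (m.-tuple (Rvec R d)).
Local Notation lam := (lebesgue_tuple R m d).
Local Notation normc := (@ComplexField.Normc.normc R).
Local Notation leb := (@lebesgue_measure R).
Local Notation c x i j := (tnth (tnth x i) j).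
Variable f : V -> R.
Hypothesis fi : intble lam f.
Local Notation A := (cos_transform f).
Local Notation B := (sin_transform f).

Lemma fourierE u : fourier f u = (A u +i* - B u)%C.
Proof.
rewrite /fourier /Cintegral; congr (_ +i* _)%C.
  by apply: eq_Rintegral => y _; rewrite /expi /= cosN mul0r subr0.
rewrite /sin_transform -mulN1r -RintegralZl//; last exact: intble_f_sin.
by apply: eq_Rintegral => y _; rewrite /expi /= sinN mul0r addr0 mulrN mulN1r.
Qed.

Lemma normc_fourier u : normc (fourier f u) = Num.sqrt (A u ^+ 2 + B u ^+ 2).
Proof. by rewrite fourierE /= sqrrN. Qed.

Lemma measurable_cos_transform : measurable_fun setT A.
Proof.
apply: (@measurable_fun_param _ _ _ _ _ lam (fun u y => f y * cos (2 * pi * dotv u y))).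
apply: measurable_funM.
  by apply: (measurableT_comp (intble_meas fi)); exact: measurable_snd.
apply: measurableT_comp; first exact: measurable_cos.
by apply: measurable_funM => //; exact: measurable_dotv.
Qed.

Lemma measurable_sin_transform : measurable_fun setT B.
Proof.
apply: (@measurable_fun_param _ _ _ _ _ lam (fun u y => f y * sin (2 * pi * dotv u y))).
apply: measurable_funM.
  by apply: (measurableT_comp (intble_meas fi)); exact: measurable_snd.
apply: measurableT_comp; first exact: measurable_sin.
by apply: measurable_funM => //; exact: measurable_dotv.
Qed.

Lemma measurable_normc_fourier : measurable_fun setT (fun u => normc (fourier f u)).
Proof.
under eq_fun do rewrite normc_fourier.
apply: measurableT_comp; first by apply: continuous_measurable_fun; exact: sqrt_continuous.
by apply: measurable_funD; apply: measurable_funX;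
  [exact: measurable_cos_transform|exact: measurable_sin_transform].
Qed.

Lemma cos_transform_le u : `|A u| <= normc (fourier f u).
Proof. by rewrite normc_fourier -sqrtr_sqr ler_wsqrtr// lerDl sqr_ge0. Qed.

Lemma sin_transform_le u : `|B u| <= normc (fourier f u).
Proof. by rewrite normc_fourier -sqrtr_sqr ler_wsqrtr// lerDr sqr_ge0. Qed.

Lemma normc_fourier_le u : normc (fourier f u) <= 2 * \int[lam]_y `|f y|.
Proof.
have h (g : V -> R) : measurable_fun setT g -> (forall y, `|g y| <= 1) ->
    `|\int[lam]_y (f y * g y)| <= \int[lam]_y `|f y|.
  move=> mg g1; have ig := intbleM_bounded fi mg g1.
  apply: (le_trans (le_normr_Rintegral measurableT ig)).
  apply: Rintegral_le; [exact: intble_norm|exact: intble_norm|].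
  by move=> y; rewrite normrM ler_piMr.
have mt : measurable_fun setT (fun y : V => 2 * pi * dotv u y).
  by apply: measurable_funM => //; exact: measurable_dotv2.
have hA : `|A u| <= \int[lam]_y `|f y|.
  apply: h => [|y]; last exact: cos_max.
  by apply: measurableT_comp => //; exact: measurable_cos.
have hB : `|B u| <= \int[lam]_y `|f y|.
  apply: h => [|y]; last exact: sin_max.
  by apply: measurableT_comp => //; exact: measurable_sin.
rewrite normc_fourier; apply: (@le_trans _ _ (`|A u| + `|B u|)); last first.
  by rewrite mulr_natl mulr2n lerD.
rewrite -[leRHS]ger0_norm ?addr_ge0// -sqrtr_sqr ler_wsqrtr//.
by rewrite sqrrD !real_normK ?num_real// addrAC lerDl mulrn_wge0// mulr_ge0.
Qed.

(** The indicator of the cube [-1, 1]^(md): an integrable majorant of the indicator of the unit ball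
    that factors over the coordinates. *)
Definition unit_box (u : V) : R :=
  \prod_(i < m) \prod_(j < d) \1_(`[-1, 1]%classic : set R) (c u i j).

Lemma intble_unit_box : intble lam unit_box.
Proof.
have i1 : intble leb (\1_(`[-1, 1]%classic : set R)) by exact: integrable_indic_itv.
have row : intble (power_measure leb d)
    (fun v => \prod_(j < d) \1_(`[-1, 1]%classic : set R) (tnth v j)).
  by have [] := @Rintegral_power_prod _ _ R leb d (fun=> \1_(`[-1, 1]%classic : set R)).
by have [] := @Rintegral_power_prod _ _ R (power_measure leb d) m (fun=> fun v =>
   \prod_(j < d) \1_(`[-1, 1]%classic : set R) (tnth v j)).
Qed.

Lemma unit_box_ge0 u : 0 <= unit_box u.
Proof. by rewrite prodr_ge0// => i _; rewrite prodr_ge0// => j _; rewrite indicE. Qed.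

Lemma unit_box1 u : normv u <= 1 -> unit_box u = 1.
Proof.
move=> u1; rewrite /unit_box big1// => i _; rewrite big1// => j _.
rewrite indicE mem_set//= in_itv/= -ler_norml.
apply: le_trans u1; rewrite /normv -sqrtr_sqr ler_wsqrtr//.
rewrite /dotv (bigD1 i)//= (bigD1 j)//= -addrA expr2 lerDl addr_ge0//.
  by rewrite sumr_ge0// => k _; rewrite -expr2 sqr_ge0.
by rewrite sumr_ge0// => k _; rewrite sumr_ge0// => l _; rewrite -expr2 sqr_ge0.
Qed.

Lemma measurable_normv : measurable_fun setT (@normv R m d).
Proof.
apply: measurableT_comp; first by apply: continuous_measurable_fun; exact: sqrt_continuous.
apply: measurable_sum => i; apply: measurable_sum => j.
by apply: measurable_funM; exact: measurable_coord.
Qed.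

Variable q : R.
Hypothesis q1 : 1 <= q.
Hypothesis fq : (\int[lam]_u (normc (fourier f u) * normv u `^ q)%R%:E < +oo)%E.

(* Inside the unit ball the transform is bounded, outside the moment condition
   takes over. *)
Lemma intble_normc_fourier : intble lam (fun u => normc (fourier f u)).
Proof.
have nc0 u : 0 <= normc (fourier f u) by rewrite normc_fourier sqrtr_ge0.
have im : intble lam (fun u => normc (fourier f u) * normv u `^ q).
  apply/integrableP; split.
    apply/measurable_EFinP; apply: measurable_funM; first exact: measurable_normc_fourier.
    apply: (@measurableT_comp _ _ _ _ _ _ (@powR R ^~ q)); first exact: measurable_powR.
    exact: measurable_normv.
  apply: le_lt_trans fq; rewrite le_eqVlt; apply/orP; left; apply/eqP.
  by apply: eq_integral => u _; rewrite /= ger0_norm// mulr_ge0// powR_ge0.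
apply: (intble_le measurable_normc_fourier _
  (intbleD (intbleZl (2 * \int[lam]_y `|f y|) intble_unit_box) im)) => u.
rewrite ger0_norm//; have [u1|u1] := leP (normv u) 1.
  by rewrite unit_box1// mulr1 (le_trans (normc_fourier_le u))// lerDl mulr_ge0// powR_ge0.
rewrite -[leLHS]add0r; apply: lerD.
  rewrite mulr_ge0 ?unit_box_ge0// mulr_ge0// Rintegral_ge0//.
by rewrite ler_peMr// (le_trans (ltW u1))// le1r_powR// ltW.
Qed.

Lemma intble_cos_transform : intble lam A.
Proof.
exact: (intble_le measurable_cos_transform cos_transform_le intble_normc_fourier).
Qed.

Lemma intble_sin_transform : intble lam B.
Proof.
exact: (intble_le measurable_sin_transform sin_transform_le intble_normc_fourier).
Qed.

End transforms.

(** * A continuous kernel as a mixture of products of waves *)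

Section mixture.
Context (R : realType) (m d : nat).
Local Notation V := (m.-tuple (Rvec R d)).
Local Notation lam := (lebesgue_tuple R m d).
Local Notation normc := (@ComplexField.Normc.normc R).

Definition trig (b : bool) (t : R) : R := if b then sin t else cos t.

Definition wave (b : bool) (v x : Rvec R d) : R :=
  trig b (2 * pi * \sum_(j < d) tnth v j * tnth x j).

Lemma wave_le1 b v x : `|wave b v x| <= 1.
Proof. by case: b; rewrite ?sin_max ?cos_max. Qed.

Lemma measurable_wave2 b : measurable_fun setT (fun z : Rvec R d * Rvec R d => wave b z.1 z.2).
Proof.
apply: measurableT_comp.
  by case: b; [exact: measurable_sin|exact: measurable_cos].
apply: measurable_funM => //; apply: measurable_sum => j; apply: measurable_funM.
  by apply: measurableT_comp (measurable_tnth j) measurable_fst.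
by apply: measurableT_comp (measurable_tnth j) measurable_snd.
Qed.

(* exp (2 i pi u.x) is expanded as a sum of products of one wave per argument, since
   only products behave well under Hoeffding projections. *)
Definition phase (s : {ffun 'I_m -> bool}) : R[i] := \prod_(i < m) (if s i then 'i%C else 1).

Lemma normc_phase s : normc (phase s) = 1.
Proof.
rewrite /phase; elim/big_ind : _ => [|x y x1 y1|i _]; first exact: ComplexField.Normc.normc1.
  by rewrite ComplexField.Normc.normcM x1 y1 mulr1.
by case: (s i); rewrite ?ComplexField.Normc.normc1//= expr0n expr1n add0r sqrtr1.
Qed.

Lemma expiD (a b : R) : expi (a + b) = expi a * expi b.
Proof. by rewrite /expi cosD sinD; apply/eqP; rewrite eq_complex/= [sin a * _ + _]addrC !eqxx. Qed.

(** The product of the cos + i sin is expanded over the choice of a cosine or a sine for each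
    argument. These 2^m choices are the origin of the factors 2^m and 2^(2m) in the statement. *)
Lemma expi_sum (th : 'I_m -> R) : expi (\sum_(i < m) th i) =
  \sum_(s : {ffun 'I_m -> bool}) phase s * (\prod_(i < m) trig (s i) (th i))%:C%C.
Proof.
have -> : expi (\sum_(i < m) th i) = \prod_(i < m) expi (th i).
  apply: (big_morph (@expi R) expiD); by rewrite /expi cos0 sin0.
have E i : expi (th i) = \sum_(b : bool) (if b then 'i%C else 1) * (trig b (th i))%:C%C.
  rewrite big_bool /expi /trig; apply/eqP; rewrite eq_complex/=.
  by rewrite !(mul0r, mul1r, mulr0, subr0, add0r, addr0, sub0r, oppr0) !eqxx.
under eq_bigr do rewrite E.
rewrite bigA_distr_bigA/=; apply: eq_bigr => s _.
by rewrite big_split/= rmorph_prod.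
Qed.

Variable f : V -> R.
Hypothesis fi : intble lam f.
Hypotheses (iA : intble lam (cos_transform f)) (iB : intble lam (sin_transform f)).

(** The waves are real, so taking real parts in the whole expansion leaves a real coefficient, no
    larger than the modulus of the transform. *)
Definition mix_coef (s : {ffun 'I_m -> bool}) (u : V) : R :=
  complex.Re (fourier f u * phase s).

Lemma mix_coef_le s u : `|mix_coef s u| <= normc (fourier f u).
Proof.
rewrite -[leRHS]mulr1 -(normc_phase s) -ComplexField.Normc.normcM /mix_coef.
by case: (fourier f u * phase s) => a b /=; rewrite -sqrtr_sqr ler_wsqrtr// lerDl sqr_ge0.
Qed.

Lemma intble_mix_coef s : intble lam (mix_coef s).
Proof.
have := intbleD (intbleZl (complex.Re (phase s)) iA) (intbleZl (complex.Im (phase s)) iB).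
congr (lam.-integrable _ _); apply/funext => u /=.
rewrite /mix_coef (fourierE fi); case: (phase s) => a b /=.
by rewrite mulNr opprK mulrC [b * _]mulrC.
Qed.

Hypothesis fc : continuous_kernel f.

Lemma mixture_representation x : f x = \sum_(s : {ffun 'I_m -> bool})
  \int[lam]_u (mix_coef s u * \prod_(i < m) wave (s i) (tnth u i) (tnth x i)).
Proof.
rewrite (fourier_inversion fi fc x iA iB) -Rintegral_sum; last first.
  move=> s _; apply: (intbleM_bounded (intble_mix_coef s) (M := 1)).
    apply: measurable_prod => i _.
    apply: (@measurableT_comp _ _ _ _ _ _ (fun z : Rvec R d * Rvec R d => wave (s i) z.1 z.2)
      _ (fun u => (tnth u i, tnth x i))); first exact: measurable_wave2.
    by apply: measurable_fun_pair => //; exact: measurable_tnth.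
  move=> u; rewrite normr_prod prodr_ile1// => i _; rewrite normr_ge0/= wave_le1//.
apply: eq_Rintegral => u _.
have Re_sum (I : finType) (z : I -> R[i]) : complex.Re (\sum_i z i) = \sum_i complex.Re (z i).
  by apply: (big_morph (@complex.Re R)) => // -[a b] [a' b'].
have ReMr (z : R[i]) (r : R) : complex.Re (z * r%:C%C) = complex.Re z * r.
  by case: z => a b /=; rewrite mulr0 subr0.
transitivity (complex.Re (fourier f u * expi (2 * pi * dotv u x))).
  by rewrite (fourierE fi) /expi /= mulNr opprK.
have -> : 2 * pi * dotv u x = \sum_(i < m) 2 * pi * \sum_(j < d) tnth (tnth u i) j * tnth (tnth x i) j.
  by rewrite /dotv mulr_sumr.
rewrite expi_sum mulr_sumr Re_sum; apply: eq_bigr => s _.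
by rewrite mulrA ReMr.
Qed.

End mixture.

(** * Hoeffding components of mixtures of products *)

Section sorted_tuples.
Variables (R : nmodType) (p : nat).
Local Notation lto := (fun i j : 'I_p => (i < j)%N).

Lemma sorted_enum_ord (S : {set 'I_p}) : sorted lto (enum S).
Proof.
have -> : enum S = [seq i <- enum 'I_p | i \in S] by rewrite enumT.
apply: sorted_filter; first by move=> y x z; exact: ltn_trans.
by have := iota_ltn_sorted 0 p; rewrite -val_enum_ord sorted_map.
Qed.

Lemma sorted_tupleE q (s : q.-tuple 'I_p) :
  sorted lto s = (#|[set x in s]%SET| == q) && (enum [set x in s]%SET == s).
Proof.
have lto_tr : transitive lto by move=> y x z; exact: ltn_trans.
have lto_irr : irreflexive lto by move=> x; exact: ltnn.
apply/idP/andP => [ss|[_ /eqP <-]]; last exact: sorted_enum_ord.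
have us := sorted_uniq lto_tr lto_irr ss.
split; first by rewrite cardsE (card_uniqP us) size_tuple.
apply/eqP; apply: (irr_sorted_eq lto_tr lto_irr) => //; first exact: sorted_enum_ord.
by move=> x; rewrite mem_enum inE.
Qed.

(** An increasing tuple is the enumeration of the set of its entries; the sums of the Hoeffding
    recursion thus become sums over subsets. *)
Lemma sum_sorted_tuples q (F : {set 'I_p} -> R) :
  \sum_(s : q.-tuple 'I_p | sorted lto s) F [set x in s]%SET =
  \sum_(S : {set 'I_p} | #|S| == q) F S.
Proof.
pose h (s : q.-tuple 'I_p) : {set 'I_p} := [set x in s]%SET.
(* The inverse map, from sets to tuples, needs a default index, so p = 0 is treated apart. *)
have [p0|p0] := posnP p.
  case: q h => [|q] h.
    rewrite (big_pred1 [tuple]) => [|s]; last by rewrite (tuple0 s); apply/esym/eqP.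
    rewrite (big_pred1 finset.set0) => [|S]; last by rewrite cards_eq0.
    by congr F; apply/setP => x; rewrite !inE.
  rewrite big_pred0 => [|s]; last by exfalso; move: (leq_ltn_trans (leq0n _) (ltn_ord (thead s))); rewrite p0.
  rewrite big_pred0 // => S; apply/negbTE; rewrite neq_ltn; apply/orP; left.
  by rewrite (leq_ltn_trans (max_card _))// card_ord p0.
pose i0 : 'I_p := Ordinal p0.
pose h' (S : {set 'I_p}) : q.-tuple 'I_p := insubd (nseq_tuple q i0) (enum S).
rewrite [RHS](reindex_onto h h') => [|S /eqP Sq]; last first.
  apply/setP => x; rewrite inE; change (x \in val (h' S) = (x \in S)).
  by rewrite /h' val_insubd -cardE Sq eqxx mem_enum.
apply: eq_bigl => s; rewrite sorted_tupleE -/(h s).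
have [hq|//] := boolP (#|h s| == q) => /=.
by rewrite -val_eqE /h' val_insubd -cardE hq.
Qed.

(** Isolates the empty set, which gives the mean of the kernel, and the full set, which gives the
    component being defined. *)
Lemma sum_by_card (F : {set 'I_p} -> R) : (0 < p)%N ->
  \sum_(S : {set 'I_p}) F S =
  F finset.set0 + (\sum_(1 <= q < p) \sum_(S : {set 'I_p} | #|S| == q) F S) + F finset.setT.
Proof.
move=> p0.
have cp (S : {set 'I_p}) : (#|S| < p.+1)%N by rewrite ltnS -[leqRHS]card_ord max_card.
rewrite (partition_big (fun S => Ordinal (cp S)) xpredT)//=.
transitivity (\sum_(q < p.+1) \sum_(S : {set 'I_p} | #|S| == q) F S).
  by apply: eq_bigr => q _; apply: eq_bigl => S; rewrite -val_eqE.
rewrite -(big_mkord xpredT (fun q => \sum_(S : {set 'I_p} | #|S| == q) F S)).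
rewrite big_ltn// (big_cat_nat (n := p))//= -addrA; congr (_ + (_ + _)).
  by rewrite (big_pred1 finset.set0)// => S; rewrite cards_eq0.
rewrite big_nat1 (big_pred1 finset.setT)// => S.
apply/eqP/eqP => [Sp|->]; last by rewrite cardsT card_ord.
by apply/eqP; rewrite eqEcard finset.subsetT cardsT card_ord Sp leqnn.
Qed.

End sorted_tuples.

(** * The Hoeffding recursion for symmetrised products *)

Section symmetric_products.
Variables (R : realType) (T : Type) (m : nat) (t0 : T).
Variables (b : 'I_m -> T -> R) (mu : 'I_m -> R).

(** A single product is not symmetric. Averaging over permutations lets positions be relabelled
    together with their arguments, see [sym_prod_perm]. *)
Definition sym_prod (S : {set 'I_m}) (X : 'I_m -> T) : R :=
  (m`!%:R)^-1 * \sum_(s : 'S_m) \prod_(k < m)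
    (if k \in S then b (s k) (X k) - mu (s k) else mu (s k)).

Definition below (p : nat) : {set 'I_m} := [set k : 'I_m | (k < p)%N]%SET.

Definition hsym p (x : p.-tuple T) : R := sym_prod (below p) (fun k => nth t0 x k).

(** The partial mean of the symmetrised product over the arguments from p on; at the empty tuple it
    is the full mean. *)
Definition gsym p (x : p.-tuple T) : R :=
  (m`!%:R)^-1 * \sum_(s : 'S_m) \prod_(k < m)
    (if (k < p)%N then b (s k) (nth t0 x k) else mu (s k)).

Lemma sym_prod_perm (S : {set 'I_m}) (X : 'I_m -> T) (g : 'S_m) :
  sym_prod [set k | g k \in S]%SET (fun k => X (g k)) = sym_prod S X.
Proof.
congr (_ * _); rewrite (reindex_inj (mulgI g)); apply: eq_bigr => s _ /=.
rewrite [RHS](reindex_inj (@perm_inj _ g)); apply: eq_bigr => k _.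
by rewrite inE permM.
Qed.

Lemma eq_sym_prod (S : {set 'I_m}) (X X' : 'I_m -> T) : (forall k, k \in S -> X k = X' k) ->
  sym_prod S X = sym_prod S X'.
Proof.
move=> XX'; congr (_ * _); apply: eq_bigr => s _; apply: eq_bigr => k _.
by case: ifPn => // /XX' ->.
Qed.

(** With A k = 0 for k >= p, the product of the A k + mu expands over all subsets, and those not
    contained in [below p] contribute nothing. *)
Lemma gsym_expand p (x : p.-tuple T) :
  gsym x = \sum_(S : {set 'I_m} | S \subset below p) sym_prod S (fun k => nth t0 x k).
Proof.
rewrite /gsym /sym_prod -big_distrr/= exchange_big/=; congr (_ * _).
apply: eq_bigr => s _.
pose A (k : 'I_m) := if (k < p)%N then b (s k) (nth t0 x k) - mu (s k) else 0.
transitivity (\prod_(k < m) (A k + mu (s k))).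
  by apply: eq_bigr => k _; rewrite /A; case: ifP => _; rewrite ?subrK ?add0r.
rewrite bigA_distr/= [RHS]big_mkcond/=; apply: eq_bigr => S _; case: ifPn => [/fintype.subsetP sS|].
  apply: eq_bigr => k _; case: ifPn => // /sS; rewrite inE => kp.
  by rewrite /A kp.
move=> /fintype.subsetPn[k kS]; rewrite inE => /negbTE kp.
by rewrite (bigD1 k)//= kS /A kp mul0r.
Qed.

Lemma perm_extending (q : nat) (s : seq 'I_m) : uniq s -> size s = q ->
  exists g : 'S_m, forall k : 'I_m, (k < q)%N -> g k = nth k s k.
Proof.
move=> us sq; pose L := s ++ enum (~: [set x in s]%SET)%SET.
have szL : size L == m.
  by rewrite size_cat -cardE -(card_uniqP us) -(cardsE (mem s)) finset.cardsC card_ord.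
have uL : uniq L.
  rewrite cat_uniq us enum_uniq andbT/=; apply/hasPn => x.
  by rewrite mem_enum !inE.
have inj : injective (tnth (Tuple szL)) by apply/tuple_uniqP.
exists (perm inj) => k kq; rewrite permE (tnth_nth k)/= /L nth_cat sq kq//.
Qed.

Lemma sum_sets_below p (F : {set 'I_m} -> R) (pm : (p <= m)%N) :
  \sum_(S : {set 'I_m} | S \subset below p) F S =
  \sum_(S : {set 'I_p}) F [set widen_ord pm i | i in S]%SET.
Proof.
have winj : injective (widen_ord pm) by move=> i j /(congr1 val)/= ?; exact: val_inj.
rewrite (reindex_onto (fun S : {set 'I_p} => [set widen_ord pm i | i in S]%SET)
   (fun S' : {set 'I_m} => [set i | widen_ord pm i \in S']%SET)).
  apply: eq_bigl => S; apply/andP; split.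
    by apply/fintype.subsetP => k /imsetP[i _ ->]; rewrite inE/=.
  by apply/eqP/setP => i; rewrite inE mem_imset.
move=> S' /fintype.subsetP S'p; apply/setP => k; apply/imsetP/idP => [[i + ->]|kS'].
  by rewrite inE.
have kp : (k < p)%N by have := S'p _ kS'; rewrite inE.
have E : widen_ord pm (Ordinal kp) = k by exact: val_inj.
by exists (Ordinal kp); rewrite ?inE E.
Qed.

(** A permutation that carries the first q positions onto the entries of s reduces an arbitrary set
    of positions to an initial segment. *)
Lemma hsym_subtuple p q (x : p.-tuple T) (s : q.-tuple 'I_p) (pm : (p <= m)%N) :
  uniq s -> (q <= p)%N ->
  hsym [tuple tnth x (tnth s j) | j < q] =
  sym_prod [set widen_ord pm i | i in [set y in s]]%SET (fun k => nth t0 x k).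
Proof.
move=> us qp; pose s' := [seq widen_ord pm i | i <- s].
have winj : injective (widen_ord pm) by move=> i j /(congr1 val)/= ?; exact: val_inj.
have us' : uniq s' by rewrite map_inj_uniq.
have [g gE] : exists g : 'S_m, forall k : 'I_m, (k < q)%N -> g k = nth k s' k.
  by apply: perm_extending => //; rewrite size_map size_tuple.
rewrite -(sym_prod_perm _ _ g) /hsym.
have gS k : (g k \in [set widen_ord pm i | i in [set y in s]]%SET) = (k < q)%N.
  apply/imsetP/idP => [[i + +]|kq].
    rewrite inE => /tnthP[j ij] gk.
    have jm : (j < m)%N by apply: leq_trans (ltn_ord j) (leq_trans qp pm).
    have : g (Ordinal jm) = widen_ord pm i.
      rewrite gE/=; last exact: ltn_ord.
      by rewrite (nth_map i) ?size_tuple//= [in RHS]ij (tnth_nth i).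
    by rewrite -gk => /perm_inj <-; exact: (ltn_ord j).
  exists (tnth s (Ordinal kq)); first by rewrite inE mem_tnth.
  rewrite gE// (nth_map (tnth s (Ordinal kq))) ?size_tuple//.
  by congr widen_ord; rewrite [RHS](tnth_nth (tnth s (Ordinal kq))).
have -> : [set k | g k \in [set widen_ord pm i | i in [set y in s]]%SET]%SET = below q.
  by apply/setP => k; rewrite !inE gS.
apply: eq_sym_prod => k; rewrite inE => kq.
have -> : nth t0 [tuple tnth x (tnth s j) | j < q] k = tnth x (tnth s (Ordinal kq)).
  by rewrite -(tnth_mktuple (fun j => tnth x (tnth s j))) (tnth_nth t0).
rewrite gE// (nth_map (tnth s (Ordinal kq))) ?size_tuple//= (tnth_nth t0)/=.
by rewrite [in LHS](tnth_nth (tnth s (Ordinal kq))).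
Qed.

(* Symmetric products of centred factors satisfy the recursion defining the Hoeffding
   components: expand the product of the b = (b - mu) + mu over all subsets. *)
Lemma hsym_recursion p (x : p.-tuple T) : (0 < p)%N -> (p <= m)%N ->
  gsym x - gsym [tuple] -
  \sum_(1 <= q < p) \sum_(s : q.-tuple 'I_p | sorted (fun i j : 'I_p => (i < j)%N) s)
    hsym [tuple tnth x (tnth s j) | j < q] = hsym x.
Proof.
move=> p0 pm; pose H (S : {set 'I_p}) := sym_prod [set widen_ord pm i | i in S]%SET (fun k => nth t0 x k).
have g0 : gsym [tuple] = H finset.set0.
  rewrite /H imset0 /gsym /sym_prod; congr (_ * _).
  by apply: eq_bigr => s _; apply: eq_bigr => k _; rewrite inE.
have hT : hsym x = H finset.setT.
  rewrite /H /hsym; congr sym_prod; apply/setP => k; rewrite inE.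
  apply/idP/imsetP => [kp|[i _ ->]]; last exact: (ltn_ord i).
  by exists (Ordinal kp) => //; exact: val_inj.
rewrite gsym_expand (sum_sets_below _ pm) (sum_by_card _ p0) -/(H finset.set0) -/(H finset.setT) g0 hT.
rewrite [X in _ - X](_ : _ = \sum_(1 <= q < p) \sum_(S : {set 'I_p} | #|S| == q) H S).
  by move: (H _) (H _) (\sum_(1 <= _ < p) _) => h0 h1 h2; ring.
rewrite !big_nat; apply: eq_bigr => q /andP[_ qp].
rewrite -(sum_sorted_tuples q H); apply: eq_bigr => s ss.
apply: hsym_subtuple; last exact: ltnW.
apply: (sorted_uniq _ _ ss); first by move=> y z t; exact: ltn_trans.
by move=> y; exact: ltnn.
Qed.

End symmetric_products.

(** * Hoeffding components of the kernel *)

Section mixtures.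
Context (R : realType) dU (U : measurableType dU) (lam : {sigma_finite_measure set U -> \bar R}).
Context dT (T : measurableType dT) (law : probability T R) (m : nat) (t0 : T) (I : finType).
Variables (c : I -> U -> R) (w : I -> 'I_m -> U -> T -> R).
Hypothesis ci : forall s, intble lam (c s).
Hypothesis mw : forall s j, measurable_fun setT (fun z : U * T => w s j z.1 z.2).
Hypothesis w1 : forall s j u x, `|w s j u x| <= 1.

Definition wave_mean s j u : R := \int[law]_x w s j u x.

Lemma measurable_wave_at s j u : measurable_fun setT (w s j u).
Proof.
rewrite -[w s j u]/((fun z : U * T => w s j z.1 z.2) \o pair u).
exact: measurableT_comp.
Qed.

Lemma measurable_wave_of d' (Z : measurableType d') s j (h : Z -> U) (g : Z -> T) :
  measurable_fun setT h -> measurable_fun setT g ->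
  measurable_fun setT (fun z => w s j (h z) (g z)).
Proof.
move=> mh mg; apply: (@measurableT_comp _ _ _ _ _ _ (fun z : U * T => w s j z.1 z.2) _
  (fun z => (h z, g z))) => //.
exact: measurable_fun_pair.
Qed.

Lemma intble_wave s j u : intble law (w s j u).
Proof.
by apply: (@intble_finite _ _ _ law _ 1) => [|x]; [exact: measurable_wave_at|exact: w1].
Qed.

Lemma measurable_wave_mean s j : measurable_fun setT (wave_mean s j).
Proof. exact: (@measurable_fun_param _ _ _ _ _ law (w s j)). Qed.

Lemma Rintegral_law_cst (a : R) : \int[law]_x a = a.
Proof. exact: mean_cst. Qed.

Lemma wave_mean_le1 s j u : `|wave_mean s j u| <= 1.
Proof.
apply: (le_trans (le_normr_Rintegral measurableT (intble_wave s j u))).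
rewrite -[leRHS](Rintegral_law_cst 1); apply: Rintegral_le => //.
- exact/intble_norm/intble_wave.
- exact: finite_measure_integrable_cst.
Qed.

Local Notation hs s u := (hsym t0 (fun j => w s j u) (fun j => wave_mean s j u)).
Local Notation gs s u := (gsym t0 (fun j => w s j u) (fun j => wave_mean s j u)).

Section factors.
Variables (s : I) (p : nat).

Lemma measurable_gsym (x : p.-tuple T) :
  measurable_fun setT (fun u => gs s u x).
Proof.
apply: measurable_funM => //; apply: measurable_sum => g; apply: measurable_prod => k _.
case: (ltnP k p) => _; last exact: measurable_wave_mean.
exact: measurable_wave_of.
Qed.

Lemma measurable_hsym :
  measurable_fun setT (fun z : p.-tuple T * U =>
    hs s z.2 z.1).
Proof.
apply: measurable_funM => //; apply: measurable_sum => g; apply: measurable_prod => k _.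
have mm : measurable_fun setT (fun z : p.-tuple T * U => wave_mean s (g k) z.2).
  exact: (measurableT_comp (measurable_wave_mean s (g k)) measurable_snd).
case: (boolP (k \in below m p)) => // kp; apply: measurable_funB => //.
rewrite inE in kp; apply: measurable_wave_of; first exact: measurable_snd.
under eq_fun do rewrite -(tnth_nth t0 _ (Ordinal kp)).
exact: (measurableT_comp (measurable_tnth (Ordinal kp)) measurable_fst).
Qed.

Lemma sum_perm_le (A : 'S_m -> R) (M : R) : (forall g, `|A g| <= M) ->
  `|(m`!%:R)^-1 * \sum_(g : 'S_m) A g| <= M.
Proof.
move=> AM; rewrite normrM ger0_norm ?invr_ge0//.
rewrite ler_pdivrMl ?ltr0n ?fact_gt0//.
apply: (le_trans (ler_norm_sum _ _ _)).
apply: (le_trans (ler_sum _ (fun g _ => AM g))).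
by rewrite sumr_const card_Sn -[leLHS]mulr_natl.
Qed.

Lemma gsym_le1 u (x : p.-tuple T) :
  `|gs s u x| <= 1.
Proof.
apply: sum_perm_le => g; rewrite normr_prod prodr_ile1// => k _.
by rewrite normr_ge0/=; case: ifP => _; rewrite ?w1 ?wave_mean_le1.
Qed.

Lemma hsym_le u (x : p.-tuple T) :
  `|hs s u x| <= 2 ^+ m.
Proof.
apply: sum_perm_le => g; rewrite normr_prod -[in leRHS](card_ord m) -prodr_const.
apply: ler_prod => k _; rewrite normr_ge0/=; case: ifP => _.
  rewrite (le_trans (ler_normB _ _))// (_ : 2 = 1 + 1 :> R)//.
  by rewrite lerD// ?w1 ?wave_mean_le1.
by rewrite (le_trans (wave_mean_le1 _ _ _))// ler1n.
Qed.

Lemma intble_gsym (x : p.-tuple T) :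
  intble lam (fun u => c s u * gs s u x).
Proof.
apply: (intbleM_bounded (ci s) (measurable_gsym x) (M := 1)) => u; exact: gsym_le1.
Qed.

Lemma intble_hsym (x : p.-tuple T) :
  intble lam (fun u => c s u * hs s u x).
Proof.
apply: (intbleM_bounded (ci s) _ (M := 2 ^+ m)) => [|u]; last exact: hsym_le.
exact: (measurableT_comp measurable_hsym (pair1_measurable x)).
Qed.

End factors.

Variable f : m.-tuple T -> R.
Hypothesis fE : forall x, f x =
  \sum_(s : I) \int[lam]_u (c s u * \prod_(i < m) w s i u (tnth x i)).
Hypothesis fsym : forall (g : 'S_m) x, f [tuple tnth x (g i) | i < m] = f x.

Lemma measurable_wave_prod s (g : 'I_m -> 'I_m) (x : m.-tuple T) :
  measurable_fun setT (fun u => \prod_(k < m) w s (g k) u (tnth x k)).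
Proof. by apply: measurable_prod => k _; exact: measurable_wave_of. Qed.

Lemma wave_prod_le1 s (g : 'I_m -> 'I_m) u (x : m.-tuple T) :
  `|\prod_(k < m) w s (g k) u (tnth x k)| <= 1.
Proof. by rewrite normr_prod prodr_ile1// => k _; rewrite normr_ge0 w1. Qed.

(** By symmetry f is the average of its values over permuted arguments; averaging the representation
    replaces each product by its symmetrisation. *)
Lemma symmetric_mixture x : f x = \sum_(s : I) \int[lam]_u (c s u *
   ((m`!%:R)^-1 * \sum_(g : 'S_m) \prod_(k < m) w s (g k) u (tnth x k))).
Proof.
have -> : f x = (m`!%:R)^-1 * \sum_(g : 'S_m) f [tuple tnth x ((g^-1)%g i) | i < m].
  under eq_bigr do rewrite fsym.
  by rewrite sumr_const card_Sn -[f x *+ _]mulr_natl mulKf.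
under eq_bigr do rewrite fE.
rewrite exchange_big/= big_distrr/=; apply: eq_bigr => s _.
have ig (g : 'S_m) : intble lam (fun u => c s u * \prod_(k < m) w s (g k) u (tnth x k)).
  apply: (intbleM_bounded (ci s) (measurable_wave_prod _ _ _) (M := 1)) => u.
  exact: wave_prod_le1.
transitivity ((m`!%:R)^-1 * \int[lam]_u (\sum_(g : 'S_m)
    (c s u * \prod_(k < m) w s (g k) u (tnth x k)))).
  rewrite Rintegral_sum//; congr (_ * _); apply: eq_bigr => g _.
  apply: eq_Rintegral => u _; congr (_ * _).
  rewrite (reindex_inj (@perm_inj _ g)); apply: eq_bigr => k _.
  by rewrite tnth_mktuple permK.
rewrite -RintegralZl//; last exact: intble_sum.
by apply: eq_Rintegral => u _; rewrite -big_distrr/= mulrCA.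
Qed.

(** Fubini brings the mean inside the frequency integral, where the product factors: arguments k < p
    keep their wave, the others leave its mean. *)
Lemma partial_mean_mixture p (x : p.-tuple T) :
  \int[power_measure law m]_y f [tuple nth (tnth y i) x i | i < m] =
  \sum_(s : I) \int[lam]_u
    (c s u * gs s u x).
Proof.
have PT : power_measure law m setT = 1%E by exact/power_measure_setT/probability_setT.
have i1 : intble (power_measure law m) (cst 1).
  apply/integrableP; split; first exact/measurable_EFinP.
  by under eq_integral do rewrite /= normr1; rewrite integral_cst// mul1e (_ : _ setT = 1%E) ?ltry.
under eq_Rintegral do rewrite symmetric_mixture.
pose F s (y : m.-tuple T) u := c s u * ((m`!%:R)^-1 * \sum_(g : 'S_m) \prod_(k < m)
   w s (g k) u (nth (tnth y k) x k)).
pose wf s (g : 'I_m -> 'I_m) (k : 'I_m) u := fun t : T => w s (g k) u (nth t x k).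
have mwf s (g : 'I_m -> 'I_m) k :
    measurable_fun setT (fun z : m.-tuple T * U => w s (g k) z.2 (nth (tnth z.1 k) x k)).
  apply: measurable_wave_of; first exact: measurable_snd.
  case: (ltnP k p) => kp.
    have E t : nth t x k = tnth x (Ordinal kp) by rewrite (tnth_nth t).
    by under eq_fun do rewrite E; exact: measurable_cst.
  under eq_fun do rewrite nth_default ?size_tuple//.
  exact: (measurableT_comp (measurable_tnth k) measurable_fst).
have mF s : measurable_fun setT (fun z : m.-tuple T * U => F s z.1 z.2).
  apply: measurable_funM; first exact: (measurableT_comp (intble_meas (ci s)) measurable_snd).
  by apply: measurable_funM => //; apply: measurable_sum => g; apply: measurable_prod.
have F1 s y u : `|F s y u| <= 1 * `|c s u|.
  rewrite mul1r /F normrM ler_piMr//; apply: sum_perm_le => g.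
  by rewrite normr_prod prodr_ile1// => k _; rewrite normr_ge0 w1.
have FE y : \sum_s \int[lam]_u (c s u * ((m`!%:R)^-1 * \sum_(g : 'S_m) \prod_(k < m)
    w s (g k) u (tnth [tuple nth (tnth y i) x i | i < m] k))) =
    \sum_s \int[lam]_u F s y u.
  apply: eq_bigr => s _; apply: eq_Rintegral => u _; congr (_ * (_ * _)).
  by apply: eq_bigr => g _; apply: eq_bigr => k _; rewrite tnth_mktuple.
under eq_Rintegral do rewrite FE.
have ic s := intble_norm (ci s).
rewrite Rintegral_sum; last first.
  by move=> s _; exact: (intble_fubini1 (mF s) i1 (ic s) (F1 s)).
apply: eq_bigr => s _; rewrite (Rfubini (mF s) i1 (ic s) (F1 s)).
apply: eq_Rintegral => u _.
have iw (g : 'S_m) k : intble law (wf s g k u).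
  apply: (@intble_finite _ _ _ law _ 1) => [|t]; last exact: w1.
  case: (ltnP k p) => kp.
    have E t : nth t x k = tnth x (Ordinal kp) by rewrite (tnth_nth t).
    by rewrite /wf; under eq_fun do rewrite E; exact: measurable_cst.
  rewrite /wf; under eq_fun do rewrite nth_default ?size_tuple//.
  exact: measurable_wave_at.
have ip (g : 'S_m) := Rintegral_power_prod (iw g).
rewrite /F RintegralZl//; last first.
  by apply: intbleZl; apply: intble_sum => g _; case: (ip g).
congr (_ * _); rewrite RintegralZl//; last first.
  by apply: intble_sum => g _; case: (ip g).
congr (_ * _); rewrite Rintegral_sum; last by move=> g _; case: (ip g).
apply: eq_bigr => g _; case: (ip g) => _ ->; apply: eq_bigr => k _.
rewrite /wf; case: (ltnP k p) => kp.
  have E t : nth t x k = tnth x (Ordinal kp) by rewrite (tnth_nth t).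
  by under eq_Rintegral do rewrite E; rewrite Rintegral_law_cst E.
by under eq_Rintegral do rewrite nth_default ?size_tuple//.
Qed.

Lemma hoeffding_g_mixture p (x : p.-tuple T) :
  hoeffding_g law f x = \sum_(s : I) \int[lam]_u
    (c s u * (gs s u x -
              gs s u [tuple])).
Proof.
(* The kernel mean is the same partial mean, taken at the empty tuple. *)
have -> : hoeffding_g law f x = \int[power_measure law m]_y f [tuple nth (tnth y i) x i | i < m] -
    \int[power_measure law m]_y f [tuple nth (tnth y i) [tuple] i | i < m].
  rewrite /hoeffding_g; congr (_ - _); apply: eq_Rintegral => y _.
  by congr f; apply: eq_from_tnth => i; rewrite tnth_mktuple nth_nil.
rewrite !(@partial_mean_mixture _ _) -sumrB; apply: eq_bigr => s _.
rewrite -RintegralB//; [|exact: intble_gsym|exact: intble_gsym].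
by apply: eq_Rintegral => u _; rewrite mulrBr.
Qed.

(** Both sides obey the same recursion in p: [hoeffdingE] on the left, [hsym_recursion] under the
    integral on the right. *)
Theorem hoeffding_mixture p (x : p.-tuple T) : (0 < p)%N -> (p <= m)%N ->
  hoeffding law f x = \sum_(s : I) \int[lam]_u
    (c s u * hs s u x).
Proof.
elim/ltn_ind: p x => p ih x p0 pm; rewrite hoeffdingE hoeffding_g_mixture.
pose h s u q (S : q.-tuple 'I_p) := hs s u
   [tuple tnth x (tnth S j) | j < q].
have ih' : \sum_(1 <= q < p)
    \sum_(S : q.-tuple 'I_p | sorted (fun i j : 'I_p => (i < j)%N) S)
      hoeffding law f [tuple tnth x (tnth S j) | j < q] =
  \sum_(s : I) \int[lam]_u \sum_(1 <= q < p)
    \sum_(S : q.-tuple 'I_p | sorted (fun i j : 'I_p => (i < j)%N) S) c s u * h s u q S.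
  transitivity (\sum_(1 <= q < p)
      \sum_(S : q.-tuple 'I_p | sorted (fun i j : 'I_p => (i < j)%N) S)
       \sum_(s : I) \int[lam]_u (c s u * h s u q S)).
    rewrite !big_nat; apply: eq_bigr => q /andP[q0 qp]; apply: eq_bigr => S _.
    by apply: ih => //; exact: leq_trans (ltnW qp) pm.
  under eq_bigr do rewrite exchange_big/=.
  rewrite exchange_big/=; apply: eq_bigr => s _.
  rewrite Rintegral_sum; last first.
    by move=> q _; apply: intble_sum => S _; exact: intble_hsym.
  by apply: eq_bigr => q _; rewrite Rintegral_sum// => S _; exact: intble_hsym.
rewrite ih' -sumrB; apply: eq_bigr => s _.
rewrite -RintegralB//; last 2 first.
- under eq_fun do rewrite mulrBr.
  by apply: intbleB; exact: intble_gsym.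
- by apply: intble_sum => q _; apply: intble_sum => S _; exact: intble_hsym.
apply: eq_Rintegral => u _.
rewrite -(hsym_recursion t0 (fun j => w s j u) (fun j => wave_mean s j u) x p0 pm).
rewrite [RHS]mulrBr; congr (_ - _).
by rewrite big_distrr/=; apply: eq_bigr => q _; rewrite big_distrr.
Qed.

Lemma measurable_hoeffding p : (0 < p)%N -> (p <= m)%N ->
  measurable_fun setT (hoeffding law f (p := p)).
Proof.
move=> p0 pm; rewrite (_ : hoeffding law f (p := p) = fun x => \sum_(s : I) \int[lam]_u
    (c s u * hs s u x)); last first.
  by apply/funext => x; exact: hoeffding_mixture.
apply: measurable_sum => s; apply: (@measurable_fun_param _ _ _ _ _ lam (fun x u =>
    c s u * hs s u x)).
apply: measurable_funM; first exact: (measurableT_comp (intble_meas (ci s)) measurable_snd).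
exact: measurable_hsym.
Qed.

End mixtures.

(** * The tail bound *)

(** Takes care of n = 1, where ln 1 = 0 leaves t unrestricted and the maximum is at most 2. The
    [+ 1] makes the bound hold for every G >= 0. *)
Lemma linear_le_quadratic (R : realFieldType) (G t : R) : 0 <= G ->
  t * 2 <= 8 + 4 * (G + 1) * t ^+ 2.
Proof.
move=> G0.
have h' := sqr_ge0 (2 * t - 1); nra.
Qed.

Section stationary_maxima.
Context dO (O : measurableType dO) (R : realType) (P : probability O R).
Context dT (T : measurableType dT) (X : int -> {RV P >-> T}).
Variable b : T -> R.
Hypotheses (mb : measurable_fun setT b) (b1 : forall x, `|b x| <= 1).

Definition sum_max (n : nat) (w : O) : R := \big[Num.max/0]_(0 <= k < n.+1)
  `|\sum_(a < k) (b (X a.+1%:Z w) - \int[distribution P (X 1)]_x b x)|.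

Lemma Rintegral_distribution : \int[distribution P (X 1)]_x b x = law_mean X b.
Proof.
apply: (@Rintegral_image _ _ _ _ R P (distribution P (X 1)) (X 1)) => //.
apply: (@intble_finite _ _ _ P _ 1) => [|w]; last exact: b1.
exact: measurableT_comp.
Qed.

Lemma sum_maxE n w : sum_max n w = 2 * maxsum (centered X b 0) 0 n w.
Proof.
have E k : \sum_(a < k) (b (X a.+1%:Z w) - \int[distribution P (X 1)]_x b x) =
    2 * psum (centered X b 0) (iota 0 k) w.
  rewrite -(big_mkord xpredT (fun a => b (X a.+1%:Z w) - \int[distribution P (X 1)]_x b x)).
  rewrite /psum /index_iota subn0 big_distrr/=; apply: eq_bigr => a _.
  by rewrite /centered addr0 Rintegral_distribution mulrC divfK.
apply/eqP; rewrite eq_le; apply/andP; split.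
  rewrite /sum_max big_seq; apply: bigmax_le => [|k].
    by rewrite mulr_ge0// maxsum_ge0.
  rewrite mem_index_iota ltnS => /andP[_ kn].
  by rewrite E normrM ger0_norm// ler_pM2l// maxsum_ge.
rewrite -ler_pdivlMl//; apply: maxsum_le => [|k kn].
  by rewrite mulr_ge0// /sum_max bigmax_ge_id.
rewrite ler_pdivlMl// -[leLHS](_ : `|2 * psum (centered X b 0) (iota 0 k) w| = _); last first.
  by rewrite normrM ger0_norm.
rewrite -E; apply: (@le_bigmax_seq _ _ _ _ 0 k xpredT
   (fun k => `|\sum_(a < k) (b (X a.+1%:Z w) - \int[distribution P (X 1)]_x b x)|)) => //.
by rewrite mem_index_iota.
Qed.

(** The maximal inequality concerns absolute values and needs mixing for both signs; the opposite
    sequence comes from the function -b. *)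
Lemma centered_opp : centered X (fun x => - b x) 0 = (fun i w => - centered X b 0 i w).
Proof.
apply/funext => i; apply/funext => w; rewrite /centered /law_mean -mulNr; congr (_ / _).
rewrite opprB addrC; congr (_ - _).
under eq_Rintegral do rewrite -mulN1r.
rewrite RintegralZl// ?mulN1r ?opprK//.
apply: (@intble_finite _ _ _ P _ 1) => [|v]; last exact: b1.
exact: measurableT_comp.
Qed.

Variables (g1 g2 : R).
Hypothesis statX : stationary X.
Hypotheses (g1_gt0 : 0 < g1) (g2_gt0 : 0 < g2).
Hypothesis alphaX : forall i : nat, (1 <= i)%N -> alpha X i <= g1 * expR (- (g2 * i%:R)).

Lemma sum_max_le n w : sum_max n w <= 2 * n%:R.
Proof. by rewrite sum_maxE ler_pM2l//; apply: maxsum_le_size => i w'; exact: centered_le1. Qed.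

Lemma measurable_sum_max n : measurable_fun setT (sum_max n).
Proof.
apply: measurable_bigmax => k; apply: measurableT_comp => //; apply: measurable_sum => a.
by apply: measurable_funB => //; exact: measurableT_comp.
Qed.

Lemma intble_exp_sum_max t n : 0 <= t -> intble P (fun w => expR (t * sum_max n w)).
Proof.
move=> t0; apply: (@intble_finite _ _ _ P _ (expR (t * (2 * n%:R)))) => [|w].
  apply: measurableT_comp; first exact: measurable_expR.
  by apply: measurable_funM => //; exact: measurable_sum_max.
by rewrite ger0_norm ?expR_ge0// ler_expR ler_wpM2l// sum_max_le.
Qed.

(** [centered] is halved, so [maximal_laplace] is used at 2t; hence the factors 2 and 4. *)
Lemma sum_max_laplace n t : (1 <= n)%N -> 0 < t -> 2 * t * ln n%:R ^+ 2 <= range_const g1 g2 ->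
  \int[P]_w expR (t * sum_max n w) <= expR (8 + 4 * (growth_const g1 g2 + 1) * t ^+ 2 * n%:R).
Proof.
move=> n1 t0 tn; have G0 := growth_const_gt0 g1_gt0 g2_gt0.
have [n2|n2] := leqP 2 n.
  under eq_Rintegral do rewrite sum_maxE mulrA [t * 2]mulrC.
  apply: le_trans (maximal_laplace g1_gt0 g2_gt0 _ _ n2 _ tn) _.
  - exact: mixing_seq_centered.
  - rewrite -centered_opp; apply: mixing_seq_centered => //; first exact: measurableT_comp.
    by move=> x; rewrite normrN.
  - by rewrite mulr_gt0.
  - rewrite ler_expR lerD2l ler_wpM2r// exprMn mulrA ler_wpM2r ?sqr_ge0//.
    rewrite mulrC; have -> : 2 ^+ 2 = 4 :> R by rewrite -natrX.
    by rewrite ler_pM2l// lerDl.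
have -> : n = 1%N by apply/eqP; rewrite eqn_leq n1 -ltnS n2.
apply: (@le_trans _ _ (\int[P]_w expR (t * 2))).
  apply: Rintegral_le; first exact: intble_exp_sum_max (ltW t0).
    exact: finite_measure_integrable_cst.
  by move=> w; rewrite ler_expR ler_wpM2l ?(ltW t0)// (le_trans (sum_max_le 1 w))// mulr1.
by rewrite mean_cst ler_expR mulr1 linear_le_quadratic// ltW.
Qed.

End stationary_maxima.

Section product_sums.
Variables (R : realType) (T : Type) (m : nat) (t0 : T).
Variables (b : 'I_m -> T -> R) (mu : 'I_m -> R).

Lemma sum_tuple_prod p k (F : 'I_p -> 'I_k -> R) :
  \sum_(i : p.-tuple 'I_k) \prod_(l < p) F l (tnth i l) = \prod_(l < p) \sum_(a < k) F l a.
Proof.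
rewrite bigA_distr_bigA/= (reindex (fun f : {ffun 'I_p -> 'I_k} => [tuple f l | l < p])).
  by apply: eq_bigr => f _; apply: eq_bigr => l _; rewrite tnth_mktuple.
exists (fun i : p.-tuple 'I_k => [ffun l => tnth i l]) => [f _|i _].
  by apply/ffunP => l; rewrite ffunE tnth_mktuple.
by apply/eq_from_tnth => l; rewrite tnth_mktuple ffunE.
Qed.

(** All p-tuples of indices are summed, repetitions included, so for each permutation the sum of
    products is a product of sums, and the m - p means factor out. *)
Lemma sum_hsym p k (Y : 'I_k -> T) (pm : (p <= m)%N) :
  \sum_(i : p.-tuple 'I_k) hsym t0 b mu [tuple Y (tnth i l) | l < p] =
  (m`!%:R)^-1 * \sum_(g : 'S_m)
    ((\prod_(l < p) \sum_(a < k) (b (g (widen_ord pm l)) (Y a) - mu (g (widen_ord pm l)))) *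
     \prod_(j < m | ~~ (j < p)%N) mu (g j)).
Proof.
rewrite -big_distrr/= exchange_big/=; congr (_ * _); apply: eq_bigr => g _.
rewrite -sum_tuple_prod big_distrl/=; apply: eq_bigr => i _.
rewrite (bigID (fun j : 'I_m => (j < p)%N))/=; congr (_ * _); last first.
  by apply: eq_bigr => j /negbTE jp; rewrite inE jp.
rewrite (big_ord_narrow pm); apply: eq_bigr => l _.
have -> : Y (tnth i l) = nth t0 [tuple Y (tnth i l) | l < p] (widen_ord pm l).
  by rewrite -(tnth_mktuple (fun l => Y (tnth i l)) l) (tnth_nth t0).
by rewrite inE (ltn_ord l : (widen_ord pm l < p)%N).
Qed.

End product_sums.

(* With b = t Y / p >= 1: r^b >= 1 + b (r - 1) for r the product of the M l / Y, then
   Jensen. The right-hand side only involves Laplace transforms of single factors. *)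
Lemma prod_le_exp_sum (R : realType) p (M : 'I_p -> R) (t Y : R) :
  (0 < p)%N -> 0 < Y -> p%:R <= t * Y -> (forall l, 0 <= M l) ->
  1 + t * Y / p%:R * (\prod_(l < p) (M l / Y) - 1) <=
  p%:R^-1 * \sum_(l < p) expR (t * (M l - Y)).
Proof.
move=> p0 Y0 tY M0; have pR : 0 < p%:R :> R by rewrite ltr0n.
set b := t * Y / p%:R.
have b1 : 1 <= b by rewrite ler_pdivlMr// mul1r.
pose sg := \sum_(l < p) (M l / Y - 1).
have prod_le : \prod_(l < p) (M l / Y) <= expR sg.
  rewrite /sg expR_sum; apply: ler_prod => l _; rewrite divr_ge0 ?(ltW Y0)//=.
  by rewrite (le_trans _ (expR_ge1Dx _))// addrC subrK.
(* Bernoulli's inequality r^b >= 1 + b (r - 1) at r = exp(sg), from two uses of 1 + y <= exp(y). *)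
have tilt : 1 + b * (expR sg - 1) <= expR (b * sg).
  have e0 := expR_gt0 sg.
  have h1 : 1 >= expR sg * (1 - sg).
    rewrite -[leRHS](mulfV (lt0r_neq0 e0)) ler_wpM2l ?(ltW e0)// -expRN.
    exact: expR_ge1Dx.
  have h2 : expR (b * sg) >= expR sg * (1 + (b - 1) * sg).
    have -> : b * sg = sg + (b - 1) * sg by ring.
    by rewrite expRD ler_wpM2l ?(ltW e0)// expR_ge1Dx.
  have h3 : (b - 1) * (expR sg * (1 - sg)) <= b - 1.
    by rewrite -[leRHS]mulr1 ler_wpM2l// subr_ge0.
  move: (expR sg) (expR (b * sg)) h2 h3 => e e' h2 h3.
  rewrite -(lerD2r (b - 1)) (le_trans _ (lerD h2 h3))//.
  by rewrite le_eqVlt; apply/orP; left; apply/eqP; ring.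
apply: (@le_trans _ _ (expR (b * sg))).
  apply: le_trans tilt; rewrite lerD2l ler_wpM2l ?(le_trans ler01 b1)//.
  by rewrite lerD2r.
(* Tangent of the exponential at b sg, the mean of the t (M l - Y); the linear terms cancel in the
   sum. *)
have E l : expR (t * (M l - Y)) >= expR (b * sg) * (1 + (t * (M l - Y) - b * sg)).
  rewrite -[t * (M l - Y)](subrK (b * sg)) [_ + b * sg]addrC expRD.
  rewrite ler_wpM2l ?expR_ge0//; apply: le_trans (expR_ge1Dx _).
  by rewrite addrC addrK.
rewrite ler_pdivlMl//; apply: le_trans (ler_sum _ (fun l _ => E l)).
rewrite -mulr_sumr big_split/= sumr_const card_ord sumrB sumr_const card_ord.
have -> : \sum_(l < p) t * (M l - Y) = (b * sg) *+ p.
  rewrite -[RHS]mulr_natl mulrA /b [p%:R * _]mulrC divfK ?lt0r_neq0//.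
  rewrite /sg mulr_sumr; apply: eq_bigr => l _.
  by rewrite [RHS]mulrBr mulr1 -mulrA [Y * _]mulrC divfK ?lt0r_neq0// mulrBr.
by rewrite subrr addr0 mulrC.
Qed.

(** * Markov's inequality for the mixture *)

Section tail.
Context (R : realType) dU (U : measurableType dU) (lam : {sigma_finite_measure set U -> \bar R}).
Context dO (O : measurableType dO) (P : probability O R).
Context dT (T : measurableType dT) (X : int -> {RV P >-> T}) (m : nat) (t0 : T) (I : finType).
Local Notation law := (distribution P (X 1)).
Variables (c : I -> U -> R) (w : I -> 'I_m -> U -> T -> R) (N : U -> R).
Hypothesis ci : forall s, intble lam (c s).
Hypothesis mw : forall s j, measurable_fun setT (fun z : U * T => w s j z.1 z.2).
Hypothesis w1 : forall s j u x, `|w s j u x| <= 1.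
Hypotheses (Ni : intble lam N) (cN : forall s u, `|c s u| <= N u).
Variable f : m.-tuple T -> R.
Hypothesis fE : forall x, f x =
  \sum_(s : I) \int[lam]_u (c s u * \prod_(i < m) w s i u (tnth x i)).
Hypothesis fsym : forall (g : 'S_m) x, f [tuple tnth x (g i) | i < m] = f x.
Variables (p n : nat) (pm : (p <= m)%N).
Hypothesis p0 : (0 < p)%N.

Local Notation mean := (wave_mean law w).
Local Notation hs s u := (hsym t0 (fun j => w s j u) (fun j => mean s j u)).
Local Notation V := (vstat X (hoeffding law f (p := p))).

Definition factor_max s (g : 'S_m) (l : 'I_p) (u : U) (v : O) : R :=
  sum_max X (w s (g (widen_ord pm l)) u) n v.

Definition perm_mean (A : 'S_m -> R) : R := (m`!%:R)^-1 * \sum_(g : 'S_m) A g.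

Lemma perm_mean_le (A B : 'S_m -> R) : (forall g, A g <= B g) -> perm_mean A <= perm_mean B.
Proof. by move=> AB; rewrite ler_wpM2l ?invr_ge0//; apply: ler_sum. Qed.

Lemma perm_mean_affine (a b : R) (A : 'S_m -> R) :
  perm_mean (fun g => a + b * A g) = a + b * perm_mean A.
Proof.
have m0 : m`!%:R != 0 :> R by rewrite pnatr_eq0 -lt0n fact_gt0.
rewrite /perm_mean big_split/= sumr_const card_Sn mulrDr -[a *+ _]mulr_natl mulKf//.
by rewrite -mulr_sumr mulrCA.
Qed.

Lemma perm_mean_cst (a : R) : perm_mean (fun=> a) = a.
Proof.
have m0 : m`!%:R != 0 :> R by rewrite pnatr_eq0 -lt0n fact_gt0.
by rewrite /perm_mean sumr_const card_Sn -[a *+ _]mulr_natl mulKf.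
Qed.

Lemma N_ge0 (s : I) u : 0 <= N u.
Proof. exact: le_trans (normr_ge0 _) (cN s u). Qed.

Lemma measurable_w s j u : measurable_fun setT (w s j u).
Proof. exact: measurable_wave_at. Qed.

Lemma factor_max_ge0 s g l u v : 0 <= factor_max s g l u v.
Proof. by rewrite /factor_max /sum_max bigmax_ge_id. Qed.

Lemma factor_max_le s g l u v : factor_max s g l u v <= 2 * n%:R.
Proof. by apply: sum_max_le; [exact: measurable_w|exact: w1]. Qed.

Lemma measurable_factor_max s g l :
  measurable_fun setT (fun z : U * O => factor_max s g l z.1 z.2).
Proof.
apply: measurable_bigmax => k; apply: measurableT_comp => //; apply: measurable_sum => a.
apply: measurable_funB.
  apply: (measurable_wave_of mw); first exact: measurable_fst.
  exact: (measurableT_comp _ measurable_snd).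
exact: (measurableT_comp (measurable_wave_mean law mw s (g (widen_ord pm l))) measurable_fst).
Qed.

Lemma measurable_vstat k : measurable_fun setT (V k).
Proof.
apply: measurable_sum => i.
apply: (@measurableT_comp _ _ _ _ _ _ (hoeffding law f (p := p)) _
  (fun v => [tuple X (tnth i j).+1%:Z v | j < p])).
  exact: (measurable_hoeffding law t0 ci mw w1 fE fsym p0 pm).
apply/measurable_fun_tnthP => j.
rewrite (_ : _ \o _ = X (tnth i j).+1%:Z); first exact: measurable_funP.
by apply/funext => v /=; rewrite tnth_mktuple.
Qed.

Lemma measurable_tail_event (x : R) :
  measurable [set v | x <= n%:R ^- p * \big[Num.max/0]_(1 <= k < n.+1) `|V k v|].
Proof.
rewrite -[X in measurable X]setTI; apply: (measurable_fun_le (f := cst x)) => //.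
apply: measurable_funM => //; apply: measurable_bigmax => k.
by apply: measurableT_comp => //; exact: measurable_vstat.
Qed.

Lemma sum_hsym_le s u v k : (k <= n)%N ->
  `|\sum_(i : p.-tuple 'I_k) hs s u
      [tuple X (tnth i j).+1%:Z v | j < p]| <=
  perm_mean (fun g => \prod_(l < p) factor_max s g l u v).
Proof.
move=> kn; rewrite (sum_hsym t0 _ _ (fun a : 'I_k => X a.+1%:Z v) pm).
rewrite normrM ger0_norm ?invr_ge0// ler_wpM2l ?invr_ge0//.
apply: (le_trans (ler_norm_sum _ _ _)); apply: ler_sum => g _.
rewrite normrM -[leRHS]mulr1 ler_pM// normr_prod; last first.
  by apply: prodr_ile1 => j _; rewrite normr_ge0 wave_mean_le1.
apply: ler_prod => l _; rewrite normr_ge0/=.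
apply: (@le_bigmax_seq _ _ _ _ 0 k xpredT (fun k => `|\sum_(a < k)
   (w s (g (widen_ord pm l)) u (X a.+1%:Z v) - mean s (g (widen_ord pm l)) u)|)) => //.
by rewrite mem_index_iota.
Qed.

Lemma prod_factor_max_le s u v :
  `|perm_mean (fun g => \prod_(l < p) factor_max s g l u v)| <= (2 * n%:R) ^+ p.
Proof.
apply: sum_perm_le => g; rewrite normr_prod -[in leRHS](card_ord p) -prodr_const.
apply: ler_prod => l _; rewrite normr_ge0/=.
by rewrite ger0_norm ?factor_max_ge0 ?factor_max_le.
Qed.

Lemma measurable_factor_max_of s g l v : measurable_fun setT (fun u => factor_max s g l u v).
Proof. exact: (measurableT_comp (measurable_factor_max s g l) (pair2_measurable v)). Qed.

Lemma intble_prod_factor_max s v : intble lam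
  (fun u => N u * perm_mean (fun g => \prod_(l < p) factor_max s g l u v)).
Proof.
apply: (intbleM_bounded Ni _ (M := (2 * n%:R) ^+ p)) => [|u]; last exact: prod_factor_max_le.
apply: measurable_funM => //; apply: measurable_sum => g; apply: measurable_prod => l _.
exact: measurable_factor_max_of.
Qed.

(** The right-hand side does not depend on k, so the bound passes to the maximum over k <= n. *)
Lemma vstat_le k v : (k <= n)%N -> `|V k v| <=
  \sum_(s : I) \int[lam]_u (N u * perm_mean (fun g => \prod_(l < p) factor_max s g l u v)).
Proof.
move=> kn.
pose h s u := \sum_(i : p.-tuple 'I_k) hs s u
      [tuple X (tnth i j).+1%:Z v | j < p].
have ih s : intble lam (fun u => c s u * h s u).
  under eq_fun do rewrite mulr_sumr.
  by apply: intble_sum => i _; exact: intble_hsym.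
have -> : V k v = \sum_(s : I) \int[lam]_u (c s u * h s u).
  rewrite /vstat; under eq_bigr do rewrite (hoeffding_mixture law t0 ci mw w1 fE fsym _ p0 pm).
  rewrite exchange_big/=; apply: eq_bigr => s _.
  rewrite -Rintegral_sum; last by move=> i _; exact: intble_hsym.
  by apply: eq_Rintegral => u _; rewrite mulr_sumr.
apply: (le_trans (ler_norm_sum _ _ _)); apply: ler_sum => s _.
apply: (le_trans (le_normr_Rintegral measurableT (ih s))).
apply: Rintegral_le; [exact: intble_norm|exact: intble_prod_factor_max|move=> u].
by rewrite normrM ler_pM ?sum_hsym_le.
Qed.

Variables (g1 g2 : R).
Hypothesis statX : stationary X.
Hypotheses (g1_gt0 : 0 < g1) (g2_gt0 : 0 < g2).
Hypothesis alphaX : forall i : nat, (1 <= i)%N -> alpha X i <= g1 * expR (- (g2 * i%:R)).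

Definition exp_mean (t Y : R) s u v : R := perm_mean (fun g =>
  p%:R^-1 * \sum_(l < p) expR (t * (factor_max s g l u v - Y))).

Lemma exp_mean_ge0 t Y s u v : 0 <= exp_mean t Y s u v.
Proof.
rewrite mulr_ge0 ?invr_ge0//; apply: sumr_ge0 => g _.
by rewrite mulr_ge0 ?invr_ge0//; apply: sumr_ge0 => l _; exact: expR_ge0.
Qed.

Lemma exp_mean_le t Y s u v : 0 < t -> 0 < Y -> exp_mean t Y s u v <= expR (t * (2 * n%:R)).
Proof.
move=> tpos Y0; rewrite -[leRHS]perm_mean_cst; apply: perm_mean_le => g.
rewrite ler_pdivrMl ?ltr0n//.
apply: (@le_trans _ _ (\sum_(l < p) expR (t * (2 * n%:R)))).
  apply: ler_sum => l _; rewrite ler_expR ler_wpM2l ?(ltW tpos)//.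
  by rewrite lerBlDr (le_trans (factor_max_le _ _ _ _ _))// lerDl ltW.
by rewrite sumr_const card_ord -[leLHS]mulr_natl.
Qed.

Lemma measurable_exp_mean t Y s :
  measurable_fun setT (fun z : U * O => exp_mean t Y s z.1 z.2).
Proof.
apply: measurable_funM => //; apply: measurable_sum => g.
apply: measurable_funM => //; apply: measurable_sum => l.
apply: measurableT_comp; first exact: measurable_expR.
apply: measurable_funM => //; apply: measurable_funB => //.
exact: measurable_factor_max.
Qed.

Lemma mean_exp_mean t Y s u : (1 <= n)%N -> 0 < t ->
  2 * t * ln n%:R ^+ 2 <= range_const g1 g2 ->
  \int[P]_v exp_mean t Y s u v <=
  expR (8 - t * Y + 4 * (growth_const g1 g2 + 1) * t ^+ 2 * n%:R).
Proof.
move=> n1 tpos tn; set B := expR _.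
have ie g l : intble P (fun v => expR (t * (factor_max s g l u v - Y))).
  have := intbleZl (expR (- (t * Y)))
    (intble_exp_sum_max X (measurable_w s (g (widen_ord pm l)) u) (w1 _ _ _) n (ltW tpos)).
  congr (_.-integrable _ _); apply/funext => v /=.
  by rewrite -expRD; congr (expR _)%:E; rewrite /factor_max; ring.
have eB g l : \int[P]_v expR (t * (factor_max s g l u v - Y)) <= B.
  have E v : expR (t * (factor_max s g l u v - Y)) =
      expR (- (t * Y)) * expR (t * sum_max X (w s (g (widen_ord pm l)) u) n v).
    by rewrite -expRD; congr expR; rewrite /factor_max; ring.
  under eq_Rintegral do rewrite E.
  rewrite RintegralZl//; last first.
    exact: (intble_exp_sum_max X (measurable_w s (g (widen_ord pm l)) u) (w1 _ _ _) n (ltW tpos)).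
  rewrite /B; have -> : forall a, 8 - t * Y + a = - (t * Y) + (8 + a) by move=> a; ring.
  rewrite expRD ler_wpM2l ?expR_ge0//.
  exact: (sum_max_laplace (measurable_w s (g (widen_ord pm l)) u) (w1 _ _ _) statX).
rewrite /exp_mean /perm_mean RintegralZl//; last first.
  by apply: intble_sum => g _; apply: intbleZl; apply: intble_sum => l _; exact: ie.
rewrite Rintegral_sum; last first.
  by move=> g _; apply: intbleZl; apply: intble_sum => l _; exact: ie.
rewrite -[B]perm_mean_cst; apply: perm_mean_le => g.
rewrite RintegralZl//; last by apply: intble_sum => l _; exact: ie.
rewrite Rintegral_sum; last by move=> l _; exact: ie.
rewrite ler_pdivrMl ?ltr0n//; apply: le_trans (ler_sum _ (fun l _ => eB g l)) _.
by rewrite sumr_const card_ord -[leLHS]mulr_natl.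
Qed.

(** Y is normalised so that n^p x is Y^p times the total mass #|I| F. Then [W] is at least this mass
    on the event, while its mean is at most the mass times [B]. *)
Theorem tail_bound (x t Y : R) : (1 <= n)%N -> 0 < t ->
  2 * t * ln n%:R ^+ 2 <= range_const g1 g2 ->
  0 < Y -> p%:R <= t * Y -> (0 < #|I|)%N -> 0 < \int[lam]_u N u -> 0 <= x ->
  #|I|%:R * (\int[lam]_u N u) * Y ^+ p = n%:R ^+ p * x ->
  (P [set v | (x <= n%:R ^- p * \big[Num.max/0]_(1 <= k < n.+1) `|V k v|)%R] <=
   (expR (8 - t * Y + 4 * (growth_const g1 g2 + 1) * t ^+ 2 * n%:R))%:E)%E.
Proof.
move=> n1 tpos tn Y0 tY I0 F0 x0 xY; set E := [set v | _]; set B := expR _.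
set F := \int[lam]_u N u in F0 xY.
have n0 : 0 < n%:R ^+ p :> R by rewrite exprn_gt0// ltr0n.
have KF : 0 < #|I|%:R * F by rewrite mulr_gt0// ltr0n.
have mE : measurable E := measurable_tail_event x.
pose W v := \sum_(s : I) \int[lam]_u (N u * exp_mean t Y s u v).
have iNE s v : intble lam (fun u => N u * exp_mean t Y s u v).
  apply: (intbleM_bounded Ni _ (M := expR (t * (2 * n%:R)))) => [|u].
    exact: (measurableT_comp (measurable_exp_mean t Y s) (pair2_measurable v)).
  by rewrite ger0_norm ?exp_mean_ge0 ?exp_mean_le.
have EW v : E v -> #|I|%:R * F <= W v.
  move=> Ev; set b := t * Y / p%:R.
  have b1 : 1 <= b by rewrite ler_pdivlMr ?ltr0n// mul1r.
  pose D s := \int[lam]_u (N u * perm_mean (fun g => \prod_(l < p) factor_max s g l u v)).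
  (* [prod_le_exp_sum] averaged over permutations and integrated against N. After summation over s
     the weights 1 - b and b recombine into the total mass. *)
  have D_le s : (1 - b) * F + b / Y ^+ p * D s <= \int[lam]_u (N u * exp_mean t Y s u v).
    rewrite /F /D -(RintegralZl (1 - b) measurableT Ni).
    rewrite -(RintegralZl (b / Y ^+ p) measurableT (intble_prod_factor_max s v)).
    rewrite -RintegralD//; last 2 first.
    - exact: intbleZl.
    - exact/intbleZl/intble_prod_factor_max.
    apply: Rintegral_le => //.
      by apply: intbleD; apply: intbleZl => //; exact: intble_prod_factor_max.
    move=> u; rewrite [(1 - b) * _]mulrC mulrCA -mulrDr ler_wpM2l ?(N_ge0 s)//.
    rewrite -perm_mean_affine; apply: perm_mean_le => g.
    apply: le_trans (prod_le_exp_sum p0 Y0 tY (fun l => factor_max_ge0 s g l u v)).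
    rewrite -/b big_split/= prodr_const card_ord exprVn.
    by rewrite le_eqVlt; apply/orP; left; apply/eqP; ring.
  have D_ge : n%:R ^+ p * x <= \sum_s D s.
    rewrite -ler_pdivlMl//; move: Ev; rewrite /E/= => Ev; apply: (le_trans Ev).
    rewrite ler_wpM2l ?invr_ge0 ?(ltW n0)// big_nat_cond; apply: bigmax_le => [|k].
      by apply: sumr_ge0 => s _; apply: Rintegral_ge0 => u _; rewrite mulr_ge0 ?(N_ge0 s)//
        mulr_ge0 ?invr_ge0//; apply: sumr_ge0 => g _; apply: prodr_ge0 => l _;
        exact: factor_max_ge0.
    by rewrite andbT => /andP[_ kn]; exact: vstat_le.
  rewrite -xY in D_ge; apply: le_trans (ler_sum _ (fun s _ => D_le s)).
  rewrite big_split/= sumr_const -[X in X + _]mulr_natl -mulr_sumr.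
  have bY : 0 <= b / Y ^+ p by rewrite divr_ge0 ?exprn_ge0 ?(ltW Y0)// (le_trans _ b1).
  apply: le_trans (lerD (lexx _) (ler_wpM2l bY D_ge)).
  have Yp : Y ^+ p != 0 by rewrite expf_neq0// lt0r_neq0.
  have -> : b / Y ^+ p * (#|I|%:R * F * Y ^+ p) = b * (#|I|%:R * F).
    by move: (_ * F) (Y ^+ p) Yp => z y y0; field.
  by rewrite le_eqVlt; apply/orP; left; apply/eqP; rewrite cardT; ring.
have i1 : intble P (cst (expR (t * (2 * n%:R)))) by exact: finite_measure_integrable_cst.
have mNE s : measurable_fun setT (fun z : O * U => N z.2 * exp_mean t Y s z.2 z.1).
  apply: measurable_funM; first exact: (measurableT_comp (intble_meas Ni) measurable_snd).
  apply: (@measurableT_comp _ _ _ _ _ _ (fun z : U * O => exp_mean t Y s z.1 z.2) _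
    (fun z : O * U => (z.2, z.1))); first exact: measurable_exp_mean.
  by apply: measurable_fun_pair; [exact: measurable_snd|exact: measurable_fst].
have dNE s v u : `|N u * exp_mean t Y s u v| <= cst (expR (t * (2 * n%:R))) v * N u.
  rewrite normrM [leRHS]mulrC (ger0_norm (N_ge0 s u)) ler_wpM2l ?(N_ge0 s)//.
  by rewrite ger0_norm ?exp_mean_ge0 ?exp_mean_le.
have iW : intble P W.
  by apply: intble_sum => s _; exact: (intble_fubini1 (mNE s) i1 Ni (dNE s)).
have W_le : \int[P]_v W v <= #|I|%:R * F * B.
  rewrite /W Rintegral_sum; last first.
    by move=> s _; exact: (intble_fubini1 (mNE s) i1 Ni (dNE s)).
  have Ws s : \int[P]_v \int[lam]_u (N u * exp_mean t Y s u v) <= F * B.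
    rewrite (Rfubini (mNE s) i1 Ni (dNE s)) mulrC /F -RintegralZl//.
    have iE u : intble P (exp_mean t Y s u).
      apply: (@intble_finite _ _ _ P _ (expR (t * (2 * n%:R)))) => [|v].
        exact: (measurableT_comp (measurable_exp_mean t Y s) (pair1_measurable u)).
      by rewrite ger0_norm ?exp_mean_ge0 ?exp_mean_le.
    have iN : intble lam (fun u => N u * \int[P]_v exp_mean t Y s u v).
      apply: (intbleM_bounded Ni _ (M := B)) => [|u].
        exact: (@measurable_fun_param _ _ _ _ _ P (exp_mean t Y s) (measurable_exp_mean t Y s)).
      rewrite ger0_norm ?mean_exp_mean//; apply: Rintegral_ge0 => v _; exact: exp_mean_ge0.
    under eq_Rintegral do rewrite RintegralZl//.
    apply: Rintegral_le => //; first exact: intbleZl.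
    by move=> u; rewrite mulrC ler_wpM2r ?(N_ge0 s)// mean_exp_mean.
  apply: le_trans (ler_sum _ (fun s _ => Ws s)) _.
  by rewrite sumr_const -[leLHS]mulr_natl mulrA.
rewrite -(@fineK _ (P E)) ?fin_num_measure// lee_fin.
rewrite -(ler_pM2l KF); apply: le_trans W_le.
rewrite -Rintegral_indic// -RintegralZl//; last first.
  by apply: (@intble_finite _ _ _ P _ 1) => [|v]; [exact: measurable_indic|rewrite indicE; case: (_ \in _); rewrite ?normr1 ?normr0].
apply: Rintegral_le => //.
  apply: intbleZl; apply: (@intble_finite _ _ _ P _ 1) => [|v]; first exact: measurable_indic.
  by rewrite indicE; case: (_ \in _); rewrite ?normr1 ?normr0.
move=> v; rewrite indicE; case: (boolP (v \in E)) => vE; last first.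
  rewrite mulr0; apply: sumr_ge0 => s _; apply: Rintegral_ge0 => u _.
  by rewrite mulr_ge0 ?(N_ge0 s)// exp_mean_ge0.
by rewrite mulr1; apply: EW; rewrite inE in vE.
Qed.

End tail.

(** * Rescaling of the exponent and choice of the rate *)

Lemma powR_exprVK (R : realType) (y : R) p : (0 < p)%N -> 0 <= y -> (y ^+ p) `^ p%:R^-1 = y.
Proof.
by move=> p0 y0; rewrite -powR_mulrn// -powRrM mulfV ?powRr1// pnatr_eq0 -lt0n.
Qed.

Lemma powRV_exprK (R : realType) (y : R) p : (0 < p)%N -> 0 <= y -> (y `^ p%:R^-1) ^+ p = y.
Proof.
move=> p0 y0; rewrite -powR_mulrn ?powR_ge0// -powRrM mulVf ?powRr1//.
by rewrite pnatr_eq0 -lt0n.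
Qed.

(** With D = 2^m F and Q = D^(1/p), one has x = (Q z)^p, while A and M are (Q^2 B)^p and (Q L^2)^p:
    the p-th roots are exact and Q^2 cancels. *)
Lemma exponent_reduction (R : realType) (F B L x : R) m p :
  (0 < p)%N -> 0 < F -> 0 < B -> 0 <= L -> 0 < x ->
  let z := (x / (2 ^+ m * F)) `^ p%:R^-1 in
  x `^ (2 / p%:R) / ((2 ^+ (2 * m) * F ^+ 2 * B ^+ p) `^ p%:R^-1 +
    x `^ p%:R^-1 * (2 ^+ m * F * L ^+ (2 * p)) `^ p%:R^-1) = z ^+ 2 / (B + z * L ^+ 2).
Proof.
move=> p0 F0 B0 L0 x0 z; set D := 2 ^+ m * F.
have D0 : 0 < D by rewrite mulr_gt0// exprn_gt0.
pose Q := D `^ p%:R^-1; have Q0 : 0 < Q by exact: powR_gt0.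
have z0 : 0 < z by rewrite powR_gt0// divr_gt0.
have xE : x = (Q * z) ^+ p.
  by rewrite exprMn !powRV_exprK ?(ltW D0) ?divr_ge0 ?(ltW D0) ?(ltW x0)// mulrC divfK ?lt0r_neq0.
have xp : x `^ p%:R^-1 = Q * z by rewrite xE powR_exprVK// mulr_ge0// ltW.
have -> : x `^ (2 / p%:R) = (Q * z) ^+ 2.
  by rewrite mulrC powRrM xp powR_mulrn// mulr_ge0// ltW.
have -> : 2 ^+ (2 * m) * F ^+ 2 * B ^+ p = (Q ^+ 2 * B) ^+ p.
  by rewrite mulnC exprM -exprMn -/D [RHS]exprMn -[Q ^+ 2 ^+ p]exprM mulnC exprM powRV_exprK// ltW.
rewrite powR_exprVK ?mulr_ge0 ?(ltW Q0) ?(ltW B0)//.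
have -> : D * L ^+ (2 * p) = (Q * L ^+ 2) ^+ p.
  by rewrite [RHS]exprMn powRV_exprK ?(ltW D0)// -exprM.
rewrite powR_exprVK ?mulr_ge0 ?sqr_ge0 ?(ltW Q0)// xp.
have den : 0 < B + z * L ^+ 2 by rewrite ltr_pwDl// mulr_ge0 ?sqr_ge0// ltW.
have -> : Q ^+ 2 * B + Q * z * (Q * L ^+ 2) = Q ^+ 2 * (B + z * L ^+ 2) by ring.
by rewrite exprMn -mulf_div divff ?mul1r// expf_neq0// lt0r_neq0.
Qed.

Section rate.
Variables (R : realType) (g1 g2 : R) (m : nat).
Hypotheses (g1_gt0 : 0 < g1) (g2_gt0 : 0 < g2).

Definition base_const : R := 64 * g1 `^ 3^-1 / (1 - expR (- (g2 / 3))).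
Definition absorb_const : R := (4 * (8 + m%:R))^-1.
(** The minimum q satisfies 8 q (growth + 1) <= base and 2 q <= range, so that q times the
    denominator of [tilt] is at most B + z L^2 as soon as base <= B. *)
Definition rate_const : R := absorb_const *
  Num.min (base_const / (8 * (growth_const g1 g2 + 1))) (range_const g1 g2 / 2).

Lemma base_const_gt0 : 0 < base_const.
Proof.
rewrite divr_gt0 ?mulr_gt0 ?powR_gt0// subr_gt0 -[ltRHS]expR0 ltr_expR.
by rewrite oppr_lt0 divr_gt0.
Qed.

Lemma absorb_const_gt0 : 0 < absorb_const.
Proof. by rewrite invr_gt0 mulr_gt0// ltr_wpDr. Qed.

Lemma rate_const_gt0 : 0 < rate_const.
Proof.
have G1 : 0 < 8 * (growth_const g1 g2 + 1).
  by apply: mulr_gt0 => //; apply: addr_gt0 => //; exact: growth_const_gt0.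
apply: mulr_gt0; first exact: absorb_const_gt0.
by rewrite lt_min; apply/andP; split; apply: divr_gt0 => //; [exact: base_const_gt0|exact: range_const_gt0].
Qed.

(* Near-optimal in t for the exponent - t n z + 4 (growth + 1) t^2 n, under the
   constraint 2 t L^2 <= range. *)
Definition tilt (z L : R) : R :=
  z / (8 * (growth_const g1 g2 + 1) + 2 * z * L ^+ 2 / range_const g1 g2).

Lemma tiltP (z L B : R) (n : nat) : 0 < z -> base_const <= B ->
  let t := tilt z L in
  [/\ 0 < t, 2 * t * L ^+ 2 <= range_const g1 g2,
      4 * (growth_const g1 g2 + 1) * t ^+ 2 * n%:R <= t * (n%:R * z) / 2 &
      rate_const * n%:R * (z ^+ 2 / (B + z * L ^+ 2)) <= absorb_const * (t * (n%:R * z))].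
Proof.
have G0 := growth_const_gt0 g1_gt0 g2_gt0; have r0 := range_const_gt0 g1_gt0 g2_gt0.
have K0 := base_const_gt0; have a0 := absorb_const_gt0.
rewrite /rate_const /tilt; move: (growth_const _ _) (range_const _ _) base_const absorb_const G0 r0 K0 a0.
move=> G r K a G0 r0 K0 a0 z0 KB /=.
have L2 := sqr_ge0 L; move: (L ^+ 2) L2 => l l0; set t := z / _.
pose den := 8 * (G + 1) + 2 * z * l / r.
have den1 : 8 * (G + 1) <= den by rewrite lerDl divr_ge0 ?mulr_ge0 ?(ltW z0) ?(ltW r0).
have G1 : 0 < 8 * (G + 1) by rewrite mulr_gt0// addr_gt0.
have den0 : 0 < den := lt_le_trans G1 den1.
have t0 : 0 < t by rewrite divr_gt0.
have tden : t * den = z by rewrite /t divfK// lt0r_neq0.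
clearbody t; have n0 : 0 <= n%:R :> R by [].
split=> //.
- rewrite -(ler_pM2r den0).
  have -> : 2 * t * l * den = 2 * l * z by rewrite -tden; ring.
  have -> : r * den = r * (8 * (G + 1)) + 2 * l * z.
    by rewrite /den mulrDr; congr (_ + _); rewrite mulrC divfK ?lt0r_neq0//; ring.
  by rewrite lerDr mulr_ge0 ?(ltW r0) ?(ltW G1).
- have -> : t * (n%:R * z) / 2 = t * n%:R * (z / 2) by ring.
  have -> : 4 * (G + 1) * t ^+ 2 * n%:R = t * n%:R * (4 * (G + 1) * t) by ring.
  rewrite ler_wpM2l// ?mulr_ge0 ?(ltW t0)//.
  have : 8 * (G + 1) * t <= z by rewrite -tden mulrC ler_wpM2l// ltW.
  by move: (G + 1) => g; lra.
- have Bl : 0 < B + z * l by rewrite ltr_pwDl ?mulr_ge0 ?(ltW z0)// (lt_le_trans K0).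
  rewrite mulrA ler_pdivrMr//.
  have -> : a * (t * (n%:R * z)) * (B + z * l) = t * (n%:R * z) * (a * (B + z * l)) by ring.
  have -> : forall q, a * q * n%:R * z ^+ 2 = t * (n%:R * z) * (a * (q * den)).
    by move=> q; rewrite -tden; ring.
  rewrite ler_wpM2l ?mulr_ge0 ?(ltW t0) ?(ltW z0)// ler_wpM2l ?(ltW a0)//.
  set q := Num.min _ _.
  have q1 : q * (8 * (G + 1)) <= K by rewrite -ler_pdivlMr// ge_min lexx.
  have q2 : q * 2 <= r by rewrite -ler_pdivlMr// ge_min lexx orbT.
  rewrite /den mulrDr lerD ?(le_trans q1)//.
  have -> : q * (2 * z * l / r) = q * 2 / r * (z * l) by ring.
  rewrite -[leRHS]mul1r ler_wpM2r ?mulr_ge0 ?(ltW z0)//.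
  by rewrite ler_pdivrMr// mul1r.
Qed.

(** Up to s = 4 (8 + m) the right-hand side is at least 6 exp(-1) >= 1; beyond, 8 - s/2 < -s/4. The
    proviso m <= s is what will give p <= t Y, the condition of [tail_bound]. *)
Lemma absorb (a s : R) : 0 <= a -> a <= 1 -> 0 <= s ->
  (m%:R <= s -> a <= expR (8 - s / 2)) -> a <= 6 * expR (- (absorb_const * s)).
Proof.
move=> a0 a1 s0 h; have c0 := absorb_const_gt0.
have M0 : 0 < 4 * (8 + m%:R) :> R by rewrite mulr_gt0// ltr_wpDr.
have [sM|sM] := leP s (4 * (8 + m%:R)).
  apply: (le_trans a1); rewrite -ler_pdivrMl// mulr1.
  have e1 : (6^-1 : R) <= expR (- 1).
    have h2 : (2^-1 : R) <= expR (- 2^-1).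
      by apply: le_trans (expR_ge1Dx _); lra.
    have -> : - 1 = - 2^-1 + - 2^-1 :> R by lra.
    rewrite expRD; have : (2^-1 * 2^-1 : R) <= expR (- 2^-1) * expR (- 2^-1) by rewrite ler_pM.
    by apply: le_trans; lra.
  apply: (le_trans e1); rewrite ler_expR lerN2 /absorb_const mulrC ler_pdivrMr// mul1r//.
have m0 : 0 <= m%:R :> R by [].
apply: (le_trans (h _)); first by lra.
apply: (@le_trans _ _ (expR (- (absorb_const * s)))).
  rewrite ler_expR.
  have a4 : absorb_const <= 8^-1.
    by rewrite lef_pV2 ?posrE//; lra.
  have : absorb_const * s <= 8^-1 * s by rewrite ler_wpM2r.
  by move: (absorb_const * s) => b; lra.
by rewrite ler_peMl ?expR_ge0// ler1n.
Qed.

End rate.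

Theorem theorem1 (R : realType) (m : nat) (gamma1 gamma2 : R) :
  (1 <= m)%N -> 0 < gamma1 -> 0 < gamma2 ->
  exists C : R, 0 < C /\
    forall (d n : nat) (dO : measure_display) (O : measurableType dO)
      (P : probability O R) (X : int -> {RV P >-> Rvec R d})
      (f : m.-tuple (Rvec R d) -> R) (q : R),
    (1 <= d)%N -> (1 <= n)%N ->
    stationary X ->
    (forall i : nat, (1 <= i)%N -> alpha X i <= gamma1 * expR (- (gamma2 * i%:R))) ->
    symmetric_kernel f ->
    (lebesgue_tuple R m d).-integrable setT (EFin \o f) ->
    continuous_kernel f ->
    1 <= q ->
    (\int[lebesgue_tuple R m d]_u
       (ComplexField.Normc.normc (fourier f u) * normv u `^ q)%R%:E < +oo)%E ->
    forall (p : nat) (x : R), (1 <= p)%N -> (p <= m)%N -> 0 < x ->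
    let A := 2 ^+ (2 * m) * L1norm (fourier f) ^+ 2 *
             (64 * gamma1 `^ 3^-1 / (1 - expR (- (gamma2 / 3)))
              + ln n%:R ^+ 4 / n%:R) ^+ p in
    let M := 2 ^+ m * L1norm (fourier f) * ln n%:R ^+ (2 * p) in
    (P [set w | (x <= n%:R ^- p *
          \big[Num.max/0]_(1 <= k < n.+1)
            `|vstat X (@hoeffding _ _ _ (distribution P (X 1)) m f p) k w|)%R]
     <= (6 * expR (- (C * n%:R * x `^ (2 / p%:R) /
           (A `^ p%:R^-1 + x `^ p%:R^-1 * M `^ p%:R^-1)))%R)%:E)%E.
Proof.
move=> m1 g1_gt0 g2_gt0; exists (rate_const gamma1 gamma2 m).
split; first exact: rate_const_gt0.
move=> d n dO O P X f q d1 n1 statX alphaX fsym fi fc q1 fq p x p0 pm x0; cbv zeta.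
have Fi := intble_normc_fourier fi q1 fq.
have iA := intble_cos_transform fi q1 fq; have iB := intble_sin_transform fi q1 fq.
set E := [set w | _]; set B := base_const gamma1 gamma2 + ln n%:R ^+ 4 / n%:R.
have ln0 : 0 <= ln n%:R :> R by rewrite ln_ge0// ler1n.
have BK : base_const gamma1 gamma2 <= B by rewrite lerDl divr_ge0 ?exprn_ge0.
have B0 : 0 < B := lt_le_trans (base_const_gt0 g1_gt0 g2_gt0) BK.
pose t0 : Rvec R d := [tuple 0 | _ < d].
pose w (s : {ffun 'I_m -> bool}) j (u : m.-tuple (Rvec R d)) x := wave (s j) (tnth u j) x.
have mw s j : measurable_fun setT (fun z : m.-tuple (Rvec R d) * Rvec R d => w s j z.1 z.2).
  apply: (@measurableT_comp _ _ _ _ _ _ (fun z : Rvec R d * Rvec R d => wave (s j) z.1 z.2)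
    _ (fun z => (tnth z.1 j, z.2))); first exact: measurable_wave2.
  apply: measurable_fun_pair; last exact: measurable_snd.
  exact: (measurableT_comp (measurable_tnth j) measurable_fst).
have w1 s j u y : `|w s j u y| <= 1 by exact: wave_le1.
have ci := intble_mix_coef fi iA iB.
have fE := mixture_representation fi iA iB fc.
have cN s u : `|mix_coef f s u| <= ComplexField.Normc.normc (fourier f u) by exact: mix_coef_le.
have mE : measurable E.
  exact: (measurable_tail_event X t0 ci mw w1 fE fsym n pm p0 x).
have PE : P E = (fine (P E))%:E by rewrite fineK// fin_num_measure.
have PE0 : 0 <= fine (P E) by rewrite fine_ge0.
have PE1 : fine (P E) <= 1 by rewrite -lee_fin -PE probability_le1.
have F0 : 0 <= L1norm (fourier f).
  by apply: Rintegral_ge0 => u _; rewrite (normc_fourier fi) sqrtr_ge0.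
(* If the transform has norm 0, then A = M = 0 and the quotient is 0 by the convention 1/0 = 0: the
   right-hand side is 6. *)
rewrite PE lee_fin; move: F0; rewrite le_eqVlt => /predU1P[F0|F0].
  have pV : p%:R^-1 != 0 :> R by rewrite invr_neq0// pnatr_eq0 -lt0n.
  rewrite -F0 expr0n/= !mulr0 !mul0r !powR0// mulr0 addr0 invr0 !mulr0 oppr0 expR0 mulr1.
  by rewrite (le_trans PE1)// ler1n.
rewrite -[rate_const _ _ _ * _ * _ / _]mulrA.
have := exponent_reduction m p0 F0 B0 ln0 x0.
rewrite -/(base_const _ _) -/B; set z := _ `^ _ => /= ->.
have D0 : 0 < 2 ^+ m * L1norm (fourier f) by rewrite mulr_gt0// exprn_gt0.
have z0 : 0 < z by rewrite powR_gt0// divr_gt0.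
have [t0_ tr tG tC] := tiltP m g1_gt0 g2_gt0 (ln n%:R) n z0 BK.
move: (tilt _ _ _ _) t0_ tr tG tC => t tpos tr tG tC.
(* The threshold Y = n z solves 2^m F Y^p = n^p x, with F the norm of the transform. *)
have Y0 : 0 < n%:R * z by rewrite mulr_gt0// ltr0n.
have s0 : 0 <= t * (n%:R * z) by rewrite mulr_ge0 ?(ltW tpos) ?(ltW Y0).
apply: le_trans (_ : 6 * expR (- (absorb_const R m * (t * (n%:R * z)))) <= _); last first.
  by rewrite ler_pM2l// ler_expR lerN2.
apply: absorb => // ms; rewrite -lee_fin -PE.
have ps : p%:R <= t * (n%:R * z) by apply: le_trans ms; rewrite ler_nat.
have cardI : #|{: {ffun 'I_m -> bool}}|%:R = 2 ^+ m :> R.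
  by rewrite card_ffun card_bool card_ord natrX.
apply: le_trans (tail_bound t0 ci mw w1 Fi cN fE fsym pm p0 statX g1_gt0 g2_gt0 alphaX
  n1 tpos tr Y0 ps _ F0 (ltW x0) _) _.
- by rewrite card_ffun card_bool card_ord expn_gt0.
- rewrite cardI exprMn powRV_exprK ?divr_ge0 ?(ltW x0) ?(ltW D0)//.
  by rewrite mulrCA [_ * (x / _)]mulrC divfK// lt0r_neq0.
- rewrite lee_fin ler_expR.
  by move: tG; set a := 4 * _ * _ * _; set b := t * (_ * _) => h; lra.
Qed.
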